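(* Let $\varphi : M^2 \to N^4 (\epsilon)$ be a non-CMC biconservative W-surface with flat normal bundle. Assume that $3 f^2 + K - \epsilon \neq 0$, $\nabla^\perp E_3 \neq 0$, $A_4 \neq 0$ and $\nabla_{E_2} E_2 \neq 0$ at any point. Then $M$ has constant Gaussian curvature $K = \epsilon$ if and only if, locally, \[ b_1 = - \frac{\dot f (3 - c f)}{\sqrt c\, f^{3/2} \sqrt{2 - c f}},\qquad a_2=\frac32\frac{\dot f}{f},\qquad \alpha=\sqrt c\, f^{3/2}\sqrt{2-cf},\qquad k_2=c f^2, \] where $c$ is a positive real constant and the mean curvature function $f=f(s)$ is a positive solution of \[ \ddot f f - \frac 5 2 \dot f^2 - \frac 2 3 \epsilon f^2 = 0 \] which satisfies $\dot f > 0$.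
   Context: $N^4(\epsilon)$, $\epsilon\in\mathbb R$, is the 4-dimensional space form (complete, simply connected) of constant sectional curvature $\epsilon$. Manifolds are connected and immersions are isometric. For a surface $\varphi:M^2\to N^4(\epsilon)$: $B$ is the second fundamental form, $A_\eta$ the shape operator in the normal direction $\eta$, $\nabla$ the Levi-Civita connection, $\nabla^\perp$ the normal connection, $H=\frac12\operatorname{trace}B$, $f=|H|$ the mean curvature function, $K$ the Gaussian curvature. The surface has flat normal bundle if the curvature of $\nabla^\perp$ vanishes. It is biconservative if $2\operatorname{trace}A_{\nabla^\perp_{(\cdot)}H}(\cdot)+\operatorname{grad}|H|^2=0$. It is a W-surface if there is a smooth $W:\mathbb R^2\to\mathbb R$ with nowhere zero gradient such that $W(f,K)=0$ on $M$. ''Non-CMC biconservative'' means biconservative with $H\neq0$, $\operatorname{grad}f\neq0$ and $A_{H/f}\neq f\,\mathrm{Id}$ at every point. Frame (all results are local; $M$ is taken to be a connected domain where the following is defined): $E_3=H/f$, $E_4$ is a unit normal section orthogonal to $E_3$, $A_3=A_{E_3}$, $A_4=A_{E_4}$, and $\{E_1,E_2\}$ is an orthonormal tangent frame with $A_3E_1=k_1E_1$, $A_3E_2=k_2E_2$. Flatness of the normal bundle gives $A_4E_1=\alpha E_1$, $A_4E_2=-\alpha E_2$ for a smooth function $\alpha$. The functions $a_i,b_i$ are defined by $\nabla_{E_1}E_1=-a_1E_2$, $\nabla_{E_2}E_2=a_2E_1$ and $b_i=\langle\nabla^\perp_{E_i}E_3,E_4\rangle$, $i=1,2$. Labelling convention: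 when $b_1b_2=0$ on $M$ and $\nabla^\perp E_3\neq0$ at every point (the first condition is automatic for the surfaces considered here), $E_1,E_2$ are labelled so that $b_1\neq0$ everywhere and $b_2=0$ on $M$. Sign convention: the signs of $E_1$ and $E_4$ are chosen so that $E_1(f)>0$ and $\alpha>0$ (then $E_1=\operatorname{grad}f/|\operatorname{grad}f|$). ''Locally'' means: around any point, in local coordinates $(s,t)$ in which the metric is $ds^2+g_{22}(s)dt^2$, $E_1=\partial/\partial s$, $E_2=g_{22}^{-1/2}\partial/\partial t$, and $f,k_1,k_2,\alpha,a_2,b_1,K$ depend only on $s$ (such coordinates exist for the surfaces considered here). The dot denotes $d/ds$. *)

(* Defs.v *)
From HB Require Import structures.
From mathcomp Require Import all_boot all_order all_algebra.
From mathcomp Require Import all_classical all_reals all_analysis.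

Set Implicit Arguments.
Unset Strict Implicit.
Unset Printing Implicit Defensive.

Import Order.TTheory GRing.Theory Num.Theory.
Import numFieldNormedType.Exports.

Local Open Scope classical_set_scope.
Local Open Scope ring_scope.

Section Smoothness.
Context {R : realType} {V W : normedModType R}.

Definition iter_derive (vs : seq V) (F : V -> W) : V -> W :=
  foldr (fun v G => fun x => 'D_v G x) F vs.

(* C^infinity on the open set U *)
Definition smooth_on (U : set V) (F : V -> W) : Prop :=
  forall (vs : seq V) (x : V), U x -> differentiable (iter_derive vs F) x.

End Smoothness.

(* cinv is only meaningful on the image of cdom. *)
Record chart (R : realType) (M : topologicalType) := Chart {
  cdom : set M;
  cmap : M -> 'rV[R]_2;
  cinv : 'rV[R]_2 -> M;
  cdom_open : open cdom;
  cimg_open : open (cmap @` cdom);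
  cmapK : forall p, cdom p -> cinv (cmap p) = p;
  cmap_continuous : {within cdom, continuous cmap};
  cinv_continuous : {within cmap @` cdom, continuous cinv}
}.

Definition smoothly_compatible (R : realType) (M : topologicalType)
    (x y : chart R M) : Prop :=
  smooth_on (cmap x @` (cdom x `&` cdom y)) (cmap y \o cinv x) /\
  smooth_on (cmap y @` (cdom x `&` cdom y)) (cmap x \o cinv y).

(* Smooth 2-manifold structure on M; the atlas need not be maximal. *)
Record surface (R : realType) (M : topologicalType) := Surface {
  atlas : set (chart R M);
  surface_hausdorff : hausdorff_space M;
  surface_second_countable : @second_countable M;
  surface_connected : connected [set: M];
  atlas_cover : forall p : M, exists2 x, atlas x & cdom x p;
  atlas_compatible : forall x y, atlas x -> atlas y -> smoothly_compatible x y
}.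

Definition local_coordinates (R : realType) (M : topologicalType)
    (S : surface R M) (x : chart R M) : Prop :=
  forall y, atlas S y -> smoothly_compatible x y.

Definition smooth_map (R : realType) (M : topologicalType) (S : surface R M)
    (W : normedModType R) (F : M -> W) : Prop :=
  forall x, atlas S x -> smooth_on (cmap x @` cdom x) (F \o cinv x).

Definition pair_vec (R : realType) (a b : R) : 'rV[R]_2 :=
  \row_i (if i == ord0 then a else b).
Definition e_s {R : realType} : 'rV[R]_2 := delta_mx 0 ord0.
Definition e_t {R : realType} : 'rV[R]_2 := delta_mx 0 ord_max.

(* N^4(eps) is realized in R^5 as the round sphere <x,x> = 1/eps (eps > 0), the
   hyperplane x_0 = 0 (eps = 0), or the sheet x_0 > 0 of the hyperboloid
   <x,x> = 1/eps of Minkowski space (eps < 0), with the metric induced by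
   [ambient_ip eps].  Its Levi-Civita connection is the flat derivative of R^5
   followed by the projection [space_form_proj] onto the tangent space. *)
Section SpaceForm.
Context {R : realType} (eps : R).
Implicit Types u v x : 'rV[R]_5.

Definition ambient_ip u v : R :=
  (if eps < 0 then -1 else 1) * (u 0 ord0 * v 0 ord0)
  + \sum_(i < 4) u 0 (lift ord0 i) * v 0 (lift ord0 i).

Definition space_form : set 'rV[R]_5 :=
  [set x : 'rV[R]_5 | if eps == 0 then x 0 ord0 = 0
           else ambient_ip x x = eps^-1 /\ (eps < 0 -> 0 < x 0 ord0)].

Definition space_form_normal x : 'rV[R]_5 :=
  if eps == 0 then delta_mx 0 ord0 else x.

Definition space_form_proj x v : 'rV[R]_5 :=
  let n := space_form_normal x in
  v - (ambient_ip v n / ambient_ip n n) *: n.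

End SpaceForm.

(* Tangent vectors of M at p are identified with their images under d(phi) in
   R^5, and vector fields on M with maps M -> R^5.  M carries the metric induced
   by phi.  The operators given by [xget 0] return the unique element of the
   set in question when phi is an immersion into N^4(eps) and the arguments are
   smooth and of the expected (tangent or normal) kind. *)
Section SurfaceGeometry.
Context {R : realType} (eps : R) {M : topologicalType} (S : surface R M)
        (phi : M -> 'rV[R]_5).
Local Notation vec := 'rV[R]_5.
Local Notation ip := (ambient_ip eps).
Implicit Types (p q : M) (u v w : vec) (X Y Z xi eta : M -> vec).

Definition isometric_immersion : Prop :=
  [/\ smooth_map S phi, forall p, space_form eps (phi p) &
      forall x p h, atlas S x -> cdom x p ->
        'D_h (phi \o cinv x) (cmap x p) = 0 -> h = 0].

Definition coord_field (x : chart R M) (h : 'rV[R]_2) : M -> vec :=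
  fun q => 'D_h (phi \o cinv x) (cmap x q).

Definition tangent_vec p : set vec :=
  [set v | exists x h, [/\ atlas S x, cdom x p & v = coord_field x h p]].

Definition normal_vec p : set vec :=
  [set w | space_form_proj eps (phi p) w = w /\
           forall u, tangent_vec p u -> ip w u = 0].

(* derivative at p of a map on M along the tangent vector v *)
Definition dirder (W : normedModType R) (F : M -> W) p v : W :=
  xget 0 [set w | exists x h, [/\ atlas S x, cdom x p, coord_field x h p = v &
                                  'D_h (F \o cinv x) (cmap x p) = w]].

Definition tan_part p v : vec :=
  xget 0 [set w | tangent_vec p w /\
                  forall u, tangent_vec p u -> ip (v - w) u = 0].

Definition nor_part p v : vec := space_form_proj eps (phi p) v - tan_part p v.

Definition tangent_field X : Prop :=
  smooth_map S X /\ forall p, tangent_vec p (X p).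

Definition normal_field xi : Prop :=
  smooth_map S xi /\ forall p, normal_vec p (xi p).

Definition nabla p v Y : vec := tan_part p (dirder Y p v).
Definition nabla_perp p v xi : vec := nor_part p (dirder xi p v).

(* Via d(phi), the Lie bracket is the bracket of maps into the flat R^5. *)
Definition bracket X Y : M -> vec :=
  fun p => dirder Y p (X p) - dirder X p (Y p).

(* curvature D_X D_Y Z - D_Y D_X Z - D_[X,Y] Z of a connection D *)
Definition curvature (D : M -> vec -> (M -> vec) -> vec) X Y Z p : vec :=
  D p (X p) (fun q => D q (Y q) Z) - D p (Y p) (fun q => D q (X q) Z)
  - D p (bracket X Y p) Z.

Definition gauss_curvature p : R :=
  xget 0 [set k | exists x, [/\ atlas S x, cdom x p &
    let X := coord_field x e_s in
    let Y := coord_field x e_t in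
    k = ip (curvature nabla X Y Y p) (X p)
        / (ip (X p) (X p) * ip (Y p) (Y p) - ip (X p) (Y p) ^+ 2)]].

(* B(v,w): w is extended to a field with constant coordinates. *)
Definition second_fundamental_form p v w : vec :=
  xget 0 [set b | exists x h, [/\ atlas S x, cdom x p, coord_field x h p = w &
                                  b = nor_part p (dirder (coord_field x h) p v)]].

Definition shape_operator p eta_p v : vec :=
  xget 0 [set w | tangent_vec p w /\ forall u, tangent_vec p u ->
                    ip w u = ip (second_fundamental_form p v u) eta_p].

Definition metric_trace p (b : vec -> vec -> vec) : vec :=
  xget 0 [set t | exists v w, [/\ tangent_vec p v, tangent_vec p w,
      ip v v = 1 /\ ip w w = 1, ip v w = 0 & t = b v v + b w w]].

Definition gradient (F : M -> R) p : vec :=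
  xget 0 [set w | tangent_vec p w /\ forall u, tangent_vec p u ->
                    ip w u = dirder F p u].

Definition mean_curvature_vector p : vec :=
  2^-1 *: metric_trace p (second_fundamental_form p).

Definition mean_curvature p : R :=
  Num.sqrt (ip (mean_curvature_vector p) (mean_curvature_vector p)).

Definition flat_normal_bundle : Prop :=
  forall X Y xi, tangent_field X -> tangent_field Y -> normal_field xi ->
  forall p, curvature nabla_perp X Y xi p = 0.

Definition biconservative : Prop :=
  forall p,
    2 *: metric_trace p
           (fun v w => shape_operator p (nabla_perp p v mean_curvature_vector) w)
    + gradient (fun q => mean_curvature q ^+ 2) p = 0.

(* H / f, which is the field E_3 of the adapted frames *)
Definition unit_mean_curvature p : vec :=
  (mean_curvature p)^-1 *: mean_curvature_vector p.

Definition nonCMC_biconservative : Prop :=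
  biconservative /\
  forall p, [/\ mean_curvature_vector p <> 0,
    gradient mean_curvature p <> 0 &
    ~ (forall v, tangent_vec p v ->
         shape_operator p (unit_mean_curvature p) v = mean_curvature p *: v)].

Definition W_surface : Prop :=
  exists W : 'rV[R]_2 -> R,
    [/\ smooth_on setT W,
        forall z, exists h, 'D_h W z != 0 &
        forall p, W (pair_vec (mean_curvature p) (gauss_curvature p)) = 0].

Section Frame.
Variables (E1 E2 E3 E4 : M -> vec).

Definition shape_coef xi X p : R := ip (shape_operator p (xi p) (X p)) (X p).

Definition k1 : M -> R := shape_coef E3 E1.
Definition k2 : M -> R := shape_coef E3 E2.
Definition alpha : M -> R := shape_coef E4 E1.
Definition a2 p : R := ip (nabla p (E2 p) E2) (E1 p).
Definition b1 p : R := ip (nabla_perp p (E1 p) E3) (E4 p).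
Definition b2 p : R := ip (nabla_perp p (E2 p) E3) (E4 p).

(* (E_1, E_2) also diagonalizes A_4: A_4 E_1 = alpha E_1 and
   A_4 E_2 = - alpha E_2 follow from flatness of the normal bundle. *)
Definition adapted_frame : Prop :=
  [/\ [/\ tangent_field E1, tangent_field E2, normal_field E3 & normal_field E4],
      forall p, E3 p = unit_mean_curvature p,
      forall p, ip (E4 p) (E4 p) = 1 /\ ip (E3 p) (E4 p) = 0,
      forall p, [/\ ip (E1 p) (E1 p) = 1, ip (E2 p) (E2 p) = 1
                  & ip (E1 p) (E2 p) = 0] &
      forall p, shape_operator p (E3 p) (E1 p) = k1 p *: E1 p /\
                shape_operator p (E3 p) (E2 p) = k2 p *: E2 p].

Definition nowhere_parallel xi : Prop :=
  forall p, exists2 v, tangent_vec p v & nabla_perp p v xi != 0.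

Definition labelling_convention : Prop :=
  (forall p, b1 p * b2 p = 0) -> nowhere_parallel E3 ->
  forall p, b1 p != 0 /\ b2 p = 0.

Definition sign_convention : Prop :=
  forall p, 0 < dirder mean_curvature p (E1 p) /\ 0 < alpha p.

End Frame.

Definition coord_s (x : chart R M) (q : M) : R := cmap x q 0 ord0.

Definition s_range (x : chart R M) : set R := coord_s x @` cdom x.

Definition depends_on_s (x : chart R M) (F : M -> R) (F_ : R -> R) : Prop :=
  forall q, cdom x q -> F q = F_ (coord_s x q).

(* coordinates (s,t) with metric ds^2 + g22(s) dt^2, E_1 = d/ds and
   E_2 = g22^(-1/2) d/dt *)
Definition adapted_coordinates (E1 E2 : M -> vec) (x : chart R M)
    (g22 : R -> R) : Prop :=
  local_coordinates S x /\
  forall q, cdom x q ->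
    [/\ ip (coord_field x e_s q) (coord_field x e_s q) = 1,
        ip (coord_field x e_s q) (coord_field x e_t q) = 0,
        ip (coord_field x e_t q) (coord_field x e_t q) = g22 (coord_s x q),
        E1 q = coord_field x e_s q &
        E2 q = (Num.sqrt (g22 (coord_s x q)))^-1 *: coord_field x e_t q].

End SurfaceGeometry.

(* Main.v *)
Require Import Defs.
From HB Require Import structures.
From mathcomp Require Import all_boot all_order all_algebra.
From mathcomp Require Import all_classical all_reals all_analysis.
From mathcomp Require Import ring lra.

Set Implicit Arguments.
Unset Strict Implicit.
Unset Printing Implicit Defensive.

Import Order.TTheory GRing.Theory Num.Theory.
Import numFieldNormedType.Exports.

Local Open Scope classical_set_scope.
Local Open Scope ring_scope.

(** Why the theorem holds.

In a chart the frame turns the immersion into functions on an open set of the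
plane: the principal curvatures [k1 = 2 f - k] and [k = k2] of [A_3], the
eigenvalue [al] of [A_4], and the coefficients [a1 = <D_E1 E2, E1>],
[a2 = <D_E2 E2, E1>], [b1], [b2] of the tangent and normal connections.  [A_4] is
diagonal together with [A_3] because flatness of the normal bundle makes them
commute and [A_3] is not umbilical ([A4_offdiagonal]).  The Gauss equation reads
[K = k1 k - al ^ 2 + eps] ([gauss_curvatureE]), so [K = eps] means
[k (2 f - k) = al ^ 2].  The formulas of the theorem satisfy this identity, which
is the easy implication.

Conversely, let [k (2 f - k) = al ^ 2].  Differentiate it along [E1] and [E2] and
insert the Codazzi and the biconservative equations: this gives
[2 f a2 = 3 E1(f)], [2 f a1 = - 3 E2(f)], [f E1(k) = 2 E1(f) k] and
[f E2(k) = 2 E2(f) (k - f)], while [b1] and [b2] are multiples of [E1(f)] and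
[E2(f)].  The commutator of [E1] and [E2], applied to [f] and to [k], yields the
mixed derivative [7 E1(f) E2(f) / (2 f)] of [f].  With all these values the Ricci
equation becomes [6 f E1(f) E2(f) / al ^ 3 = 0] ([ricci_forces_product_zero]), so
that [E2(f) = 0] since [E1(f) > 0].  Then [a1 = b2 = 0] and [E2(k) = 0], and only
ordinary differential equations along [E1] are left: [k / f ^ 2] is a constant
[c], the Gauss equation of the metric is the stated equation for [f], and
[(E1(f) ^ 2 + 4/9 eps f ^ 2) / f ^ 5] is a first integral, with value [A] say.

Coordinates [s], [t] must satisfy [E1 s = 1], [E2 s = 0], [E1 t = 0] and
[E2 t = f ^ (3/2)].  By the first integral [E1(f)] is a function of [f], so
[ds = df / E1(f)] can be integrated in one variable.  The same device gives [t]: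
a component [y] of the vector [E2] of R^5 has [E1 y = 0], and
[Y = E2(y) / f ^ (3/2)] satisfies [E1 Y = 0] and [E2 Y = - kap f ^ (3/2) y] with
the constant [kap = 9/4 A + 2 c]; thus [Y ^ 2 + kap y ^ 2] is constant, [Y] is a
function of [y], and [dt = dy / Y].  A component with [Y <> 0] exists because
[D_E2 E2] has the component [a2 > 0] along [E1] ([e2_component_moves]).  The map
[(s, t)] is inverted by the inverse function theorem ([local_inverse]). *)

(** * Smooth functions on open sets *)

Section SmoothCalculus.
Context {R : realType}.

Lemma differentiable_from_expansion (V W : normedModType R) (f : V -> W) (x : V)
    (L : {linear V -> W}) : continuous L ->
  (forall e, 0 < e -> \forall h \near (0:V), `|f (h + x) - f x - L h| <= e * `|h|) ->
  differentiable f x.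
Proof.
move=> cL fL.
have E : f \o shift x = cst (f x) + L +o_ 0 id.
  apply/eqaddoP => e e0; near=> h.
  rewrite [X in `|X|](_ : _ = f (h + x) - f x - L h); last first.
    by rewrite /= opprD addrA.
  near: h; exact: fL.
by apply/diff_locallyP; rewrite (diff_unique cL E).
Unshelve. all: by end_near. Qed.

Lemma near_eq_differentiable (V W : normedModType R) (f g : V -> W) (x : V) :
  (\near x, f x = g x) -> differentiable f x -> differentiable g x.
Proof.
move=> fg df; have [cL /eqaddoP E] := (diff_locallyP x f).1 df.
apply: (@differentiable_from_expansion _ _ _ _ ('d f x)) => // e e0.
have fgx := nbhs_singleton fg.
near=> h.
have <- : f (h + x) = g (h + x).
  by near: h; move: fg; rewrite (near_shift 0 x) /=; apply: filterS => h /=; rewrite subr0.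
rewrite -fgx; near: h; apply: filterS (E e e0) => h.
suff -> : (f \o shift x - (cst (f x) + 'd f x)) h = f (h + x) - f x - 'd f x h by [].
by rewrite /= opprD addrA.
Unshelve. all: by end_near. Qed.

Section Coinduction.
Context {V W : normedModType R}.
Implicit Types (U : set V) (F G : V -> W).

Lemma smooth_on_differentiable U F x : smooth_on U F -> U x -> differentiable F x.
Proof. by move=> sF Ux; apply: (sF [::]). Qed.

Lemma smooth_on_derive U F v : smooth_on U F -> smooth_on U (fun x => 'D_v F x).
Proof.
move=> sF vs x Ux; have := sF (rcons vs v) x Ux.
by rewrite /iter_derive foldr_rcons.
Qed.

Lemma smooth_on_subset U U' F : U' `<=` U -> smooth_on U F -> smooth_on U' F.
Proof. by move=> sU sF vs x /sU; apply: sF. Qed.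

(** Coinduction: when a family of differentiable functions is closed under directional
derivatives, all iterated derivatives of its members stay in it.  Equality is asked
on [U] only, because the derivatives are known only there. *)
Lemma smooth_on_coind U (P : (V -> W) -> Prop) F : open U ->
  (forall F, P F -> forall x, U x -> differentiable F x) ->
  (forall F v, P F -> exists2 G, P G & forall x, U x -> 'D_v F x = G x) ->
  P F -> smooth_on U F.
Proof.
move=> oU Pdiff Pder PF vs.
have [G PG FG] : exists2 G, P G & forall x, U x -> iter_derive vs F x = G x.
  elim: vs => [|v vs [G PG FG]]; first by exists F.
  have [G' PG' GG'] := Pder G v PG; exists G' => // x Ux /=.
  rewrite -GG' //; apply: near_eq_derive.
  by near=> z; apply: FG; near: z; apply: open_nbhs_nbhs.
move=> x Ux; apply: (@near_eq_differentiable _ _ G); last exact: Pdiff PG x Ux.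
by near=> z; apply/esym/FG; near: z; apply: open_nbhs_nbhs.
Unshelve. all: by end_near. Qed.

Lemma smooth_on_ext U F G : open U -> (forall x, U x -> F x = G x) ->
  smooth_on U F -> smooth_on U G.
Proof.
move=> oU FG sF.
apply: (@smooth_on_coind U (fun G => exists2 F, smooth_on U F &
  forall x, U x -> F x = G x)) => //; last by exists F.
- move=> {F G FG sF}G [F sF FG] x Ux.
  apply: (@near_eq_differentiable _ _ F); last exact: smooth_on_differentiable sF Ux.
  by near=> z; apply: FG; near: z; apply: open_nbhs_nbhs.
- move=> {F G FG sF}G v [F sF FG]; exists (fun x => 'D_v F x).
    by exists (fun x => 'D_v F x) => //; apply: smooth_on_derive.
  move=> x Ux; apply: near_eq_derive.
  by near=> z; apply/esym/FG; near: z; apply: open_nbhs_nbhs.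
Unshelve. all: by end_near. Qed.

End Coinduction.

Section Algebra.
Context {V : normedModType R}.
Implicit Types (U : set V) (F G : V -> R).

(** Sums, products and real powers of smooth functions: this family is closed under
differentiation by the Leibniz rule and the rule for powers. *)
Inductive smooth_expr U : (V -> R) -> Prop :=
| SE_smooth F : smooth_on U F -> smooth_expr U F
| SE_add F G : smooth_expr U F -> smooth_expr U G -> smooth_expr U (F + G)
| SE_mul F G : smooth_expr U F -> smooth_expr U G -> smooth_expr U (F * G)
| SE_pow F a : smooth_expr U F -> (forall x, U x -> 0 < F x) ->
    smooth_expr U (fun x => F x `^ a).

Lemma smooth_on_cst (W : normedModType R) U (c : W) : smooth_on U (cst c).
Proof.
suff H vs : exists c', iter_derive vs (cst c : V -> W) = cst c'.
  by move=> vs x _; have [c' ->] := H vs; exact: differentiable_cst.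
elim: vs => [|v vs [c' /= ->]]; first by exists c.
by exists 0; apply/funext => x; rewrite derive_cst.
Qed.

Lemma is_derive_powR_comp F a x v : differentiable F x -> 0 < F x ->
  is_derive x v (fun x => F x `^ a) (a * F x `^ (a - 1) * 'D_v F x).
Proof.
move=> dF F0.
have dp : is_derive (F x) 1 (fun y : R => y `^ a) (a * F x `^ (a - 1)) by exact: is_derive1_powR.
have dp' : differentiable (fun y : R => y `^ a) (F x) by apply/derivable1_diffP; case: dp.
have dc : differentiable ((fun y : R => y `^ a) \o F) x by exact: differentiable_comp.
apply: DeriveDef; first exact: diff_derivable.
rewrite (deriveE v dc) diff_comp //= -(deriveE v dF).
have -> : 'D_v F x = 'D_v F x *: (1 : R) by rewrite /GRing.scale /= mulr1.
rewrite linearZ /= -deriveE //; case: dp => _ ->.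
by rewrite /GRing.scale /= mulrC mulr1.
Qed.

Lemma smooth_expr_differentiable U F : smooth_expr U F ->
  forall x, U x -> differentiable F x.
Proof.
elim=> {F} [F sF|F G _ dF _ dG|F G _ dF _ dG|F a _ dF F0] x Ux.
- exact: smooth_on_differentiable sF Ux.
- by apply: differentiableD; [exact: dF | exact: dG].
- by apply: differentiableM; [exact: dF | exact: dG].
- apply: (@differentiable_comp _ _ _ _ F (fun y : R => y `^ a)); first exact: dF.
  by apply/derivable1_diffP; have [] := is_derive1_powR a (F0 x Ux).
Qed.

Lemma smooth_expr_derive U F v : open U -> smooth_expr U F ->
  exists2 G, smooth_expr U G & forall x, U x -> 'D_v F x = G x.
Proof.
move=> oU; elim=> {F} [F sF|F G sF [F' sF' eF] sG [G' sG' eG]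
  |F G sF [F' sF' eF] sG [G' sG' eG]|F a sF [F' sF' eF] F0].
- by exists (fun x => 'D_v F x) => //; apply/SE_smooth/smooth_on_derive.
- exists (F' + G') => [|x Ux]; first exact: SE_add.
  rewrite deriveD ?eF ?eG //; apply: diff_derivable.
    exact: smooth_expr_differentiable sF _ Ux.
  exact: smooth_expr_differentiable sG _ Ux.
- exists (F * G' + G * F') => [|x Ux]; first by apply: SE_add; apply: SE_mul.
  rewrite deriveM ?eF ?eG //; apply: diff_derivable.
    exact: smooth_expr_differentiable sF _ Ux.
  exact: smooth_expr_differentiable sG _ Ux.
- exists (cst a * (fun x => F x `^ (a - 1)) * F').
    apply: SE_mul => //; apply: SE_mul; last exact: SE_pow.
    exact/SE_smooth/smooth_on_cst.
  move=> x Ux; have dF := smooth_expr_differentiable sF Ux.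
  by have [_ ->] := is_derive_powR_comp a v dF (F0 x Ux); rewrite eF.
Qed.

Lemma smooth_exprP U F : open U -> smooth_expr U F -> smooth_on U F.
Proof.
move=> oU; apply: (@smooth_on_coind _ _ U (smooth_expr U)) => // {}F.
- exact: smooth_expr_differentiable.
- by move=> v; apply: smooth_expr_derive.
Qed.

Section Closure.
Variables (U : set V) (oU : open U).

Lemma smooth_onD F G : smooth_on U F -> smooth_on U G ->
  smooth_on U (fun x => F x + G x).
Proof. by move=> sF sG; apply: smooth_exprP => //; apply: (SE_add (SE_smooth sF) (SE_smooth sG)). Qed.

Lemma smooth_onM F G : smooth_on U F -> smooth_on U G ->
  smooth_on U (fun x => F x * G x).
Proof. by move=> sF sG; apply: smooth_exprP => //; apply: (SE_mul (SE_smooth sF) (SE_smooth sG)). Qed.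

Lemma smooth_onZ (c : R) F : smooth_on U F -> smooth_on U (fun x => c * F x).
Proof. by move=> sF; apply: smooth_onM => //; apply: smooth_on_cst. Qed.

Lemma smooth_onN F : smooth_on U F -> smooth_on U (fun x => - F x).
Proof.
by move=> sF; apply: (@smooth_on_ext _ _ _ _ _ oU _ (smooth_onZ (-1) sF)) => x _; rewrite mulN1r.
Qed.

Lemma smooth_onB F G : smooth_on U F -> smooth_on U G ->
  smooth_on U (fun x => F x - G x).
Proof. by move=> sF sG; apply: smooth_onD => //; apply: smooth_onN. Qed.

Lemma smooth_on_powR F a : smooth_on U F -> (forall x, U x -> 0 < F x) ->
  smooth_on U (fun x => F x `^ a).
Proof. by move=> sF F0; apply: smooth_exprP => //; apply: SE_pow => //; apply: SE_smooth. Qed.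

(** Real powers need a positive base; [1 / F = F (F ^ 2) ^ (-1)] covers the negative
values of [F]. *)
Lemma smooth_onV F : smooth_on U F -> (forall x, U x -> F x != 0) ->
  smooth_on U (fun x => (F x)^-1).
Proof.
move=> sF F0.
have F2 x : U x -> 0 < F x * F x by move=> Ux; rewrite -expr2 exprn_even_gt0 //= F0.
apply: (@smooth_on_ext _ _ _ _ _ oU _
  (smooth_onM sF (smooth_on_powR (-1) (smooth_onM sF sF) F2))) => x Ux.
by rewrite powR_inv1 ?ltW ?F2 // invfM mulrA divff ?mul1r // F0.
Qed.

Lemma smooth_on_div F G : smooth_on U F -> smooth_on U G ->
  (forall x, U x -> G x != 0) -> smooth_on U (fun x => F x / G x).
Proof. by move=> sF sG G0; apply: smooth_onM => //; apply: smooth_onV. Qed.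

Lemma smooth_onX F n : smooth_on U F -> smooth_on U (fun x => F x ^+ n).
Proof.
move=> sF; elim: n => [|n IH]; first exact: smooth_on_cst.
by apply: (@smooth_on_ext _ _ _ _ _ oU _ (smooth_onM sF IH)) => x _; rewrite exprS.
Qed.

Lemma smooth_on_sum (I : Type) (r : seq I) (F : I -> V -> R) :
  (forall i, smooth_on U (F i)) -> smooth_on U (fun x => \sum_(i <- r) F i x).
Proof.
move=> sF; elim: r => [|i r IH].
  by apply: (@smooth_on_ext _ _ _ _ _ oU _ (smooth_on_cst (0:R))) => x _; rewrite big_nil.
by apply: (@smooth_on_ext _ _ _ _ _ oU _ (smooth_onD (sF i) IH)) => x _; rewrite big_cons.
Qed.

Lemma differentiable_rV n (F : V -> 'rV[R]_n) x :
  (forall i, differentiable (fun x => F x 0 i) x) -> differentiable F x.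
Proof.
move=> dF; have -> : F = \sum_(i < n) (fun x => F x 0 i *: delta_mx 0 i).
  by apply/funext => y; rewrite fct_sumE -row_sum_delta.
apply: differentiable_sum => i; exact: differentiableZl.
Qed.

Lemma differentiable_rV_coord n (F : V -> 'rV[R]_n) x i :
  differentiable F x -> differentiable (fun x => F x 0 i) x.
Proof.
move=> dF; apply: (@differentiable_comp _ _ _ _ F (fun N : 'rV_n => N 0 i)) => //.
exact: differentiable_coord.
Qed.

Lemma derive_rV n (F : V -> 'rV[R]_n) x v i : differentiable F x ->
  ('D_v F x) 0 i = 'D_v (fun x => F x 0 i) x.
Proof. by move=> dF; rewrite derive_mx ?mxE //; apply: diff_derivable. Qed.

Lemma smooth_on_coord n (F : V -> 'rV[R]_n) i : smooth_on U F ->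
  smooth_on U (fun x => F x 0 i).
Proof.
move=> sF; apply: (@smooth_on_coind _ _ U (fun G => exists2 F : V -> 'rV[R]_n,
   smooth_on U F & G = fun x => F x 0 i)) => //; last by exists F.
- move=> {F sF} G [F sF ->] x Ux.
  exact/differentiable_rV_coord/(smooth_on_differentiable sF).
- move=> {F sF} G v [F sF ->]; exists (fun x => 'D_v F x 0 i).
    by exists (fun x => 'D_v F x) => //; apply: smooth_on_derive.
  by move=> x Ux; rewrite derive_rV //; apply: smooth_on_differentiable sF Ux.
Qed.

Lemma smooth_on_rV n (F : V -> 'rV[R]_n) :
  (forall i, smooth_on U (fun x => F x 0 i)) -> smooth_on U F.
Proof.
move=> sF; apply: (@smooth_on_coind _ _ U (fun F : V -> 'rV[R]_n =>
   forall i, smooth_on U (fun x => F x 0 i))) => // {F sF} F.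
- by move=> sF x Ux; apply: differentiable_rV => i; apply: smooth_on_differentiable (sF i) Ux.
- move=> v sF; exists (fun x => 'D_v F x) => // i.
  apply: (@smooth_on_ext _ _ _ _ _ oU _ (smooth_on_derive v (sF i))) => x Ux.
  rewrite derive_rV //.
  by apply: differentiable_rV => j; apply: smooth_on_differentiable (sF j) Ux.
Qed.

End Closure.

Lemma smooth_on_id U : open U -> smooth_on U (id : V -> V).
Proof.
move=> oU; apply: (@smooth_on_coind V V U (fun F : V -> V => F = id \/ exists c : V, F = cst c) id oU).
- by move=> F [->|[c ->]] x _; [exact: ex_diff | exact: differentiable_cst].
- move=> F v [->|[c ->]].
    by exists (cst v) => [|x _]; [right; exists v | rewrite derive_id].
  by exists (cst 0) => [|x _]; [right; exists 0 | rewrite derive_cst].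
- by left.
Qed.
End Algebra.
End SmoothCalculus.

(** * Differentiation in several variables *)

Section SeveralVariables.
Context {R : realType}.

Lemma derive_dirD (V W : normedModType R) (F : V -> W) x u v :
  differentiable F x -> 'D_(u + v) F x = 'D_u F x + 'D_v F x.
Proof. by move=> dF; rewrite !deriveE // linearD. Qed.

Lemma derive_dirZ (V W : normedModType R) (F : V -> W) x (k : R) v :
  differentiable F x -> 'D_(k *: v) F x = k *: 'D_v F x.
Proof. by move=> dF; rewrite !deriveE // linearZ. Qed.

Lemma derive_dirB (V W : normedModType R) (F : V -> W) x u v :
  differentiable F x -> 'D_(u - v) F x = 'D_u F x - 'D_v F x.
Proof. by move=> dF; rewrite !deriveE // linearB. Qed.

Lemma derive_dir_sum (V W : normedModType R) (F : V -> W) x n (v : 'I_n -> V) :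
  differentiable F x -> 'D_(\sum_i v i) F x = \sum_i 'D_(v i) F x.
Proof.
by move=> dF; rewrite deriveE // linear_sum; apply: eq_bigr => i _; rewrite deriveE.
Qed.

Lemma derive_rV_dir (W : normedModType R) n (F : 'rV[R]_n -> W) x h :
  differentiable F x -> 'D_h F x = \sum_i h 0 i *: 'D_(delta_mx 0 i) F x.
Proof.
move=> dF; rewrite {1}(row_sum_delta h) derive_dir_sum //.
by apply: eq_bigr => i _; rewrite derive_dirZ.
Qed.

Lemma derive_chain (U V W : normedModType R) (T : U -> V) (F : V -> W) x v :
  differentiable T x -> differentiable F (T x) ->
  'D_v (F \o T) x = 'D_('D_v T x) F (T x).
Proof.
move=> dT dF; have dFT : differentiable (F \o T) x by exact: differentiable_comp.
by rewrite (deriveE v dFT) diff_comp //= (deriveE v dT) deriveE.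
Qed.

Lemma derive_linear_comp (U V W : normedModType R) (L : {linear V -> W})
    (F : U -> V) x v : continuous L -> differentiable F x ->
  'D_v (L \o F) x = L ('D_v F x).
Proof.
move=> cL dF; have dL := linear_differentiable (F x) cL.
by rewrite derive_chain // deriveE // diff_lin.
Qed.

Lemma smooth_on_linear_comp (U V W : normedModType R) (L : {linear V -> W})
    (A : set U) (F : U -> V) : open A -> continuous L ->
  smooth_on A F -> smooth_on A (L \o F).
Proof.
move=> oA cL sF; pose P (H : U -> W) := exists2 F, smooth_on A F & H = L \o F.
apply: (@smooth_on_coind _ _ _ A P) => //; last by exists F.
- move=> _ [{sF}F sF ->] x Ax; apply: differentiable_comp.
    exact: smooth_on_differentiable sF Ax.
  exact: linear_differentiable.
- move=> _ v [{sF}F sF ->]; exists (L \o (fun x => 'D_v F x)).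
    by exists (fun x => 'D_v F x) => //; apply: smooth_on_derive.
  by move=> x Ax; rewrite derive_linear_comp //; apply: smooth_on_differentiable sF Ax.
Qed.

Section Composition.
Context {V : normedModType R} {n : nat}.
Variables (U : set V) (U' : set 'rV[R]_n) (T : V -> 'rV[R]_n).
Hypotheses (oU : open U) (sT : smooth_on U T) (TU : forall x, U x -> U' (T x)).

(** By the chain rule the derivative of [F \o T] is a sum of products of smooth
functions and of functions [G \o T], which is why products with smooth functions
have to be part of the family. *)
Inductive comp_expr : (V -> R) -> Prop :=
| CE_smooth F : smooth_on U F -> comp_expr F
| CE_comp F : smooth_on U' F -> comp_expr (F \o T)
| CE_add F G : comp_expr F -> comp_expr G -> comp_expr (F + G)
| CE_mul F G : comp_expr F -> comp_expr G -> comp_expr (F * G).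

Lemma comp_expr_differentiable F : comp_expr F -> forall x, U x -> differentiable F x.
Proof.
elim=> {F} [F sF|F sF|F G _ dF _ dG|F G _ dF _ dG] x Ux.
- exact: smooth_on_differentiable sF Ux.
- apply: differentiable_comp; first exact: smooth_on_differentiable sT Ux.
  by apply: smooth_on_differentiable sF _; apply: TU.
- by apply: differentiableD; [exact: dF | exact: dG].
- by apply: differentiableM; [exact: dF | exact: dG].
Qed.

Lemma comp_expr_sum (I : Type) (r : seq I) (F : I -> V -> R) :
  (forall i, comp_expr (F i)) -> comp_expr (fun x => \sum_(i <- r) F i x).
Proof.
move=> sF; elim: r => [|i r IH].
  by apply: CE_smooth; rewrite (_ : (fun _ => _) = cst 0);
    [exact: smooth_on_cst | apply/funext => x; rewrite big_nil].
rewrite (_ : (fun _ => _) = F i + (fun x => \sum_(i <- r) F i x)); first exact: CE_add.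
by apply/funext => x; rewrite big_cons.
Qed.

Lemma comp_expr_derive F v : comp_expr F ->
  exists2 G, comp_expr G & forall x, U x -> 'D_v F x = G x.
Proof.
elim=> {F} [F sF|F sF|F G sF [F' sF' eF] sG [G' sG' eG]
  |F G sF [F' sF' eF] sG [G' sG' eG]].
- by exists (fun x => 'D_v F x) => //; apply/CE_smooth/smooth_on_derive.
- exists (fun x => \sum_(i < n) ((fun x => ('D_v T x) 0 i) * ((fun y => 'D_(delta_mx 0 i) F y) \o T)) x).
    apply: comp_expr_sum => i; apply: CE_mul.
      by apply/CE_smooth/smooth_on_coord => //; apply: smooth_on_derive.
    by apply: CE_comp; apply: smooth_on_derive.
  move=> x Ux; have dF : differentiable F (T x).
    by apply: smooth_on_differentiable sF _; apply: TU.
  rewrite derive_chain //; last exact: smooth_on_differentiable sT Ux.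
  by rewrite derive_rV_dir.
- exists (F' + G') => [|x Ux]; first exact: CE_add.
  rewrite deriveD ?eF ?eG //; apply: diff_derivable.
    exact: comp_expr_differentiable sF _ Ux.
  exact: comp_expr_differentiable sG _ Ux.
- exists (F * G' + G * F') => [|x Ux]; first by apply: CE_add; apply: CE_mul.
  rewrite deriveM ?eF ?eG //; apply: diff_derivable.
    exact: comp_expr_differentiable sF _ Ux.
  exact: comp_expr_differentiable sG _ Ux.
Qed.

Lemma smooth_on_comp_scalar (F : 'rV[R]_n -> R) :
  smooth_on U' F -> smooth_on U (F \o T).
Proof.
move=> sF; apply: (@smooth_on_coind _ _ _ U comp_expr) => //; last exact: CE_comp.
- exact: comp_expr_differentiable.
- by move=> {sF}F v; apply: comp_expr_derive.
Qed.

Lemma smooth_on_comp m (F : 'rV[R]_n -> 'rV[R]_m) : open U' ->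
  smooth_on U' F -> smooth_on U (F \o T).
Proof.
move=> oU' sF; apply: smooth_on_rV => // i.
exact: (smooth_on_comp_scalar (smooth_on_coord oU' i sF)).
Qed.
End Composition.

Lemma is_derive_line (V W : normedModType R) (F : V -> W) (x v : V) (t : R) :
  differentiable F (x + t *: v) ->
  is_derive t 1 (fun t => F (x + t *: v)) ('D_v F (x + t *: v)).
Proof.
move=> dF.
have dl : is_diff t (fun t : R => x + t *: v) (0 + *:%R ^~ v : R -> V).
  exact: (@is_diffD _ _ _ (cst x) (fun t : R => t *: v)).
have dl' : differentiable (fun t : R => x + t *: v) t by case: dl.
have dc : differentiable (F \o (fun t : R => x + t *: v)) t by exact: differentiable_comp.
apply: DeriveDef; first by apply: diff_derivable; exact: dc.
by rewrite derive_chain // (deriveE (1 : R) dl') (@diff_val _ _ _ _ _ _ _ dl) /= fctE add0r scale1r.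
Qed.

Lemma MVT_line (V : normedModType R) (F : V -> R) (x v : V) :
  (forall t, 0 <= t <= 1 -> differentiable F (x + t *: v)) ->
  exists2 c, 0 <= c <= 1 & F (x + v) - F x = 'D_v F (x + c *: v).
Proof.
move=> dF.
have [||c] := @MVT_segment R (fun t => F (x + t *: v)) (fun t => 'D_v F (x + t *: v)) 0 1 ler01.
- move=> t; rewrite in_itv /= => /andP[t0 t1]; apply: is_derive_line.
  by apply: dF; rewrite !ltW.
- apply: derivable_within_continuous => t; rewrite in_itv /= => t01.
  by have [] := is_derive_line (dF t t01).
- rewrite in_itv /= subr0 mulr1 scale1r scale0r addr0 => c01 ->.
  by exists c.
Qed.
End SeveralVariables.

(** * Symmetry of second derivatives *)

Section Schwarz.
Context {R : realType} {V : normedModType R}.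
Implicit Types (F : V -> R) (U : set V).

Lemma dist_le_half (a b c e : R) :
  `|c - a| < e / 2 -> `|c - b| < e / 2 -> `|a - b| <= e.
Proof.
rewrite distrC => ca cb; apply: ltW; rewrite -(subrKA c) (le_lt_trans (ler_normD _ _)) //.
by rewrite [ltRHS]splitr ltrD.
Qed.

Lemma constant_on_ball F (z : V) (r : R) :
  (forall x, ball z r x -> differentiable F x /\ forall v, 'D_v F x = 0) ->
  forall x, ball z r x -> F x = F z.
Proof.
move=> dF x zx.
have seg t : 0 <= t <= 1 -> ball z r (z + t *: (x - z)).
  move=> /andP[t0 t1]; move: zx; rewrite -!ball_normE /= opprD addNKr normrN normrZ.
  rewrite (distrC z) ger0_norm //; apply: le_lt_trans.
  by rewrite -[leRHS]mul1r ler_wpM2r.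
have [t t01|c c01] := @MVT_line _ _ F z (x - z); first exact: (dF _ (seg t t01)).1.
have -> : z + (x - z) = x by rewrite addrC subrK.
by rewrite (dF _ (seg c c01)).2 => /eqP; rewrite subr_eq0 => /eqP.
Qed.

(** The mean value theorem is applied to [y |-> F (y + v) - F y] in the direction [u],
and then to the derivative of [F] in the direction [u]. *)
Lemma double_difference U F (x u v : V) : smooth_on U F ->
  (forall s t, 0 <= s <= 1 -> 0 <= t <= 1 -> U (x + s *: u + t *: v)) ->
  exists s t, [/\ 0 <= s <= 1, 0 <= t <= 1 &
    F (x + u + v) - F (x + u) - (F (x + v) - F x)
    = 'D_v (fun y => 'D_u F y) (x + s *: u + t *: v)].
Proof.
move=> sF inU.
have one01 : 0 <= (1 : R) <= 1 by rewrite ler01 lexx.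
have zero01 : 0 <= (0 : R) <= 1 by rewrite ler01 lexx.
have dF y : U y -> differentiable F y by exact: smooth_on_differentiable.
have Uv s : 0 <= s <= 1 -> U (x + s *: u + v) by move=> s01; have := inU s 1 s01 one01; rewrite scale1r.
have U0 s : 0 <= s <= 1 -> U (x + s *: u) by move=> s01; have := inU s 0 s01 zero01; rewrite scale0r addr0.
have dFv s : 0 <= s <= 1 -> is_diff (x + s *: u) (fun y => F (y + v)) ('d F (x + s *: u + v)).
  move=> s01.
  have dsh : is_diff (x + s *: u) (fun y : V => y + v) (id + 0).
    exact: (@is_diffD _ _ _ id (cst v)).
  have dsh' : differentiable (fun y : V => y + v) (x + s *: u) by case: dsh.
  have dFxv : differentiable F (x + s *: u + v) by apply: dF; apply: Uv.
  apply: DiffDef; first exact: (@differentiable_comp _ _ _ _ (fun y : V => y + v) F).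
  rewrite (@diff_comp _ _ _ _ (fun y : V => y + v) F) // diff_val.
  by apply/funext => y /=; rewrite addr0.
have dG s : 0 <= s <= 1 -> differentiable (fun y => F (y + v) - F y) (x + s *: u).
  move=> s01; apply: differentiableB; first by case: (dFv s s01).
  by apply: dF; exact: U0.
have [s s01 Es] := MVT_line dG.
have sDF := smooth_on_derive u sF.
have [|t t01 Et] := @MVT_line _ _ (fun y => 'D_u F y) (x + s *: u) v.
  by move=> t t01; apply: smooth_on_differentiable sDF _; apply: inU.
exists s, t; split => //; rewrite -Et Es.
have d1 := dFv s s01; have d1' : differentiable (fun y => F (y + v)) (x + s *: u) by case: d1.
have d2 : differentiable F (x + s *: u) by apply: dF; apply: U0.
have d3 : differentiable F (x + s *: u + v) by apply: dF; apply: Uv.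
rewrite (@deriveB _ _ _ (fun y => F (y + v)) F); [|exact: diff_derivable..].
by rewrite (deriveE _ d1') diff_val (deriveE _ d3).
Qed.

(** The second difference of [F] over a small parallelogram is symmetric in its two
sides, and [double_difference] compares it with both mixed derivatives. *)
Lemma derive_symmetric U F (x u v : V) : open U -> smooth_on U F -> U x ->
  'D_v (fun y => 'D_u F y) x = 'D_u (fun y => 'D_v F y) x.
Proof.
move=> oU sF Ux.
pose close u' v' e (h : R) := forall s t, 0 <= s <= 1 -> 0 <= t <= 1 ->
  U (x + s *: (h *: u') + t *: (h *: v')) /\
  `|'D_v' (fun y => 'D_u' F y) (x + s *: (h *: u') + t *: (h *: v'))
    - 'D_v' (fun y => 'D_u' F y) x| < e.
have near_small u' v' e : 0 < e -> \forall h \near (0 : R), close u' v' e h.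
  move=> e0.
  have sDD := smooth_on_derive v' (smooth_on_derive u' sF).
  have cDD := differentiable_continuous (smooth_on_differentiable sDD Ux).
  have : \forall y \near x, U y /\ `|'D_v' (fun y => 'D_u' F y) y - 'D_v' (fun y => 'D_u' F y) x| < e.
    near=> y; split; first by near: y; apply: open_nbhs_nbhs.
    by rewrite distrC; near: y; exact: (cvgrPdist_lt _ _).1 cDD e e0.
  move=> /nbhs_ballP[r /= r0 Hr].
  have M0 : 0 < `|u'| + `|v'| + 1 by rewrite ltr_wpDl // addr_ge0.
  near=> h => s t /andP[s0 s1] /andP[t0 t1]; apply: Hr.
  rewrite -ball_normE /= -addrA opprD addNKr normrN.
  apply: (@le_lt_trans _ _ (`|h| * (`|u'| + `|v'| + 1))).
    rewrite (le_trans (ler_normD _ _)) // !normrZ !(ger0_norm s0) !(ger0_norm t0).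
    have hu : 0 <= `|h| * `|u'| by rewrite mulr_ge0.
    have hv : 0 <= `|h| * `|v'| by rewrite mulr_ge0.
    have := ler_wpM2r hu s1; have := ler_wpM2r hv t1; have := normr_ge0 h; lra.
  rewrite -ltr_pdivlMr //; near: h.
  have /cvgrPdist_lt H : (fun h : R => h) @ nbhs (0:R) --> (0:R) by [].
  have := H (r / (`|u'| + `|v'| + 1)) (divr_gt0 r0 M0).
  by apply: filterS => h; rewrite sub0r normrN.
apply/eqP; rewrite -subr_eq0 -normr_le0; apply/ler_addgt0Pl => e e0; rewrite addr0.
have e2 : 0 < e / 2 by rewrite divr_gt0.
suff : exists2 h : R, h != 0 & close u v (e / 2) h /\ close v u (e / 2) h.
  move=> [h h0 [H1 H2]].
  have scale2 a b y : U y -> 'D_(h *: b) (fun y => 'D_(h *: a) F y) y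
     = h * (h * 'D_b (fun y => 'D_a F y) y).
    move=> Uy; have sD := smooth_on_derive a sF.
    have dD := smooth_on_differentiable sD Uy.
    rewrite (@near_eq_derive _ _ _ _ (h \*: (fun y => 'D_a F y))); last first.
      near=> w; rewrite derive_dirZ //; apply: smooth_on_differentiable sF _.
      by near: w; apply: open_nbhs_nbhs.
    rewrite deriveZ; last exact: diff_derivable.
    by rewrite derive_dirZ.
  have [|s1 [t1 [s01 t01 E1]]] := @double_difference U F x (h *: u) (h *: v) sF.
    by move=> s t s' t'; have [] := H1 s t s' t'.
  have [|s2 [t2 [s02 t02 E2]]] := @double_difference U F x (h *: v) (h *: u) sF.
    by move=> s t s' t'; have [] := H2 s t s' t'.
  have [U1 {}H1] := H1 s1 t1 s01 t01; have [U2 {}H2] := H2 s2 t2 s02 t02.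
  move: E1 E2; rewrite (scale2 u v _ U1) (scale2 v u _ U2) (addrAC x (h *: v)).
  set A := 'D_v _ _ in H1 *; set B := 'D_u _ _ in H2 *.
  clearbody A B => E1 E2.
  have AB : A = B.
    apply: (mulfI h0); apply: (mulfI h0); rewrite -E1 -E2.
    by rewrite !opprD !opprK !addrA (addrAC (F _)).
  rewrite AB in H1.
  exact: dist_le_half H1 H2.
have H1 := near_small u v _ e2; have H2 := near_small v u _ e2.
have [r /= r0 Hr] := (nbhs_ballP (0 : R) _).1 (filterI H1 H2).
exists (r / 2); first by rewrite gt_eqF // divr_gt0.
have hr : ball (0 : R) r (r / 2).
  by rewrite -ball_normE /= sub0r normrN gtr0_norm ?divr_gt0 // ltr_pdivrMr // ltr_pMr // ltrDl ltr01.
by have [K1 K2] := Hr _ hr; split.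
Unshelve. all: by end_near. Qed.
End Schwarz.

(** * The inverse function theorem *)

(** The Banach fixed point theorem asks for a complete normed module. *)
HB.instance Definition _ (R : realType) (n : nat) :=
  Complete.copy 'rV[R]_n.+1 'rV[R]_n.+1.

Section InverseFunction.
Context {R : realType} {n : nat}.
Local Notation vec := 'rV[R]_n.+1.

Lemma rV_norm_le (x : vec) (e : R) : 0 <= e ->
  (forall i, `|x 0 i| <= e) -> `|x| <= e.
Proof.
move=> e0 xe; rewrite /Num.Def.normr /= mx_normrE bigmax_le // => -[i j] _ /=.
by rewrite ord1.
Qed.

Lemma rV_coord_le (x : vec) i : `|x 0 i| <= `|x|.
Proof.
rewrite [leRHS]/Num.Def.normr /= mx_normrE.
exact: (le_bigmax _ (fun ij : 'I_1 * 'I_n.+1 => `|x ij.1 ij.2|) (0, i)).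
Qed.

Lemma mulmx_bounded (A : 'M[R]_n.+1) :
  exists2 K, 0 < K & forall x : vec, `|x *m A| <= K * `|x|.
Proof.
exists (1 + \sum_i \sum_j `|A i j|).
  by rewrite ltr_pwDl // sumr_ge0 // => i _; rewrite sumr_ge0.
move=> x; apply: rV_norm_le => [|j].
  by rewrite mulr_ge0 // addr_ge0 // sumr_ge0 // => i _; rewrite sumr_ge0.
rewrite mxE (le_trans (ler_norm_sum _ _ _)) // mulrDl mul1r mulr_suml.
apply: ler_wpDl => //; apply: ler_sum => i _; rewrite normrM mulrC.
apply: ler_pM => //; last exact: rV_coord_le.
by rewrite (bigD1 j) //= lerDl sumr_ge0.
Qed.

Section MeanValue.
Variables (U : set vec) (G : vec -> vec) (z : vec).
Hypotheses (oU : open U) (Uz : U z) (sG : smooth_on U G).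

(** By continuity all partial derivatives are at most [1 / (2 (n + 1))] near [z], and
the mean value theorem sums [n + 1] of them. *)
Lemma small_differential_contracts : (forall v, 'D_v G z = 0) ->
  exists2 r, 0 < r & ball z r `<=` U /\
    forall x y, ball z r x -> ball z r y -> `|G x - G y| <= 2^-1 * `|x - y|.
Proof.
move=> DG0; pose e : R := (2 * n.+1%:R)^-1.
have e0 : 0 < e by rewrite invr_gt0 mulr_gt0.
have sDG i j := smooth_on_derive (delta_mx 0 i) (smooth_on_coord oU j sG).
have dG j x : U x -> differentiable (fun y => G y 0 j) x.
  exact: smooth_on_differentiable (smooth_on_coord oU j sG).
have small i j : \forall x \near z, `|'D_(delta_mx 0 i) (fun y => G y 0 j) x| <= e.
  have := differentiable_continuous (smooth_on_differentiable (sDG i j) Uz).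
  move=> /cvgrPdist_le/(_ e e0); apply: filterS => x.
  rewrite -(derive_rV _ _ (smooth_on_differentiable sG Uz)) DG0 mxE sub0r.
  by rewrite normrN.
have : \forall x \near z, U x /\ forall i j,
    `|'D_(delta_mx 0 i) (fun y => G y 0 j) x| <= e.
  near=> x; split; near: x; first exact: open_nbhs_nbhs.
  by apply: filter_forall => i; apply: filter_forall => j; apply: small.
move=> /(nbhs_ballP z)[r /= r0 Hr]; exists r => //; split=> [x /Hr[]//|].
move=> x y zx zy; apply: rV_norm_le => [|j]; first by rewrite mulr_ge0 ?invr_ge0.
have seg t : 0 <= t <= 1 -> ball z r (y + t *: (x - y)).
  move=> /andP[t0 t1]; move: zx zy; rewrite -!ball_normE /= => zx zy.
  rewrite (_ : z - _ = t *: (z - x) + (1 - t) *: (z - y)); last first.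
    by apply/rowP => i; rewrite !mxE; ring.
  apply: le_lt_trans (ler_normD _ _) _; rewrite !normrZ !ger0_norm ?subr_ge0 //.
  move: t0; rewrite le_eqVlt => /predU1P[<-|t0].
    by rewrite mul0r add0r subr0 mul1r.
  have -> : r = t * r + (1 - t) * r by ring.
  by rewrite ltr_leD ?ltr_pM2l // ler_wpM2l ?subr_ge0 // ltW.
have [|c c01] := @MVT_line _ _ (fun y => G y 0 j) y (x - y).
  by move=> t t01; apply: dG; have [] := Hr _ (seg t t01).
rewrite (_ : y + (x - y) = x); last by rewrite addrC subrK.
have [Uc Dc] := Hr _ (seg c c01).
rewrite !mxE => ->; rewrite derive_rV_dir; last exact: dG.
apply: le_trans (ler_norm_sum _ _ _) _.
rewrite [leRHS](_ : _ = \sum_(i < n.+1) `|x - y| * e); last first.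
  rewrite sumr_const card_ord -mulr_natr /e invfM; field.
  by rewrite nat1r pnatr_eq0.
by apply: ler_sum => i _; rewrite normrM ler_pM // rV_coord_le.
Unshelve. all: by end_near. Qed.
End MeanValue.

Section LocalInverse.
Variables (U : set vec) (Phi : vec -> vec) (z0 : vec) (eta : 'I_n.+1 -> vec -> vec).
Hypotheses (oU : open U) (Uz0 : U z0) (sPhi : smooth_on U Phi).
Hypothesis (seta : forall j, smooth_on U (eta j)).
Hypothesis (Deta : forall x j, U x -> 'D_(eta j x) Phi x = delta_mx 0 j).

(** The rows of [N] are the fields [eta j], those of [J] the partial derivatives of
[Phi]: the two matrices are inverse to each other. *)
Let N x := \matrix_(j < n.+1) eta j x.
Let J x := \matrix_(j < n.+1) 'D_(delta_mx 0 j) Phi x.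

Let dPhi x : U x -> differentiable Phi x.
Proof. exact: smooth_on_differentiable. Qed.

Let DPhiE x v : U x -> 'D_v Phi x = v *m J x.
Proof.
move=> Ux; rewrite mulmx_sum_row derive_rV_dir; last exact: dPhi.
by apply: eq_bigr => i _; rewrite rowK.
Qed.

Let NJ x : U x -> N x *m J x = 1%:M.
Proof.
move=> Ux; apply/row_matrixP => j.
by rewrite row_mul rowK -DPhiE // Deta // row1.
Qed.

Let JN x : U x -> J x *m N x = 1%:M.
Proof. by move=> /NJ/mulmx1C. Qed.

(** The Newton map of [Phi] at [z0]; it has vanishing differential there. *)
Let G x := x - Phi x *m N z0.

Let mulN0_continuous : continuous (mulmxr (N z0) : vec -> vec).
Proof.
have [K K0 HK] := mulmx_bounded (N z0).
apply: bounded_linear_continuous; apply/linear_boundedP; exists K.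
split; first by rewrite num_real.
by move=> M KM x0 /=; rewrite (le_trans (HK x0)) // ler_wpM2r // ltW.
Qed.

Let smooth_G : smooth_on U G.
Proof.
have sm := smooth_on_linear_comp oU mulN0_continuous sPhi.
apply: smooth_on_rV => // i.
have s1 := smooth_on_coord oU i (smooth_on_id oU).
have s2 := smooth_on_coord oU i sm.
by apply: (smooth_on_ext oU _ (smooth_onB oU s1 s2)) => x _; rewrite /G /= !mxE.
Qed.

Let DG v : 'D_v G z0 = 0.
Proof.
have dP := dPhi Uz0.
have dm : differentiable ((mulmxr (N z0) : vec -> vec) \o Phi) z0.
  by apply: differentiable_comp => //; apply: linear_differentiable.
rewrite (_ : 'D_v G z0 = 'D_v id z0 - 'D_v ((mulmxr (N z0) : vec -> vec) \o Phi) z0); last first.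
  by apply: (@deriveB _ _ _ id) => //; apply: diff_derivable.
rewrite derive_id (derive_linear_comp _ mulN0_continuous dP) /=.
by rewrite DPhiE // -mulmxA JN // mulmx1 subrr.
Qed.

(** [Phi] is bi-Lipschitz where the Newton map [G] contracts.  A preimage of [y] is a
fixed point of [u |-> G u + y *m N z0]. *)
Lemma local_inverse_exists : exists (B : set vec) (Psi : vec -> vec),
  [/\ open B, B z0, B `<=` U, open (Phi @` B) & forall x, B x -> Psi (Phi x) = x] /\
  exists2 K, 0 < K & forall x y, B x -> B y -> `|x - y| <= K * `|Phi x - Phi y|.
Proof.
have [r r0 [BU lipG]] := small_differential_contracts oU Uz0 smooth_G DG.
have [K K0 HK] := mulmx_bounded (N z0).
pose B := ball z0 r.
have expand x y : B x -> B y -> `|x - y| <= (2 * K) * `|Phi x - Phi y|.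
  move=> Bx By; have := lipG x y Bx By.
  have := HK (Phi x - Phi y); rewrite mulmxBl => H1 H2.
  have : `|x - y| <= `|Phi x *m N z0 - Phi y *m N z0| + `|G x - G y|.
    apply: le_trans (ler_normD _ _); rewrite le_eqVlt; apply/orP; left; apply/eqP.
    rewrite /G; move: (Phi x *m _) (Phi y *m _) => a b.
    by congr `|_|; apply/rowP => i; rewrite !mxE; ring.
  move: `|x - y| `|Phi x - Phi y| `|_ - _| `|_ - _| H1 H2 => a b c d.
  by lra.
have inj x y : B x -> B y -> Phi x = Phi y -> x = y.
  move=> Bx By xy; have := expand x y Bx By; rewrite xy subrr normr0 mulr0.
  by rewrite normr_le0 subr_eq0 => /eqP.
pose Psi y := xget z0 [set x | B x /\ Phi x = y].
have PsiK x : B x -> Psi (Phi x) = x.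
  move=> Bx; have [By E] : [set x' | B x' /\ Phi x' = Phi x] (Psi (Phi x)).
    exact: (xgetI z0 (conj Bx erefl : [set x' | B x' /\ Phi x' = Phi x] x)).
  exact: inj E.
have openB : open (Phi @` B).
  rewrite openE => _ [x Bx <-].
  have /nbhs_closedballP[rho Hrho] : nbhs x B by apply: open_nbhs_nbhs; split => //; exact: ball_open.
  pose delta := rho%:num / (2 * K).
  have d0 : 0 < delta by rewrite divr_gt0 // mulr_gt0.
  apply/(nbhs_ballP (Phi x)); exists delta => //= y; rewrite -ball_normE /= => xy.
  pose C := closed_ball_ Num.norm x rho%:num.
  have CB u : C u -> B u by move=> Cu; apply: Hrho; rewrite closed_ballE.
  pose T u := G u + y *m N z0.
  have TC : {homo T : u / C u >-> C u}.
    move=> u Cu; rewrite /C /closed_ball_ /= /T.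
    rewrite (_ : x - _ = (G x - G u) + (Phi x - y) *m N z0); last first.
      rewrite mulmxBl /G; move: (Phi x *m _) (Phi u *m _) (y *m _) => a b c.
      by apply/rowP => i; rewrite !mxE; ring.
    apply: le_trans (ler_normD _ _) _.
    have H1 := lipG x u Bx (CB u Cu); have H2 := HK (Phi x - y).
    have H3 : K * `|Phi x - y| <= rho%:num / 2.
      have -> : rho%:num / 2 = K * delta.
        rewrite /delta; field; by rewrite gt_eqF.
      by rewrite ler_pM2l // ltW.
    move: Cu H1 H2 H3; rewrite /C /closed_ball_ /=.
    move: `|G x - G u| `|x - u| `|_ *m _| (K * _) => a b c d; lra.
  have ctr : is_contraction (mkfun_fun TC).
    exists (2^-1)%:nng; split; first by rewrite /= invf_lt1 // ltr1n.
    move=> [u v] /= [Cu Cv]; rewrite /T opprD addrACA subrr addr0.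
    exact: lipG (CB u Cu) (CB v Cv).
  have [||u Cu uT] := banach_fixed_point ctr.
  - exact: closed_closed_ball_.
  - by exists x; rewrite /C /closed_ball_ /= subrr normr0.
  exists u; first exact: CB.
  have E : Phi u *m N z0 = y *m N z0.
    have uT' : u = u - Phi u *m N z0 + y *m N z0 by exact: uT.
    move: uT'; move: (Phi u *m _) (y *m _) => a b Eu.
    apply/rowP => i; move/rowP/(_ i): Eu; rewrite !mxE; lra.
  by rewrite -[LHS]mulmx1 -[RHS]mulmx1 -(NJ Uz0) !mulmxA E.
exists B, Psi; split.
  by split => //; [exact: ball_open | exact: ballxx].
by exists (2 * K); [rewrite mulr_gt0|].
Qed.

Section Inverse.
Variables (B : set vec) (Psi : vec -> vec) (K : R).
Hypotheses (oB : open B) (BU : B `<=` U) (oPB : open (Phi @` B)).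
Hypothesis (PsiK : forall x, B x -> Psi (Phi x) = x).
Hypotheses (K0 : 0 < K)
  (expand : forall x y, B x -> B y -> `|x - y| <= K * `|Phi x - Phi y|).

Lemma inverse_continuous y : (Phi @` B) y -> {for y, continuous Psi}.
Proof.
move=> PBy; have [x Bx xy] := PBy; apply/(@cvgrPdist_le _ _ _ (nbhs y)) => e e0.
have eK : 0 < e / K by rewrite divr_gt0.
near=> y'.
have [x' Bx' xy'] : (Phi @` B) y' by near: y'; apply: open_nbhs_nbhs.
rewrite -xy -xy' !PsiK // (le_trans (expand Bx Bx')) // mulrC -ler_pdivlMr //.
rewrite xy xy'; near: y'; apply/(nbhs_ballP y); exists (e / K) => //= z.
by rewrite -ball_normE /= => /ltW.
Unshelve. all: by end_near. Qed.

(** The remainder of [Psi] at [Phi x] is the remainder of [Phi] at [x] multiplied by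
[- N x], and the Lipschitz bound makes it small in terms of [h]. *)
Lemma inverse_differentiable y : (Phi @` B) y -> differentiable Psi y.
Proof.
move=> PBy; have [x Bx xy] := PBy; have Ux := BU Bx.
have [M M0 HM] := mulmx_bounded (N x).
have cM : continuous (mulmxr (N x) : vec -> vec).
  apply: bounded_linear_continuous; apply/linear_boundedP; exists M.
  split; first by rewrite num_real.
  by move=> M' MM' x0 /=; rewrite (le_trans (HM x0)) // ler_wpM2r // ltW.
apply: (differentiable_from_expansion cM) => e e0.
have [_ /eqaddoP Ephi] := (diff_locallyP x Phi).1 (dPhi Ux).
pose e' := e / (M * K).
have e'0 : 0 < e' by rewrite divr_gt0 // mulr_gt0.
have /(nbhs_ballP (0 : vec))[d /= d0 Hd] := Ephi e' e'0.
have dK : 0 < d / K by rewrite divr_gt0.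
have /(nbhs_ballP y)[d1 /= d10 Hd1] : nbhs y (Phi @` B) by exact: open_nbhs_nbhs.
near=> h.
have [x' Bx' xy'] : (Phi @` B) (h + y).
  apply: Hd1; rewrite -ball_normE /= opprD addrCA subrr addr0 normrN.
  near: h; apply/(nbhs_ballP (0 : vec)); exists d1 => //= z.
  by rewrite -ball_normE /= sub0r normrN.
rewrite -xy' -xy !PsiK //=.
have hE : h = Phi x' - Phi x by rewrite xy' xy addrK.
have kd : `|x' - x| <= K * `|h| by rewrite hE; exact: expand.
have hd : `|h| < d / K.
  near: h; apply/(nbhs_ballP (0 : vec)); exists (d / K) => //= z.
  by rewrite -ball_normE /= sub0r normrN.
have kball : ball (0 : vec) d (x' - x).
  rewrite -ball_normE /= sub0r normrN (le_lt_trans kd) // mulrC -ltr_pdivlMr //.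
have := Hd _ kball.
rewrite (_ : (Phi \o shift x - (cst (Phi x) + 'd Phi x)) (x' - x)
    = h - (x' - x) *m J x); last first.
  rewrite hE -DPhiE // deriveE; last exact: dPhi.
  by rewrite -[LHS]/(Phi (x' - x + x) - (Phi x + 'd Phi x (x' - x))) subrK opprD addrA.
move=> H; rewrite (_ : _ - _ - _ = - ((h - (x' - x) *m J x) *m N x)); last first.
  by rewrite mulmxBl -mulmxA JN // mulmx1 opprB.
rewrite normrN (le_trans (HM _)) //.
rewrite (le_trans (ler_wpM2l (ltW M0) H)) //.
have -> : e * `|h| = M * (e' * (K * `|h|)).
  by rewrite /e'; field; rewrite !gt_eqF.
by rewrite ler_pM2l // ler_pM2l.
Unshelve. all: by end_near. Qed.

Lemma inverse_derive x j : B x -> 'D_(delta_mx 0 j) Psi (Phi x) = eta j x.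
Proof.
move=> Bx; have Ux := BU Bx.
have dPsi : differentiable Psi (Phi x) by apply: inverse_differentiable; exists x.
rewrite -(Deta j Ux) -(derive_chain _ (dPhi Ux) dPsi).
rewrite -[RHS](derive_id x); apply: near_eq_derive.
near=> z; rewrite /= PsiK //; near: z; exact: open_nbhs_nbhs.
Unshelve. all: by end_near. Qed.

(** The derivative of [G \o Psi] in the direction [v] is [(D_(v N) G) \o Psi], so the
functions [G \o Psi] are closed under differentiation. *)
Lemma inverse_smooth : smooth_on (Phi @` B) Psi.
Proof.
apply: smooth_on_rV => // i.
pose P (F : vec -> R) := exists2 G, smooth_on B G & F = G \o Psi.
apply: (@smooth_on_coind _ _ _ _ P) => //; last first.
  exists (fun x : vec => x 0 i) => //; exact: smooth_on_coord (smooth_on_id oB).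
- move=> _ v [F sF ->].
  exists ((fun x => \sum_k (\sum_j v 0 j * eta j x 0 k) * 'D_(delta_mx 0 k) F x) \o Psi).
    exists (fun x => \sum_k (\sum_j v 0 j * eta j x 0 k) * 'D_(delta_mx 0 k) F x) => //.
    apply: smooth_on_sum => // k; apply: smooth_onM => //; last exact: smooth_on_derive.
    apply: smooth_on_sum => // j; apply: smooth_onZ => //.
    by apply: smooth_on_coord => //; apply: smooth_on_subset (seta j).
  move=> y PBy; have [x Bx xy] := PBy.
  have dF : differentiable F (Psi y).
    by rewrite -xy PsiK //; apply: smooth_on_differentiable sF Bx.
  have dPsi := inverse_differentiable PBy.
  rewrite (derive_chain v dPsi dF) (derive_rV_dir _ dF) /=.
  apply: eq_bigr => k _; congr (_ * _).
  rewrite (derive_rV_dir _ dPsi) summxE; apply: eq_bigr => j _.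
  by rewrite mxE -xy inverse_derive // PsiK.
- move=> _ [F sF ->] y PBy; have [x Bx xy] := PBy.
  apply: differentiable_comp; first exact: inverse_differentiable.
  by rewrite -xy PsiK //; apply: smooth_on_differentiable sF Bx.
Qed.
End Inverse.

(** The inverse function theorem for a map that comes with smooth fields [eta j] dual
to its components; these fields are then the partial derivatives of the inverse. *)
Lemma local_inverse : exists (B : set vec) (Psi : vec -> vec),
  [/\ open B, B z0, B `<=` U, open (Phi @` B) & forall x, B x -> Psi (Phi x) = x] /\
  [/\ forall y, (Phi @` B) y -> {for y, continuous Psi}, smooth_on (Phi @` B) Psi &
      forall x j, B x -> 'D_(delta_mx 0 j) Psi (Phi x) = eta j x].
Proof.
have [B [Psi [[oB Bz0 BU oPB PsiK] [K K0 expand]]]] := local_inverse_exists.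
exists B, Psi; split=> //; split.
- exact: inverse_continuous K0 expand.
- exact: inverse_smooth K0 expand.
- exact: inverse_derive K0 expand.
Qed.
End LocalInverse.
End InverseFunction.

(** * Functions of one variable *)

Section ReciprocalPrimitive.
Context {R : realType}.

Lemma exists_primitive (g : R -> R) (a d : R) : 0 < d ->
  (forall x, ball a d x -> {for x, continuous g}) ->
  exists G : R -> R, forall x, ball a (d / 2) x -> is_derive x 1 G (g x).
Proof.
move=> d0 cg; pose mu := @lebesgue_measure R; pose e := d * 3 / 4.
have inside y : a - e <= y -> y <= a + e -> ball a d y.
  by rewrite /e /ball /= => ly ry; rewrite ltr_norml; apply/andP; split; lra.
(* the integral starts at a - 3/4 d, to the left of the ball of radius d / 2 *)
have gi : mu.-integrable `[a - e, a + e]%classic (EFin \o g).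
  apply: continuous_compact_integrable; first exact: segment_compact.
  apply/continuous_in_subspaceT => y; rewrite inE /= in_itv /= => /andP[ly ry].
  exact: cg (inside y ly ry).
exists (fun x => (\int[mu]_(t in [set` `[a - e, x]]) g t)%R) => x.
rewrite /ball /= => /ltr_normlP[lx rx].
have xe : x < a + e by rewrite /e; lra.
have ex : a - e < x by rewrite /e; lra.
have [dG G'] := @continuous_FTC1_closed R g (a - e) x (a + e) xe gi ex
  (cg x (inside x (ltW ex) (ltW xe))).
exact: DeriveDef dG (etrans (esym (derive1E _ _)) G').
Qed.

Lemma injective_of_derive_neq0 (G : R -> R) (a d : R) :
  (forall x, ball a d x -> derivable G x 1 /\ 'D_1 G x != 0) ->
  forall x y, ball a d x -> ball a d y -> G x = G y -> x = y.
Proof.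
move=> dG x y ax ay E; apply/eqP; rewrite eq_sym -subr_eq0; apply/negPn/negP => xy.
have seg t : 0 <= t <= 1 -> ball a d (x + t *: (y - x)).
  move=> /andP[t0 t1]; move: ax ay; rewrite /ball /= => /ltr_normlP[l1 r1] /ltr_normlP[l2 r2].
  have ey : x + t *: (y - x) = (1 - t) * x + t * y by rewrite /GRing.scale /=; ring.
  by rewrite ey ltr_norml; apply/andP; split; nra.
have dif z : ball a d z -> differentiable G z by move=> /dG[/derivable1_diffP].
have [t t01] : exists2 t, 0 <= t <= 1 & G (x + (y - x)) - G x = 'D_(y - x) G (x + t *: (y - x)).
  by apply: MVT_line => t t01; exact/dif/seg.
rewrite subrKC E subrr => /esym/eqP.
have -> : y - x = (y - x) *: (1 : R) by rewrite /GRing.scale /= mulr1.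
rewrite derive_dirZ; last by rewrite /GRing.scale /= mulr1; exact/dif/seg.
rewrite scaler_eq0 (negPf xy) /= -[_ *: 1]/((y - x) * 1) mulr1 => /eqP D0.
by have [_] := dG _ (seg t t01); rewrite D0 eqxx.
Qed.

(** Both coordinates are built this way.  When [w] is a positive function of [y],
given through [w ^ 2 = Q(y)], the form [dy / w] is exact: it is the differential
of [G \o y], where [G] is a primitive of [1 / sqrt Q].  As [G] is injective, [y]
is in turn a function of [G \o y]. *)
Lemma reciprocal_primitive (V : normedModType R) (U : set V) (y w : V -> R) (Q : R -> R) (z0 : V) :
  open U -> U z0 -> smooth_on U y -> smooth_on U w -> (forall z, U z -> 0 < w z) ->
  (forall z, U z -> w z ^+ 2 = Q (y z)) -> continuous Q ->
  exists (B : set V) (G y_ : R -> R),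
    [/\ open B, B z0, B `<=` U & smooth_on B (G \o y)] /\
    [/\ forall z v, B z -> 'D_v (G \o y) z = 'D_v y z / w z &
        forall z, B z -> y_ (G (y z)) = y z].
Proof.
move=> oU Uz0 sy sw w0 wQ cQ; pose a := y z0.
have Qa : 0 < Q a by rewrite -wQ // exprn_gt0 // w0.
have /nbhs_ballP[d /= d0 Qd] : \forall x \near a, 0 < Q x by exact: (cvgr_gt (Q a) (cQ a)).
pose g x := (Num.sqrt (Q x))^-1.
have cg x : ball a d x -> {for x, continuous g}.
  move=> /Qd Qx; have cs : {for x, continuous (fun x => Num.sqrt (Q x))}.
    by apply: (@continuous_comp _ _ _ Q Num.sqrt); [exact: cQ | exact: sqrt_continuous].
  by apply: (cvgV _ cs); rewrite sqrtr_eq0 -ltNge.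
have [G GP] := exists_primitive d0 cg.
have wE z : U z -> (w z)^-1 = g (y z).
  by move=> Uz; rewrite /g -wQ // sqrtr_sqr gtr0_norm // w0.
have ball_half x : ball a (d / 2) x -> ball a d x.
  by apply: le_ball; lra.
have dG x : ball a (d / 2) x -> derivable G x 1 /\ 'D_1 G x = g x.
  by move=> /GP[].
pose B := U `&` y @^-1` ball a (d / 2).
have oB : open B.
  rewrite openE => z [Uz Bz]; apply: filterI; first exact: open_nbhs_nbhs.
  have cy : {for z, continuous y} by exact/differentiable_continuous/(smooth_on_differentiable sy).
  by apply: cy; apply: open_nbhs_nbhs; split; [exact: ball_open | ].
have difG x : ball a (d / 2) x -> differentiable G x by move=> /dG[/derivable1_diffP].
have DG z v : B z -> 'D_v (G \o y) z = 'D_v y z / w z.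
  move=> [Uz Bz]; rewrite derive_chain; [|exact: smooth_on_differentiable sy Uz|exact: difG].
  have -> : 'D_v y z = 'D_v y z *: (1 : R) by rewrite /GRing.scale /= mulr1.
  rewrite derive_dirZ; last exact: difG.
  by rewrite (dG _ Bz).2 -wE // /GRing.scale /= mulr1.
have BU : B `<=` U by move=> z [].
have wn z : B z -> w z != 0 by move=> /BU/w0/lt0r_neq0.
exists B, G, (fun s => xget 0 [set x | ball a (d / 2) x /\ G x = s]); split; split=> //.
- by split=> //; apply: ballxx; lra.
- apply: (@smooth_on_coind _ _ _ B (fun F => F = G \o y \/ smooth_on B F)) => //; last by left.
    move=> F [-> z [Uz Bz]|sF z Bz]; last exact: smooth_on_differentiable sF Bz.
    by apply: differentiable_comp; [exact: smooth_on_differentiable sy Uz | exact: difG].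
  move=> F v [->|sF]; last by exists (fun x => 'D_v F x) => //; right; exact: smooth_on_derive.
  exists (fun z => 'D_v y z / w z); last by move=> z; exact: DG.
  right; apply: (smooth_on_div oB) => //; first exact/smooth_on_derive/(smooth_on_subset BU sy).
  exact: smooth_on_subset BU sw.
- move=> z [Uz Bz]; set P := [set x | _].
  have [Bx] : P (xget 0 P) by apply: (@xgetI _ 0 P (y z)).
  apply: (@injective_of_derive_neq0 G a (d / 2)) => // x Bx'; have [? ->] := dG _ Bx'; split=> //.
  by rewrite invr_eq0 sqrtr_eq0 -ltNge; exact/Qd/ball_half.
Qed.
End ReciprocalPrimitive.

(** The function [f_] of the arclength [s] is known only through [f] in the
coordinates [(s, t)]; its derivatives are the partial derivatives of [f]. *)
Lemma derive1_first_coordinate (R : realType) (A : set 'rV[R]_2) (F : 'rV[R]_2 -> R) (F_ : R -> R) y :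
  open A -> (forall y, A y -> differentiable F y) ->
  (forall y, A y -> F y = F_ (y 0 ord0)) -> A y -> derive1 F_ (y 0 ord0) = 'D_e_s F y.
Proof.
move=> oA dF E Ay.
have cF : (fun h => h^-1 *: ((F \o shift y) (h *: e_s) - F y)) @ 0^' --> 'D_e_s F y.
  exact: (diff_derivable (dF y Ay)).
apply: cvg_lim => //; apply: cvg_trans cF; apply: near_eq_cvg.
have cl : (fun h : R => h *: e_s + y) @ 0 --> 0 *: e_s + y.
  by apply: cvgD; [apply: cvgZr_tmp; exact: cvg_id | exact: cvg_cst].
have nA : \forall h \near (0 : R)^', A (h *: e_s + y).
  by apply: cvg_within; apply: cl; rewrite scale0r add0r; exact: open_nbhs_nbhs.
near=> h; rewrite /= E; last by near: h.
by rewrite (E y Ay) !mxE eqxx mulr1.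
Unshelve. all: by end_near. Qed.

(** * Derivatives along vector fields *)

Local Opaque derive.

Section DerivativeAlongField.
Context {R : realType}.
Local Notation plane := 'rV[R]_2.
Variables (U : set plane) (oU : open U).

(** The lock keeps the limit that defines the derivative folded. *)
Fact dalong_key : unit. Proof. by []. Qed.

Definition dalong (W : normedModType R) (xi : plane -> plane) (F : plane -> W) z : W :=
  locked_with dalong_key ('D_(xi z) F z).

Lemma dalongE (W : normedModType R) xi (F : plane -> W) z : dalong xi F z = 'D_(xi z) F z.
Proof. by rewrite /dalong unlock. Qed.

Section Rules.
Variable xi : plane -> plane.
Implicit Types F G : plane -> R.

Lemma dalong_ext (W : normedModType R) (F G : plane -> W) z : (forall z, U z -> F z = G z) -> U z ->
  dalong xi F z = dalong xi G z.
Proof.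
move=> FG Uz; rewrite !dalongE; apply: near_eq_derive.
by near=> w; apply: FG; near: w; apply: open_nbhs_nbhs.
Unshelve. all: by end_near. Qed.

Lemma dalong_cst (W : normedModType R) (c : W) z : dalong xi (fun _ => c) z = 0.
Proof. by rewrite dalongE; apply: derive_cst. Qed.

Lemma dalongD F G z : smooth_on U F -> smooth_on U G -> U z ->
  dalong xi (fun z => F z + G z) z = dalong xi F z + dalong xi G z.
Proof.
move=> sF sG Uz; rewrite !dalongE; apply: (@deriveD _ _ _ F G); apply: diff_derivable.
  exact: smooth_on_differentiable sF Uz.
exact: smooth_on_differentiable sG Uz.
Qed.

Lemma dalongN F z : smooth_on U F -> U z ->
  dalong xi (fun z => - F z) z = - dalong xi F z.
Proof.
move=> sF Uz; rewrite !dalongE; apply: (@deriveN _ _ _ F); apply: diff_derivable.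
exact: smooth_on_differentiable sF Uz.
Qed.

Lemma dalongB F G z : smooth_on U F -> smooth_on U G -> U z ->
  dalong xi (fun z => F z - G z) z = dalong xi F z - dalong xi G z.
Proof.
by move=> sF sG Uz; rewrite dalongD ?dalongN //; apply: smooth_onN.
Qed.

Lemma dalongM F G z : smooth_on U F -> smooth_on U G -> U z ->
  dalong xi (fun z => F z * G z) z = dalong xi F z * G z + F z * dalong xi G z.
Proof.
move=> sF sG Uz; rewrite !dalongE (@deriveM _ _ F G); try apply: diff_derivable.
- by rewrite addrC /GRing.scale /= mulrC.
- exact: smooth_on_differentiable sF Uz.
- exact: smooth_on_differentiable sG Uz.
Qed.

Lemma dalongZ (c : R) F z : smooth_on U F -> U z ->
  dalong xi (fun z => c * F z) z = c * dalong xi F z.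
Proof.
move=> sF Uz; rewrite dalongM //; last exact: smooth_on_cst.
by rewrite dalong_cst mul0r add0r.
Qed.

Lemma dalong_sum n (F : 'I_n -> plane -> R) z :
  (forall i, smooth_on U (F i)) -> U z ->
  dalong xi (fun z => \sum_i F i z) z = \sum_i dalong xi (F i) z.
Proof.
move=> sF Uz; rewrite dalongE (eq_bigr _ (fun i _ => dalongE xi (F i) z)) -derive_sum.
  by congr ('D_ _ _ _); apply/funext => x; rewrite fct_sumE.
by move=> i; apply: diff_derivable; apply: smooth_on_differentiable (sF i) Uz.
Qed.

Lemma dalong_coord n (F : plane -> 'rV[R]_n) i z : smooth_on U F -> U z ->
  dalong xi F z 0 i = dalong xi (fun z => F z 0 i) z.
Proof. by move=> sF Uz; rewrite !dalongE; apply: derive_rV; apply: smooth_on_differentiable sF Uz. Qed.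

Lemma smooth_on_dalong F : smooth_on U xi -> smooth_on U F ->
  smooth_on U (dalong xi F).
Proof.
move=> sxi sF; have := @smooth_on_sum _ _ U oU _ (index_enum 'I_2)
  (fun i z => xi z 0 i * 'D_(delta_mx 0 i) F z) _.
move=> /(_ (fun i => smooth_onM oU (smooth_on_coord oU i sxi) (smooth_on_derive _ sF))).
apply: smooth_on_ext => // z Uz.
by rewrite dalongE derive_rV_dir //; apply: smooth_on_differentiable sF Uz.
Qed.

Lemma smooth_on_dalong_rV n (F : plane -> 'rV[R]_n) : smooth_on U xi -> smooth_on U F ->
  smooth_on U (dalong xi F).
Proof.
move=> sxi sF; apply: smooth_on_rV => // i.
have sFi := smooth_on_dalong sxi (smooth_on_coord oU i sF).
by apply: (smooth_on_ext oU _ sFi) => z Uz; rewrite dalong_coord.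
Qed.
End Rules.

Section Commutator.
Variables (xi eta : plane -> plane).
Hypotheses (sxi : smooth_on U xi) (seta : smooth_on U eta).

Lemma dalong_dalong (F : plane -> R) z : smooth_on U F -> U z ->
  dalong xi (dalong eta F) z = 'D_('D_(xi z) eta z) F z
  + \sum_i \sum_j eta z 0 i * xi z 0 j * 'D_(delta_mx 0 j) (fun y => 'D_(delta_mx 0 i) F y) z.
Proof.
move=> sF Uz; have sd i := smooth_on_derive (delta_mx 0 i) sF.
have se i := smooth_on_coord oU i seta.
rewrite (@dalong_ext _ _ _ (fun z => \sum_i eta z 0 i * 'D_(delta_mx 0 i) F z)) //; last first.
  by move=> y Uy; rewrite dalongE derive_rV_dir //; apply: smooth_on_differentiable sF Uy.
rewrite dalong_sum //; last by move=> i; apply: smooth_onM.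
rewrite derive_rV_dir; last exact: smooth_on_differentiable sF Uz.
rewrite -big_split /=; apply: eq_bigr => i _.
rewrite (dalongM xi (se i) (sd i) Uz); congr (_ + _).
  by rewrite -dalong_coord // dalongE.
rewrite dalongE (derive_rV_dir _ (smooth_on_differentiable (sd i) Uz)) mulr_sumr.
by apply: eq_bigr => j _; rewrite -mulrA.
Qed.
End Commutator.

(** The terms with second derivatives cancel by symmetry. *)
Lemma dalong_commutator xi eta (F : plane -> R) z :
  smooth_on U xi -> smooth_on U eta -> smooth_on U F -> U z ->
  dalong xi (dalong eta F) z - dalong eta (dalong xi F) z
  = 'D_('D_(xi z) eta z - 'D_(eta z) xi z) F z.
Proof.
move=> sxi seta sF Uz; have dF := smooth_on_differentiable sF Uz.
rewrite !dalong_dalong //.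
pose dd i j := 'D_(delta_mx 0 j) (fun y => 'D_(delta_mx 0 i) F y) z.
have ddC i j : dd i j = dd j i by exact: derive_symmetric oU sF Uz.
have E : \sum_i \sum_j xi z 0 i * eta z 0 j * dd i j =
         \sum_i \sum_j eta z 0 i * xi z 0 j * dd i j.
  rewrite exchange_big; apply: eq_bigr => i _; apply: eq_bigr => j _ /=.
  by rewrite ddC (mulrC (xi z 0 j)).
rewrite -[X in _ - (_ + X)]/(\sum_i \sum_j xi z 0 i * eta z 0 j * dd i j) E.
rewrite -[X in (_ + X) - _]/(\sum_i \sum_j eta z 0 i * xi z 0 j * dd i j).
move: (\sum_i _) => T.
have cancel (a b t : R) : (a + t) - (b + t) = a - b by ring.
by rewrite derive_dirB //; exact: cancel.
Qed.

Lemma dalong_commutator_rV xi eta n (F : plane -> 'rV[R]_n) z :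
  smooth_on U xi -> smooth_on U eta -> smooth_on U F -> U z ->
  dalong xi (dalong eta F) z - dalong eta (dalong xi F) z
  = 'D_('D_(xi z) eta z - 'D_(eta z) xi z) F z.
Proof.
move=> sxi seta sF Uz; apply/rowP => i.
have E (a b : plane -> plane) : smooth_on U b ->
    dalong a (dalong b F) z 0 i = dalong a (dalong b (fun z => F z 0 i)) z.
  move=> sb; rewrite (dalong_coord _ _ (smooth_on_dalong_rV sb sF) Uz).
  by apply: dalong_ext => // y Uy; rewrite dalong_coord.
have -> : (dalong xi (dalong eta F) z - dalong eta (dalong xi F) z) 0 i
    = dalong xi (dalong eta (fun z => F z 0 i)) z - dalong eta (dalong xi (fun z => F z 0 i)) z.
  have sub0i (T : zmodType) (u v : 'rV[T]_n) : (u - v) 0 i = u 0 i - v 0 i by rewrite !mxE.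
  rewrite sub0i; congr (_ - _); [exact: E seta | exact: E sxi].
rewrite (derive_rV _ _ (smooth_on_differentiable sF Uz)).
exact: dalong_commutator sxi seta (smooth_on_coord oU i sF) Uz.
Qed.
End DerivativeAlongField.

(** * The ambient inner product *)

Section AmbientProduct.
Context {R : realType} (eps : R).
Local Notation vec := 'rV[R]_5.
Local Notation ip := (ambient_ip eps).

Definition ip_sign (i : 'I_5) : R := if (eps < 0) && (i == ord0) then -1 else 1.

Lemma ipE u v : ip u v = \sum_i ip_sign i * (u 0 i * v 0 i).
Proof.
rewrite /ambient_ip [RHS]big_ord_recl /ip_sign eqxx andbT; congr (_ + _).
by apply: eq_bigr => i _; rewrite andbF mul1r.
Qed.

Lemma ipC u v : ip u v = ip v u.
Proof. by rewrite !ipE; apply: eq_bigr => i _; rewrite (mulrC (u 0 i)). Qed.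

Lemma ipDl u v w : ip (u + v) w = ip u w + ip v w.
Proof.
rewrite !ipE -big_split; apply: eq_bigr => i _ /=.
by rewrite mxE mulrDl mulrDr.
Qed.

Lemma ipZl a u v : ip (a *: u) v = a * ip u v.
Proof. by rewrite !ipE mulr_sumr; apply: eq_bigr => i _; rewrite mxE; ring. Qed.

Lemma ipDr u v w : ip w (u + v) = ip w u + ip w v.
Proof. by rewrite ipC ipDl !(ipC w). Qed.

Lemma ipZr a u v : ip v (a *: u) = a * ip v u.
Proof. by rewrite ipC ipZl (ipC v). Qed.

Lemma ipNl u v : ip (- u) v = - ip u v.
Proof. by rewrite -scaleN1r ipZl mulN1r. Qed.

Lemma ipBl u v w : ip (u - v) w = ip u w - ip v w.
Proof. by rewrite ipDl ipNl. Qed.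

Lemma ip0l u : ip 0 u = 0.
Proof. by rewrite -(scale0r 0) ipZl mul0r. Qed.

Lemma ip0r u : ip u 0 = 0.
Proof. by rewrite ipC ip0l. Qed.

(** Five orthogonal non-isotropic vectors form a basis, for a form of any signature:
the matrix [B] of the coordinate functions inverts the matrix of the vectors. *)
Lemma orthogonal_expansion (fr : 'I_5 -> vec) (d : 'I_5 -> R) u :
  (forall i, d i != 0) -> (forall i j, ip (fr i) (fr j) = d i *+ (i == j)) ->
  u = \sum_i (ip u (fr i) / d i) *: fr i.
Proof.
move=> d0 frd.
pose A := \matrix_(i < 5) fr i.
pose B : 'M[R]_5 := \matrix_(j, i) (ip_sign j * fr i 0 j / d i).
have ipB v i : (v *m B) 0 i = ip v (fr i) / d i.
  rewrite mxE ipE mulr_suml; apply: eq_bigr => j _; rewrite mxE; ring.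
have AB : A *m B = 1%:M.
  apply/matrixP => i j.
  have -> : (A *m B) i j = (row i A *m B) 0 j by rewrite -row_mul [RHS]mxE.
  rewrite rowK ipB frd mxE; case: eqP => [->|_]; last by rewrite mulr0n mul0r.
  by rewrite mulr1n divff.
have BA := mulmx1C AB.
rewrite -[LHS]mulmx1 -BA mulmxA mulmx_sum_row.
by apply: eq_bigr => i _; rewrite ipB rowK.
Qed.

Section Calculus.
Variables (U : set 'rV[R]_2) (oU : open U).
Implicit Types F G : 'rV[R]_2 -> vec.

Lemma smooth_on_ip F G : smooth_on U F -> smooth_on U G ->
  smooth_on U (fun z => ip (F z) (G z)).
Proof.
move=> sF sG.
have := @smooth_on_sum _ _ U oU _ (index_enum 'I_5) (fun i z => ip_sign i * (F z 0 i * G z 0 i)) _.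
move=> /(_ (fun i => smooth_onZ oU _ (smooth_onM oU (smooth_on_coord oU i sF) (smooth_on_coord oU i sG)))).
by apply: smooth_on_ext => // z Uz; rewrite ipE.
Qed.

Lemma dalong_ip xi F G z : smooth_on U F -> smooth_on U G -> U z ->
  dalong xi (fun z => ip (F z) (G z)) z
  = ip (dalong xi F z) (G z) + ip (F z) (dalong xi G z).
Proof.
move=> sF sG Uz.
have sFi i := smooth_on_coord oU i sF; have sGi i := smooth_on_coord oU i sG.
rewrite (@dalong_ext _ _ oU _ _ _ (fun z => \sum_i ip_sign i * (F z 0 i * G z 0 i))) //; last first.
  by move=> y _; rewrite ipE.
have sFG i := smooth_onZ oU (ip_sign i) (smooth_onM oU (sFi i) (sGi i)).
rewrite (dalong_sum xi sFG Uz).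
rewrite !ipE -big_split; apply: eq_bigr => i _ /=.
rewrite (dalongZ xi _ (smooth_onM oU (sFi i) (sGi i)) Uz).
by rewrite (dalongM xi (sFi i) (sGi i) Uz) mulrDr (dalong_coord xi _ sF Uz) (dalong_coord xi _ sG Uz).
Qed.
End Calculus.
End AmbientProduct.

(** * Moving frames in the space form *)

Section SpaceFormFacts.
Context {R : realType} (eps : R).
Local Notation vec := 'rV[R]_5.
Local Notation ip := (ambient_ip eps).

Definition normal_sqnorm : R := if eps == 0 then 1 else eps^-1.

Lemma normal_sqnorm_neq0 : normal_sqnorm != 0.
Proof. by rewrite /normal_sqnorm; have [_|e0] := eqVneq eps 0; rewrite ?oner_eq0 ?invr_eq0. Qed.

Lemma ip_delta0 (v : vec) : eps = 0 -> ip v (delta_mx 0 ord0) = v 0 ord0.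
Proof.
move=> e0; rewrite ipE (bigD1 ord0) //= big1 => [|i /negPf i0].
  by rewrite /ip_sign e0 ltxx mul1r addr0 !mxE !eqxx mulr1.
by rewrite !mxE i0 andbF !mulr0.
Qed.

Lemma space_form_normalE x : space_form eps x ->
  ip (space_form_normal eps x) (space_form_normal eps x) = normal_sqnorm.
Proof.
rewrite /space_form /space_form_normal /normal_sqnorm /=; case: eqP => [e0 _|_ []//].
by rewrite ip_delta0 // !mxE !eqxx.
Qed.

Lemma orthonormal_expansion x (v1 v2 v3 v4 u : vec) : space_form eps x ->
  [/\ ip v1 v1 = 1, ip v2 v2 = 1, ip v3 v3 = 1 & ip v4 v4 = 1] ->
  [/\ ip v1 v2 = 0, ip v1 v3 = 0, ip v1 v4 = 0, ip v2 v3 = 0 & ip v2 v4 = 0] ->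
  ip v3 v4 = 0 ->
  let n := space_form_normal eps x in
  [/\ ip v1 n = 0, ip v2 n = 0, ip v3 n = 0 & ip v4 n = 0] ->
  u = ip u v1 *: v1 + ip u v2 *: v2 + ip u v3 *: v3 + ip u v4 *: v4
    + (ip u n / normal_sqnorm) *: n.
Proof.
move=> Nx [v11 v22 v33 v44] [v12 v13 v14 v23 v24] v34 n [n1 n2 n3 n4].
pose fr (i : 'I_5) := nth 0 [:: v1; v2; v3; v4; n] i.
pose d (i : 'I_5) := nth 0 [:: 1; 1; 1; 1; normal_sqnorm] i : R.
rewrite [LHS](@orthogonal_expansion _ eps fr d).
- by rewrite !big_ord_recl big_ord0 /fr /d /= !divr1 addr0 !addrA.
- by case; do 5?[case=> [|]] => //= i; rewrite /d /= ?oner_eq0 ?normal_sqnorm_neq0.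
- have nn : ip n n = normal_sqnorm by exact: space_form_normalE.
  case; do 5?[case=> [|]] => // i0; case; do 5?[case=> [|]] => // j0;
  rewrite /fr /d /= ?mulr1n ?mulr0n //.
  all: by rewrite ipC.
Qed.

End SpaceFormFacts.

Definition tangent_to_N (R : realType) (eps : R) (U : set 'rV[R]_2)
    (phi F : 'rV[R]_2 -> 'rV[R]_5) :=
  smooth_on U F /\ forall z, U z -> ambient_ip eps (F z) (space_form_normal eps (phi z)) = 0.

(** [e1], [e2] are the images under the differential of [phi] of the fields [xi1], [xi2]
of the parameter plane, and [e3], [e4] are normal to the surface in the space form. *)
Record moving_frame (R : realType) (eps : R) (U : set 'rV[R]_2)
    (phi e1 e2 e3 e4 : 'rV[R]_2 -> 'rV[R]_5) (xi1 xi2 : 'rV[R]_2 -> 'rV[R]_2) : Prop := {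
  mf_open : open U;
  mf_phi : smooth_on U phi;
  mf_xi1 : smooth_on U xi1;
  mf_xi2 : smooth_on U xi2;
  mf_N : forall z, U z -> space_form eps (phi z);
  mf_tangent : [/\ tangent_to_N eps U phi e1, tangent_to_N eps U phi e2,
                   tangent_to_N eps U phi e3 & tangent_to_N eps U phi e4];
  mf_unit : forall z, U z ->
    [/\ ambient_ip eps (e1 z) (e1 z) = 1, ambient_ip eps (e2 z) (e2 z) = 1,
        ambient_ip eps (e3 z) (e3 z) = 1 & ambient_ip eps (e4 z) (e4 z) = 1];
  mf_orth : forall z, U z ->
    [/\ ambient_ip eps (e1 z) (e2 z) = 0, ambient_ip eps (e1 z) (e3 z) = 0 &
        ambient_ip eps (e1 z) (e4 z) = 0] /\
    [/\ ambient_ip eps (e2 z) (e3 z) = 0, ambient_ip eps (e2 z) (e4 z) = 0 &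
        ambient_ip eps (e3 z) (e4 z) = 0];
  mf_dphi : forall z, U z -> dalong xi1 phi z = e1 z /\ dalong xi2 phi z = e2 z;
  mf_basis : forall z h, U z ->
    h = ambient_ip eps ('D_h phi z) (e1 z) *: xi1 z + ambient_ip eps ('D_h phi z) (e2 z) *: xi2 z
}.

Section MovingFrame.
Context {R : realType} (eps : R).
Local Notation plane := 'rV[R]_2.
Local Notation vec := 'rV[R]_5.
Local Notation ip := (ambient_ip eps).
Context (U : set plane) (phi e1 e2 e3 e4 : plane -> vec) (xi1 xi2 : plane -> plane).
Hypothesis mf : moving_frame eps U phi e1 e2 e3 e4 xi1 xi2.
Local Notation tangent_to_N := (tangent_to_N eps U phi).

Let oU : open U := mf_open mf.
Let sphi : smooth_on U phi := mf_phi mf.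
Let sxi1 : smooth_on U xi1 := mf_xi1 mf.
Let sxi2 : smooth_on U xi2 := mf_xi2 mf.
Let Nphi := mf_N mf.
Let N1 : tangent_to_N e1. Proof. by have [] := mf_tangent mf. Qed.
Let N2 : tangent_to_N e2. Proof. by have [] := mf_tangent mf. Qed.
Let N3 : tangent_to_N e3. Proof. by have [] := mf_tangent mf. Qed.
Let N4 : tangent_to_N e4. Proof. by have [] := mf_tangent mf. Qed.
Let se1 : smooth_on U e1 := N1.1.
Let se4 : smooth_on U e4 := N4.1.
Let e11 z : U z -> ip (e1 z) (e1 z) = 1. Proof. by move=> /(mf_unit mf)[]. Qed.
Let e22 z : U z -> ip (e2 z) (e2 z) = 1. Proof. by move=> /(mf_unit mf)[]. Qed.
Let e33 z : U z -> ip (e3 z) (e3 z) = 1. Proof. by move=> /(mf_unit mf)[]. Qed.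
Let e44 z : U z -> ip (e4 z) (e4 z) = 1. Proof. by move=> /(mf_unit mf)[]. Qed.
Let e12 z : U z -> ip (e1 z) (e2 z) = 0. Proof. by move=> /(mf_orth mf)[[]]. Qed.
Let e13 z : U z -> ip (e1 z) (e3 z) = 0. Proof. by move=> /(mf_orth mf)[[]]. Qed.
Let e14 z : U z -> ip (e1 z) (e4 z) = 0. Proof. by move=> /(mf_orth mf)[[]]. Qed.
Let e23 z : U z -> ip (e2 z) (e3 z) = 0. Proof. by move=> /(mf_orth mf)[_ []]. Qed.
Let e24 z : U z -> ip (e2 z) (e4 z) = 0. Proof. by move=> /(mf_orth mf)[_ []]. Qed.
Let e34 z : U z -> ip (e3 z) (e4 z) = 0. Proof. by move=> /(mf_orth mf)[_ []]. Qed.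
Let D1phi z : U z -> dalong xi1 phi z = e1 z. Proof. by move=> /(mf_dphi mf)[]. Qed.
Let D2phi z : U z -> dalong xi2 phi z = e2 z. Proof. by move=> /(mf_dphi mf)[]. Qed.
Let xi_basis := mf_basis mf.

Notation D1 := (dalong xi1).
Notation D2 := (dalong xi2).

Lemma frame_expansion z u : U z ->
  u = ip u (e1 z) *: e1 z + ip u (e2 z) *: e2 z + ip u (e3 z) *: e3 z + ip u (e4 z) *: e4 z
    + (ip u (space_form_normal eps (phi z)) / normal_sqnorm eps)
        *: space_form_normal eps (phi z).
Proof.
move=> Uz; have [[_ n1] [_ n2]] := (N1, N2); have [[_ n3] [_ n4]] := (N3, N4).
apply: (orthonormal_expansion u (Nphi Uz)); first [exact: e34 | by split; auto].
Qed.

Section Weingarten.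
Variables (xi : plane -> plane) (e : plane -> vec).
Hypothesis (Dphi : forall z, U z -> dalong xi phi z = e z).
Hypothesis (Ne : tangent_to_N e).

(** Differentiating [<F, phi> = 0] shows that the derivative of a field tangent to the
space form has the component [- eps <F, e>] along [phi]; for [eps = 0] the normal
is constant and there is no such component. *)
Lemma normal_component F z : tangent_to_N F -> U z ->
  (ip (dalong xi F z) (space_form_normal eps (phi z)) / normal_sqnorm eps)
    *: space_form_normal eps (phi z) = - (eps * ip (F z) (e z)) *: phi z.
Proof.
move=> [sF NF] Uz; rewrite /normal_sqnorm.
have [e0|e0] := eqVneq eps 0.
  rewrite {4}e0 mul0r oppr0 scale0r /space_form_normal e0 eqxx.
  have scst : smooth_on U (fun _ : plane => delta_mx 0 ord0 : vec) by exact: smooth_on_cst.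
  have : dalong xi (fun z => ip (F z) (delta_mx 0 ord0)) z = 0.
    rewrite (@dalong_ext _ _ oU _ _ _ (fun _ => 0)) // ?dalong_cst // => y Uy.
    by have := NF y Uy; rewrite /space_form_normal e0 eqxx.
  rewrite (dalong_ip eps oU xi sF scst Uz) dalong_cst ip0r addr0 -{2}e0 => ->.
  by rewrite mul0r scale0r.
rewrite /space_form_normal (negPf e0) invrK.
have : dalong xi (fun z => ip (F z) (phi z)) z = 0.
  rewrite (@dalong_ext _ _ oU _ _ _ (fun _ => 0)) // ?dalong_cst // => y Uy.
  by have := NF y Uy; rewrite /space_form_normal (negPf e0).
rewrite (dalong_ip eps oU xi sF sphi Uz) Dphi // => /eqP.
by rewrite addr_eq0 => /eqP ->; rewrite mulNr mulrC.
Qed.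

Lemma weingarten F z : tangent_to_N F -> U z ->
  dalong xi F z = ip (dalong xi F z) (e1 z) *: e1 z + ip (dalong xi F z) (e2 z) *: e2 z
    + ip (dalong xi F z) (e3 z) *: e3 z + ip (dalong xi F z) (e4 z) *: e4 z
    - (eps * ip (F z) (e z)) *: phi z.
Proof.
by move=> NF Uz; rewrite {1}(frame_expansion (dalong xi F z) Uz) normal_component // scaleNr.
Qed.

Lemma dalong_skew F G c z : (forall z, U z -> ip (F z) (G z) = c) ->
  tangent_to_N F -> tangent_to_N G -> U z ->
  ip (dalong xi F z) (G z) = - ip (dalong xi G z) (F z).
Proof.
move=> FG [sF _] [sG _] Uz; apply/eqP; rewrite -addr_eq0 (ipC _ (dalong xi G z)).
rewrite -(dalong_ip eps oU xi sF sG Uz) (@dalong_ext _ _ oU _ _ _ (fun _ => c)) //.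
by rewrite dalong_cst.
Qed.

Lemma dalong_skew0 F c z : (forall z, U z -> ip (F z) (F z) = c) ->
  tangent_to_N F -> U z -> ip (dalong xi F z) (F z) = 0.
Proof. by move=> FF NF Uz; have := dalong_skew FF NF NF Uz; lra. Qed.

End Weingarten.

Lemma eps_ip_phi F xi e z : (forall z, U z -> dalong xi phi z = e z) ->
  tangent_to_N F -> U z -> eps * ip (phi z) (dalong xi F z) = - (eps * ip (F z) (e z)).
Proof.
move=> Dphi [sF NF] Uz; have [->|e0] := eqVneq eps 0; first by rewrite !mul0r oppr0.
have : dalong xi (fun z => ip (F z) (phi z)) z = 0.
  rewrite (@dalong_ext _ _ oU _ _ _ (fun _ => 0)) // ?dalong_cst // => y Uy.
  by have := NF y Uy; rewrite /space_form_normal (negPf e0).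
rewrite (dalong_ip eps oU xi sF sphi Uz) Dphi // ipC => /eqP.
by rewrite addr_eq0 => /eqP ->; rewrite mulrN.
Qed.

Lemma ip_derivatives xi e eta e' F G z :
  (forall z, U z -> dalong xi phi z = e z) -> (forall z, U z -> dalong eta phi z = e' z) ->
  tangent_to_N F -> tangent_to_N G -> U z ->
  ip (dalong xi F z) (dalong eta G z) =
    ip (dalong xi F z) (e1 z) * ip (dalong eta G z) (e1 z)
  + ip (dalong xi F z) (e2 z) * ip (dalong eta G z) (e2 z)
  + ip (dalong xi F z) (e3 z) * ip (dalong eta G z) (e3 z)
  + ip (dalong xi F z) (e4 z) * ip (dalong eta G z) (e4 z)
  + eps * ip (F z) (e z) * ip (G z) (e' z).
Proof.
move=> De De' NF NG Uz.
have expand v : ip (dalong xi F z) v =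
    ip (dalong xi F z) (e1 z) * ip v (e1 z) + ip (dalong xi F z) (e2 z) * ip v (e2 z)
  + ip (dalong xi F z) (e3 z) * ip v (e3 z) + ip (dalong xi F z) (e4 z) * ip v (e4 z)
  - ip (F z) (e z) * (eps * ip (phi z) v).
  rewrite {1}(weingarten De NF Uz) ipBl !ipDl !ipZl !(ipC _ v); congr (_ - _).
  by rewrite [RHS]mulrCA mulrA.
rewrite expand (eps_ip_phi De' NG Uz); congr (_ + _).
by rewrite mulrN opprK mulrCA mulrA.
Qed.

Definition conn1 z := ip (D1 e2 z) (e1 z).

Definition conn2 z := ip (D2 e2 z) (e1 z).

(** The bracket of [xi1] and [xi2] is found by applying it to [phi], whose derivatives
are [e1] and [e2]. *)
Lemma frame_bracket (W : normedModType R) (F : plane -> W) z :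
  differentiable F z -> U z ->
  'D_('D_(xi1 z) xi2 z - 'D_(xi2 z) xi1 z) F z = conn1 z *: D1 F z + conn2 z *: D2 F z.
Proof.
move=> dF Uz; set w := 'D_(xi1 z) xi2 z - _.
have wE : 'D_w phi z = D1 e2 z - D2 e1 z.
  rewrite -(dalong_commutator_rV oU sxi1 sxi2 sphi Uz).
  by rewrite (dalong_ext oU xi1 D2phi Uz) (dalong_ext oU xi2 D1phi Uz).
have w1 : ip ('D_w phi z) (e1 z) = conn1 z.
  by rewrite wE ipBl (dalong_skew0 xi2 e11 N1 Uz) subr0.
have w2 : ip ('D_w phi z) (e2 z) = conn2 z.
  rewrite wE ipBl (dalong_skew0 xi1 e22 N2 Uz) sub0r.
  by rewrite (dalong_skew xi2 e12 N1 N2 Uz) opprK.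
have := xi_basis w Uz; rewrite w1 w2; clearbody w => ->.
by rewrite (derive_dirD _ _ dF) !(derive_dirZ _ _ dF) !dalongE.
Qed.

Lemma frame_commutator n (F : plane -> 'rV[R]_n) z : smooth_on U F -> U z ->
  D1 (D2 F) z - D2 (D1 F) z = conn1 z *: D1 F z + conn2 z *: D2 F z.
Proof.
move=> sF Uz; apply: etrans (dalong_commutator_rV oU sxi1 sxi2 sF Uz) _.
exact: frame_bracket (smooth_on_differentiable sF Uz) Uz.
Qed.

Lemma frame_commutator_scalar (F : plane -> R) z : smooth_on U F -> U z ->
  D1 (D2 F) z - D2 (D1 F) z = conn1 z * D1 F z + conn2 z * D2 F z.
Proof.
move=> sF Uz; apply: etrans (dalong_commutator oU sxi1 sxi2 sF Uz) _.
exact: frame_bracket (smooth_on_differentiable sF Uz) Uz.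
Qed.

(** The common source of the Gauss, Codazzi and Ricci equations: the commutator of the
frame is applied to the field [F] of R^5, where derivatives have no curvature. *)
Lemma structure_equation F G z : tangent_to_N F -> tangent_to_N G -> U z ->
  D1 (fun z => ip (D2 F z) (G z)) z - D2 (fun z => ip (D1 F z) (G z)) z
  = ip (D2 F z) (D1 G z) - ip (D1 F z) (D2 G z)
    + conn1 z * ip (D1 F z) (G z) + conn2 z * ip (D2 F z) (G z).
Proof.
move=> [sF _] [sG _] Uz.
have sF1 := smooth_on_dalong_rV oU sxi1 sF; have sF2 := smooth_on_dalong_rV oU sxi2 sF.
rewrite (dalong_ip eps oU xi1 sF2 sG Uz) (dalong_ip eps oU xi2 sF1 sG Uz).
have regroup (a b c d x y : R) : a - b = x + y -> (a + c) - (b + d) = c - d + x + y by lra.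
have E : ip (D1 (D2 F) z - D2 (D1 F) z) (G z)
    = conn1 z * ip (D1 F z) (G z) + conn2 z * ip (D2 F z) (G z).
  by apply: etrans (congr1 (ip^~ (G z)) (frame_commutator sF Uz)) _; rewrite ipDl !ipZl.
by apply: regroup; apply: etrans E; apply/esym/ipBl.
Qed.

(** [A_3] is diagonal in [(e1, e2)] and [A_4] is traceless. *)
Hypothesis (A3_offdiagonal : forall z, U z -> ip (D1 e2 z) (e3 z) = 0).
Hypothesis (A4_trace : forall z, U z -> ip (D2 e2 z) (e4 z) = - ip (D1 e1 z) (e4 z)).

(** The matrix of [A_3] is diagonal with entries [k1], [k2]; that of [A_4] has the rows
[(al, be)] and [(be, - al)].  The coefficients [b1], [b2] are those of the normal
connection. *)
Definition coef_k1 z := ip (D1 e1 z) (e3 z).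

Definition coef_k2 z := ip (D2 e2 z) (e3 z).
Definition coef_al z := ip (D1 e1 z) (e4 z).

Definition coef_be z := ip (D1 e2 z) (e4 z).
Definition coef_b1 z := ip (D1 e3 z) (e4 z).

Definition coef_b2 z := ip (D2 e3 z) (e4 z).

Lemma frame_bracket_tangent z : U z ->
  D1 e2 z - D2 e1 z = conn1 z *: e1 z + conn2 z *: e2 z.
Proof.
move=> Uz; have := frame_commutator sphi Uz.
by rewrite (dalong_ext oU xi1 D2phi Uz) (dalong_ext oU xi2 D1phi Uz) D1phi // D2phi.
Qed.

Lemma second_form_symmetric u z : U z -> ip (e1 z) u = 0 -> ip (e2 z) u = 0 ->
  ip (D2 e1 z) u = ip (D1 e2 z) u.
Proof.
move=> Uz u1 u2; apply/eqP; rewrite eq_sym -subr_eq0 -ipBl.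
have vanish a b : ip (a *: e1 z + b *: e2 z) u = 0 by rewrite ipDl !ipZl u1 u2 !mulr0 addr0.
by apply/eqP/(etrans (congr1 (ip^~ u) (frame_bracket_tangent Uz)))/vanish.
Qed.

Lemma connection_along_e1 z : U z ->
  [/\ [/\ ip (D1 e1 z) (e1 z) = 0, ip (D1 e1 z) (e2 z) = - conn1 z,
          ip (D1 e1 z) (e3 z) = coef_k1 z & ip (D1 e1 z) (e4 z) = coef_al z],
      [/\ ip (D1 e2 z) (e1 z) = conn1 z, ip (D1 e2 z) (e2 z) = 0,
          ip (D1 e2 z) (e3 z) = 0 & ip (D1 e2 z) (e4 z) = coef_be z],
      [/\ ip (D1 e3 z) (e1 z) = - coef_k1 z, ip (D1 e3 z) (e2 z) = 0,
          ip (D1 e3 z) (e3 z) = 0 & ip (D1 e3 z) (e4 z) = coef_b1 z] &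
      [/\ ip (D1 e4 z) (e1 z) = - coef_al z, ip (D1 e4 z) (e2 z) = - coef_be z,
          ip (D1 e4 z) (e3 z) = - coef_b1 z & ip (D1 e4 z) (e4 z) = 0]].
Proof.
move=> Uz; have H x y : x = - y -> y = - x :> R by move=> ->; rewrite opprK.
have s12 := dalong_skew xi1 e12 N1 N2 Uz; have s13 := dalong_skew xi1 e13 N1 N3 Uz.
have s14 := dalong_skew xi1 e14 N1 N4 Uz; have s23 := dalong_skew xi1 e23 N2 N3 Uz.
have s24 := dalong_skew xi1 e24 N2 N4 Uz; have s34 := dalong_skew xi1 e34 N3 N4 Uz.
have t3 := A3_offdiagonal Uz.
split; split; first exact: dalong_skew0 e11 N1 Uz.
- exact: s12.
- by [].
- by [].
- by [].
- exact: dalong_skew0 e22 N2 Uz.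
- exact: t3.
- by [].
- exact: H s13.
- by rewrite (H _ _ s23) t3 oppr0.
- exact: dalong_skew0 e33 N3 Uz.
- by [].
- exact: H s14.
- exact: H s24.
- exact: H s34.
- exact: dalong_skew0 e44 N4 Uz.
Qed.

Lemma connection_along_e2 z : U z ->
  [/\ [/\ ip (D2 e1 z) (e1 z) = 0, ip (D2 e1 z) (e2 z) = - conn2 z,
          ip (D2 e1 z) (e3 z) = 0 & ip (D2 e1 z) (e4 z) = coef_be z],
      [/\ ip (D2 e2 z) (e1 z) = conn2 z, ip (D2 e2 z) (e2 z) = 0,
          ip (D2 e2 z) (e3 z) = coef_k2 z & ip (D2 e2 z) (e4 z) = - coef_al z],
      [/\ ip (D2 e3 z) (e1 z) = 0, ip (D2 e3 z) (e2 z) = - coef_k2 z,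
          ip (D2 e3 z) (e3 z) = 0 & ip (D2 e3 z) (e4 z) = coef_b2 z] &
      [/\ ip (D2 e4 z) (e1 z) = - coef_be z, ip (D2 e4 z) (e2 z) = coef_al z,
          ip (D2 e4 z) (e3 z) = - coef_b2 z & ip (D2 e4 z) (e4 z) = 0]].
Proof.
move=> Uz; have H x y : x = - y -> y = - x :> R by move=> ->; rewrite opprK.
have s12 := dalong_skew xi2 e12 N1 N2 Uz; have s13 := dalong_skew xi2 e13 N1 N3 Uz.
have s14 := dalong_skew xi2 e14 N1 N4 Uz; have s23 := dalong_skew xi2 e23 N2 N3 Uz.
have s24 := dalong_skew xi2 e24 N2 N4 Uz; have s34 := dalong_skew xi2 e34 N3 N4 Uz.
have t3 : ip (D2 e1 z) (e3 z) = 0 by rewrite second_form_symmetric ?A3_offdiagonal ?e13 ?e23.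
have t4 : ip (D2 e1 z) (e4 z) = coef_be z by rewrite second_form_symmetric ?e14 ?e24.
have t5 := A4_trace Uz.
split; split; first exact: dalong_skew0 e11 N1 Uz.
- exact: s12.
- exact: t3.
- exact: t4.
- by [].
- exact: dalong_skew0 e22 N2 Uz.
- by [].
- exact: t5.
- by rewrite (H _ _ s13) t3 oppr0.
- exact: H s23.
- exact: dalong_skew0 e33 N3 Uz.
- by [].
- by rewrite (H _ _ s14) t4.
- by rewrite (H _ _ s24) t5 opprK.
- exact: H s34.
- exact: dalong_skew0 e44 N4 Uz.
Qed.

Lemma structure_equation_values F G (X Y : plane -> R) z p1 p2 p3 p4 q1 q2 q3 q4
    r1 r2 r3 r4 t1 t2 t3 t4 u1 u2 v1 v2 :
  tangent_to_N F -> tangent_to_N G -> U z ->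
  (forall y, U y -> ip (D2 F y) (G y) = X y) -> (forall y, U y -> ip (D1 F y) (G y) = Y y) ->
  [/\ ip (D1 F z) (e1 z) = p1, ip (D1 F z) (e2 z) = p2,
      ip (D1 F z) (e3 z) = p3 & ip (D1 F z) (e4 z) = p4] ->
  [/\ ip (D2 F z) (e1 z) = q1, ip (D2 F z) (e2 z) = q2,
      ip (D2 F z) (e3 z) = q3 & ip (D2 F z) (e4 z) = q4] ->
  [/\ ip (D1 G z) (e1 z) = r1, ip (D1 G z) (e2 z) = r2,
      ip (D1 G z) (e3 z) = r3 & ip (D1 G z) (e4 z) = r4] ->
  [/\ ip (D2 G z) (e1 z) = t1, ip (D2 G z) (e2 z) = t2,
      ip (D2 G z) (e3 z) = t3 & ip (D2 G z) (e4 z) = t4] ->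
  [/\ ip (F z) (e1 z) = u1, ip (F z) (e2 z) = u2,
      ip (G z) (e1 z) = v1 & ip (G z) (e2 z) = v2] ->
  D1 X z - D2 Y z = (q1 * r1 + q2 * r2 + q3 * r3 + q4 * r4 + eps * u2 * v1)
    - (p1 * t1 + p2 * t2 + p3 * t3 + p4 * t4 + eps * u1 * v2)
    + conn1 z * Y z + conn2 z * X z.
Proof.
move=> NF NG Uz XE YE [<- <- <- <-] [<- <- <- <-] [<- <- <- <-] [<- <- <- <-] [<- <- <- <-].
have E := structure_equation NF NG Uz.
rewrite (ip_derivatives D2phi D1phi NF NG Uz) (ip_derivatives D1phi D2phi NF NG Uz) in E.
by rewrite -(dalong_ext oU xi1 XE Uz) -(dalong_ext oU xi2 YE Uz) -(XE z Uz) -(YE z Uz).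
Qed.

Lemma gauss_equation z : U z -> D1 conn2 z - D2 conn1 z
  = coef_k1 z * coef_k2 z - coef_al z ^+ 2 - coef_be z ^+ 2 + eps + conn1 z ^+ 2 + conn2 z ^+ 2.
Proof.
move=> Uz; have [S1 S2 S3 S4] := connection_along_e1 Uz.
have [T1 T2 T3 T4] := connection_along_e2 Uz.
have V : [/\ ip (e2 z) (e1 z) = 0, ip (e2 z) (e2 z) = 1, ip (e1 z) (e1 z) = 1
    & ip (e1 z) (e2 z) = 0].
  by split; [rewrite ipC; exact: e12 | exact: e22 | exact: e11 | exact: e12].
have E := structure_equation_values N2 N1 Uz (X := conn2) (Y := conn1)
  (fun y _ => erefl) (fun y _ => erefl) S2 T2 S1 T1 V.
apply: etrans E _; ring.
Qed.

Lemma codazzi_31 z : U z ->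
  - D2 coef_k1 z = coef_be z * coef_b1 z - conn1 z * coef_k2 z - coef_al z * coef_b2 z
    + conn1 z * coef_k1 z.
Proof.
move=> Uz; have [S1 S2 S3 S4] := connection_along_e1 Uz.
have [T1 T2 T3 T4] := connection_along_e2 Uz.
have V : [/\ ip (e1 z) (e1 z) = 1, ip (e1 z) (e2 z) = 0, ip (e3 z) (e1 z) = 0
    & ip (e3 z) (e2 z) = 0].
  split; [exact: e11 | exact: e12 | rewrite ipC; exact: e13 | rewrite ipC; exact: e23].
have X0 y : U y -> ip (D2 e1 y) (e3 y) = (fun _ => 0) y.
  by move=> Uy; have [[_ _ ? _] _ _ _] := connection_along_e2 Uy.
have E := structure_equation_values N1 N3 Uz (Y := coef_k1)
  X0 (fun y _ => erefl) S1 T1 S3 T3 V.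
rewrite dalong_cst sub0r in E; apply: etrans E _; ring.
Qed.

Lemma codazzi_32 z : U z ->
  D1 coef_k2 z = - conn2 z * coef_k1 z - coef_al z * coef_b1 z - coef_be z * coef_b2 z
    + conn2 z * coef_k2 z.
Proof.
move=> Uz; have [S1 S2 S3 S4] := connection_along_e1 Uz.
have [T1 T2 T3 T4] := connection_along_e2 Uz.
have V : [/\ ip (e2 z) (e1 z) = 0, ip (e2 z) (e2 z) = 1, ip (e3 z) (e1 z) = 0
    & ip (e3 z) (e2 z) = 0].
  split; [rewrite ipC; exact: e12 | exact: e22 | rewrite ipC; exact: e13 | rewrite ipC; exact: e23].
have E := structure_equation_values N2 N3 Uz (X := coef_k2) (Y := fun _ => 0)
  (fun y _ => erefl) A3_offdiagonal S2 T2 S3 T3 V.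
rewrite dalong_cst subr0 in E; apply: etrans E _; ring.
Qed.

Lemma ricci_equation z : U z ->
  D1 coef_b2 z - D2 coef_b1 z = (coef_k2 z - coef_k1 z) * coef_be z
    + conn1 z * coef_b1 z + conn2 z * coef_b2 z.
Proof.
move=> Uz; have [S1 S2 S3 S4] := connection_along_e1 Uz.
have [T1 T2 T3 T4] := connection_along_e2 Uz.
have V : [/\ ip (e3 z) (e1 z) = 0, ip (e3 z) (e2 z) = 0, ip (e4 z) (e1 z) = 0
    & ip (e4 z) (e2 z) = 0].
  by split; rewrite ipC; [exact: e13 | exact: e23 | exact: e14 | exact: e24].
have E := structure_equation_values N3 N4 Uz (X := coef_b2) (Y := coef_b1)
  (fun y _ => erefl) (fun y _ => erefl) S3 T3 S4 T4 V.
apply: etrans E _; ring.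
Qed.

Lemma codazzi_41 z : U z -> (forall z, U z -> coef_be z = 0) ->
  D2 coef_al z = - 2 * coef_al z * conn1 z - coef_k1 z * coef_b2 z.
Proof.
move=> Uz be0; have [S1 S2 S3 S4] := connection_along_e1 Uz.
have [T1 T2 T3 T4] := connection_along_e2 Uz.
have V : [/\ ip (e1 z) (e1 z) = 1, ip (e1 z) (e2 z) = 0, ip (e4 z) (e1 z) = 0
    & ip (e4 z) (e2 z) = 0].
  split; [exact: e11 | exact: e12 | rewrite ipC; exact: e14 | rewrite ipC; exact: e24].
have X0 y : U y -> ip (D2 e1 y) (e4 y) = (fun _ => 0) y.
  by move=> Uy; have [[_ _ _ ->] _ _ _] := connection_along_e2 Uy; exact: be0.
have E := structure_equation_values N1 N4 Uz (Y := coef_al)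
  X0 (fun y _ => erefl) S1 T1 S4 T4 V.
rewrite dalong_cst sub0r (be0 z Uz) in E.
apply: oppr_inj; apply: etrans E _; ring.
Qed.

Lemma codazzi_42 z : U z -> (forall z, U z -> coef_be z = 0) ->
  D1 coef_al z = 2 * coef_al z * conn2 z + coef_k2 z * coef_b1 z.
Proof.
move=> Uz be0; have [S1 S2 S3 S4] := connection_along_e1 Uz.
have [T1 T2 T3 T4] := connection_along_e2 Uz.
have V : [/\ ip (e2 z) (e1 z) = 0, ip (e2 z) (e2 z) = 1, ip (e4 z) (e1 z) = 0
    & ip (e4 z) (e2 z) = 0].
  split; [rewrite ipC; exact: e12 | exact: e22 | rewrite ipC; exact: e14 | rewrite ipC; exact: e24].
have sal : smooth_on U coef_al by exact: smooth_on_ip (smooth_on_dalong_rV oU sxi1 se1) se4.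
have E := structure_equation_values N2 N4 Uz (X := fun y => - coef_al y) (Y := fun _ => 0)
  A4_trace be0 S2 T2 S4 T4 V.
rewrite dalong_cst subr0 (be0 z Uz) (dalongN xi1 sal Uz) in E.
apply: oppr_inj; apply: etrans E _; ring.
Qed.
End MovingFrame.

(** * Algebra of the structure equations when the curvature is eps *)

Section ConstantCurvatureAlgebra.
Context {R : realFieldType}.
Implicit Types f k al : R.

(** The system is linear in [a2], [b1], [Dk], [Dal].  After elimination the coefficient
of [a2] is [(2 f - 2 k) ^ 2 + 4 al ^ 2], which is [4 f ^ 2] by the Gauss equation. *)
Lemma codazzi_e1_solved f k al a2 b1 f1 Dk Dal : f != 0 ->
  k * (2 * f - k) = al ^+ 2 ->
  Dk * (2 * f - k) + k * (2 * f1 - Dk) = 2 * al * Dal ->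
  Dk = - a2 * (2 * f - k) - al * b1 + a2 * k ->
  Dal = 2 * al * a2 + k * b1 ->
  f1 * (2 * f - k + f) = - (f * b1 * al) ->
  2 * f * a2 = 3 * f1 /\ f * Dk = 2 * f1 * k.
Proof.
move=> f0 gauss dgauss c32 c42 bic.
have E1 : 2 * f * a2 = 3 * f1.
  apply: (mulfI f0); rewrite c42 c32 in dgauss.
  have bic' : f * (al * b1) = - (f1 * (2 * f - k + f)) by rewrite bic; ring.
  suff : 2 * (f * (2 * f * a2)) = 2 * (f * (3 * f1)) by lra.
  have -> : 2 * (f * (2 * f * a2)) = a2 * ((2 * f - k - k) ^+ 2 + 4 * (k * (2 * f - k))) by ring.
  rewrite gauss.
  have -> : 2 * (f * (3 * f1)) = 2 * k * f1 - 2 * (- (f1 * (2 * f - k + f))) by ring.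
  rewrite -bic'; move: dgauss; lra.
split=> //.
have -> : f * Dk = (2 * f * a2) * (k - f) - f * b1 * al by rewrite c32; ring.
rewrite E1; move: bic; lra.
Qed.

(** The elimination of [codazzi_e1_solved], along the other direction. *)
Lemma codazzi_e2_solved f k al a1 b2 f2 Dk Dal : f != 0 ->
  k * (2 * f - k) = al ^+ 2 ->
  Dk * (2 * f - k) + k * (2 * f2 - Dk) = 2 * al * Dal ->
  - (2 * f2 - Dk) = - a1 * k - al * b2 + a1 * (2 * f - k) ->
  Dal = - 2 * al * a1 - (2 * f - k) * b2 ->
  f2 * (k + f) = f * b2 * al ->
  2 * f * a1 = - 3 * f2 /\ f * Dk = 2 * f2 * (k - f).
Proof.
move=> f0 gauss dgauss c31 c41 bic.
have DkE : Dk = 2 * f2 - a1 * k - al * b2 + a1 * (2 * f - k) by move: c31; lra.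
have E1 : 2 * f * a1 = - 3 * f2.
  apply: (mulfI f0); rewrite c41 DkE in dgauss.
  have bic' : f * (al * b2) = f2 * (k + f) by rewrite bic; ring.
  suff : 2 * (f * (2 * f * a1)) = 2 * (f * (- 3 * f2)) by lra.
  have -> : 2 * (f * (2 * f * a1)) = a1 * ((2 * f - k - k) ^+ 2 + 4 * (k * (2 * f - k))) by ring.
  rewrite gauss.
  have -> : 2 * (f * (- 3 * f2)) = - 2 * (2 * f - k) * f2 - 2 * (f2 * (k + f)) by ring.
  rewrite -bic'; move: dgauss; lra.
split=> //.
have -> : f * Dk = 2 * f * f2 + (2 * f * a1) * (f - k) - f * b2 * al by rewrite DkE; ring.
rewrite E1; move: bic; lra.
Qed.

(** The commutator applied to [f] shows that the mixed derivatives of [f] agree, and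
applied to [k] it determines their value, the mixed derivatives of [k] being
obtained from those of [f]. *)
Lemma mixed_derivative_of_f f k a1 a2 f1 f2 D1k D2k D12f D21f D12k D21k : f != 0 ->
  2 * f * a2 = 3 * f1 -> 2 * f * a1 = - 3 * f2 ->
  f * D1k = 2 * f1 * k -> f * D2k = 2 * f2 * (k - f) ->
  D12f - D21f = a1 * f1 + a2 * f2 ->
  D12k - D21k = a1 * D1k + a2 * D2k ->
  f2 * D1k + f * D21k = 2 * (D21f * k + f1 * D2k) ->
  f1 * D2k + f * D12k = 2 * (D12f * (k - f) + f2 * (D1k - f1)) ->
  D12f = D21f /\ 2 * f * D12f = 7 * f1 * f2.
Proof.
move=> f0 ha2 ha1 hD1 hD2 cf ck d21 d12.
have two0 : 2 * f != 0 by rewrite mulf_neq0 ?pnatr_eq0.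
have a2E : a2 = 3 * f1 / (2 * f) by rewrite -ha2; field.
have a1E : a1 = - 3 * f2 / (2 * f) by rewrite -ha1; field.
have D1E : D1k = 2 * f1 * k / f by rewrite -hD1; field.
have D2E : D2k = 2 * f2 * (k - f) / f by rewrite -hD2; field.
have e : D12f = D21f.
  by apply/eqP; rewrite -subr_eq0 cf a1E a2E; apply/eqP; field.
split=> //.
have D21E : D21k = (2 * (D21f * k + f1 * D2k) - f2 * D1k) / f by rewrite -d21; field.
have D12E : D12k = (2 * (D12f * (k - f) + f2 * (D1k - f1)) - f1 * D2k) / f by rewrite -d12; field.
move: ck; rewrite D12E D21E D1E D2E a1E a2E -e => ck.
apply/eqP; rewrite -subr_eq0 -[_ == _]orFb -(negbTE f0) -mulf_eq0; apply/eqP.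
apply: (mulfI f0); rewrite mulr0.
have := congr1 (fun x => - (f ^+ 3) * x) ck => /eqP; rewrite -subr_eq0 => /eqP ck'.
rewrite -ck'; field.
by [].
Qed.

(** Everything in the Ricci equation is expressed through [f1], [f2], [k] and [al]; the
Gauss equation is solved for [f], after which the claim is an identity of rational
functions of [k] and [al]. *)
Lemma ricci_forces_product_zero f k al a1 a2 b1 b2 f1 f2 D1k D2k D1al D2al m D1b2 D2b1 :
  f != 0 -> k != 0 -> al != 0 -> k * (2 * f - k) = al ^+ 2 ->
  2 * f * a2 = 3 * f1 -> 2 * f * a1 = - 3 * f2 ->
  f * D1k = 2 * f1 * k -> f * D2k = 2 * f2 * (k - f) ->
  D1al = 2 * al * a2 + k * b1 -> D2al = - 2 * al * a1 - (2 * f - k) * b2 ->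
  f1 * (2 * f - k + f) = - (f * b1 * al) -> f2 * (k + f) = f * b2 * al ->
  2 * f * m = 7 * f1 * f2 ->
  m * (3 * f - k) + f1 * (3 * f2 - D2k) = - ((f2 * al + f * D2al) * b1 + f * al * D2b1) ->
  m * (k + f) + f2 * (D1k + f1) = (f1 * al + f * D1al) * b2 + f * al * D1b2 ->
  D1b2 - D2b1 = a1 * b1 + a2 * b2 ->
  f1 * f2 = 0.
Proof.
move=> f0 k0 al0 gauss ha2 ha1 hD1 hD2 hD1al hD2al bic1 bic2 hm d2 d1 ric.
have fE : f = (al ^+ 2 + k ^+ 2) / (2 * k) by rewrite -gauss; field.
have s0 : al ^+ 2 + k ^+ 2 != 0.
  by rewrite gt_eqF // ltr_pwDl ?sqr_ge0 // exprn_even_gt0.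
have a2E : a2 = 3 * f1 / (2 * f) by rewrite -ha2; field.
have a1E : a1 = - 3 * f2 / (2 * f) by rewrite -ha1; field.
have D1E : D1k = 2 * f1 * k / f by rewrite -hD1; field.
have D2E : D2k = 2 * f2 * (k - f) / f by rewrite -hD2; field.
have b1E : b1 = - (f1 * (3 * f - k)) / (f * al).
  have -> : f1 * (3 * f - k) = - (f * b1 * al) by rewrite -bic1; ring.
  by field; rewrite f0 al0.
have b2E : b2 = f2 * (k + f) / (f * al) by rewrite bic2; field; rewrite f0 al0.
have mE : m = 7 * f1 * f2 / (2 * f) by rewrite -hm; field.
have D2b1E : D2b1 = - (m * (3 * f - k) + f1 * (3 * f2 - D2k) + (f2 * al + f * D2al) * b1) / (f * al).
  by rewrite d2; field; rewrite f0 al0.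
have D1b2E : D1b2 = (m * (k + f) + f2 * (D1k + f1) - (f1 * al + f * D1al) * b2) / (f * al).
  by rewrite d1; field; rewrite f0 al0.
have key : D1b2 - D2b1 - (a1 * b1 + a2 * b2) = 6 * f1 * f2 * f / al ^+ 3.
  rewrite D1b2E D2b1E hD1al hD2al mE b1E b2E D1E D2E a1E a2E fE.
  by field; rewrite al0 k0 s0.
move: key; rewrite ric subrr => /esym/eqP.
rewrite mulf_eq0 invr_eq0 expf_eq0 (negPf al0) andbF orbF.
by rewrite mulf_eq0 (negPf f0) orbF -mulrA mulf_eq0 pnatr_eq0 /= => /eqP.
Qed.
End ConstantCurvatureAlgebra.

(** * The functions of a frame of curvature eps *)

(** The scalar functions of an adapted frame and the equations that they satisfy
when the curvature is eps; [k1] is replaced by [2 f - k] throughout. *)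
Record constant_curvature_frame (R : realType) (eps : R) (U : set 'rV[R]_2)
    (xi1 xi2 : 'rV[R]_2 -> 'rV[R]_2) (f k al a1 a2 b1 b2 : 'rV[R]_2 -> R) : Prop := {
  ccf_open : open U;
  ccf_xi : smooth_on U xi1 /\ smooth_on U xi2;
  ccf_smooth : [/\ smooth_on U f, smooth_on U k & smooth_on U al];
  ccf_smooth_conn : [/\ smooth_on U a1, smooth_on U a2, smooth_on U b1 & smooth_on U b2];
  ccf_commutator : forall F : 'rV[R]_2 -> R, smooth_on U F -> forall z, U z ->
    dalong xi1 (dalong xi2 F) z - dalong xi2 (dalong xi1 F) z
    = a1 z * dalong xi1 F z + a2 z * dalong xi2 F z;
  ccf_pos : forall z, U z -> [/\ 0 < f z, 0 < al z & 0 < dalong xi1 f z];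
  ccf_gauss : forall z, U z -> k z * (2 * f z - k z) = al z ^+ 2;
  ccf_gauss_intrinsic : forall z, U z ->
    dalong xi1 a2 z - dalong xi2 a1 z = eps + a1 z ^+ 2 + a2 z ^+ 2;
  ccf_codazzi31 : forall z, U z -> - dalong xi2 (fun z => 2 * f z - k z) z =
    - a1 z * k z - al z * b2 z + a1 z * (2 * f z - k z);
  ccf_codazzi32 : forall z, U z -> dalong xi1 k z =
    - a2 z * (2 * f z - k z) - al z * b1 z + a2 z * k z;
  ccf_codazzi41 : forall z, U z -> dalong xi2 al z =
    - 2 * al z * a1 z - (2 * f z - k z) * b2 z;
  ccf_codazzi42 : forall z, U z -> dalong xi1 al z = 2 * al z * a2 z + k z * b1 z;
  ccf_ricci : forall z, U z ->
    dalong xi1 b2 z - dalong xi2 b1 z = a1 z * b1 z + a2 z * b2 z;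
  ccf_biconservative : forall z, U z ->
    dalong xi1 f z * (2 * f z - k z + f z) = - (f z * b1 z * al z) /\
    dalong xi2 f z * (k z + f z) = f z * b2 z * al z
}.

Section ConstantCurvatureAnalysis.
Context {R : realType} (eps : R).
Local Notation plane := 'rV[R]_2.
Context (U : set plane) (xi1 xi2 : plane -> plane) (f k al a1 a2 b1 b2 : plane -> R).
Hypothesis ccf : constant_curvature_frame eps U xi1 xi2 f k al a1 a2 b1 b2.
Notation D1 := (dalong xi1).
Notation D2 := (dalong xi2).

Let oU : open U := ccf_open ccf.
Let sxi1 : smooth_on U xi1 := (ccf_xi ccf).1.
Let sxi2 : smooth_on U xi2 := (ccf_xi ccf).2.
Let sf : smooth_on U f. Proof. by have [] := ccf_smooth ccf. Qed.
Let sk : smooth_on U k. Proof. by have [] := ccf_smooth ccf. Qed.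
Let sal : smooth_on U al. Proof. by have [] := ccf_smooth ccf. Qed.
Let sa2 : smooth_on U a2. Proof. by have [] := ccf_smooth_conn ccf. Qed.
Let sb1 : smooth_on U b1. Proof. by have [] := ccf_smooth_conn ccf. Qed.
Let sb2 : smooth_on U b2. Proof. by have [] := ccf_smooth_conn ccf. Qed.
Let commutator := ccf_commutator ccf.
Let f0 z : U z -> 0 < f z. Proof. by move=> /(ccf_pos ccf)[]. Qed.
Let al0 z : U z -> 0 < al z. Proof. by move=> /(ccf_pos ccf)[]. Qed.
Let D1f0 z : U z -> 0 < D1 f z. Proof. by move=> /(ccf_pos ccf)[]. Qed.
Let gauss_flat := ccf_gauss ccf.
Let gauss_intrinsic := ccf_gauss_intrinsic ccf.
Let codazzi31 := ccf_codazzi31 ccf.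
Let codazzi32 := ccf_codazzi32 ccf.
Let codazzi41 := ccf_codazzi41 ccf.
Let codazzi42 := ccf_codazzi42 ccf.
Let ricci := ccf_ricci ccf.
Let bic1 z (Uz : U z) := (ccf_biconservative ccf Uz).1.
Let bic2 z (Uz : U z) := (ccf_biconservative ccf Uz).2.

Let f_neq0 z : U z -> f z != 0. Proof. by move=> /f0/lt0r_neq0. Qed.
Let al_neq0 z : U z -> al z != 0. Proof. by move=> /al0/lt0r_neq0. Qed.
Let sD1f := smooth_on_dalong oU sxi1 sf.
Let sD2f := smooth_on_dalong oU sxi2 sf.
Let sD1k := smooth_on_dalong oU sxi1 sk.
Let sD2k := smooth_on_dalong oU sxi2 sk.
Let s2f := smooth_onZ oU 2 sf.
Let sk1 := smooth_onB oU s2f sk.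

Let D_k1 xi z : U z -> dalong xi (fun z => 2 * f z - k z) z = 2 * dalong xi f z - dalong xi k z.
Proof. by move=> Uz; rewrite (dalongB oU xi s2f sk Uz) (dalongZ xi 2 sf Uz). Qed.

Let D_gauss xi z : U z ->
  dalong xi k z * (2 * f z - k z) + k z * (2 * dalong xi f z - dalong xi k z)
  = 2 * al z * dalong xi al z.
Proof.
move=> Uz; have := dalong_ext oU xi (F := fun z => k z * (2 * f z - k z))
  (G := fun z => al z * al z) _ Uz.
rewrite (dalongM xi sk sk1 Uz) (dalongM xi sal sal Uz) D_k1 // => -> ; first by ring.
by move=> y Uy; rewrite gauss_flat // expr2.
Qed.

(** First-order equations along [E1], which lead to the equation of [f] and to the
constancy of [k / f ^ 2]. *)
Lemma a2_and_D1k z : U z -> 2 * f z * a2 z = 3 * D1 f z /\ f z * D1 k z = 2 * D1 f z * k z.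
Proof.
move=> Uz; exact: codazzi_e1_solved (f_neq0 Uz) (gauss_flat Uz) (D_gauss xi1 Uz)
  (codazzi32 Uz) (codazzi42 Uz) (bic1 Uz).
Qed.

Lemma a1_and_D2k z : U z ->
  2 * f z * a1 z = - 3 * D2 f z /\ f z * D2 k z = 2 * D2 f z * (k z - f z).
Proof.
move=> Uz; apply: (@codazzi_e2_solved _ _ _ _ _ _ _ _ _ (f_neq0 Uz) (gauss_flat Uz)
  (D_gauss xi2 Uz) _ (codazzi41 Uz) (bic2 Uz)).
by rewrite -D_k1 //; apply: codazzi31.
Qed.

(** Implicit differentiation, by which the solved equations [a2_and_D1k] and
[a1_and_D2k] yield second derivatives. *)
Lemma product_rule xi (F G H K : plane -> R) z dF dG dH dK :
  smooth_on U F -> smooth_on U G -> smooth_on U H -> smooth_on U K ->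
  (forall z, U z -> F z * G z = H z * K z) -> U z ->
  dalong xi F z = dF -> dalong xi G z = dG -> dalong xi H z = dH -> dalong xi K z = dK ->
  dF * G z + F z * dG = dH * K z + H z * dK.
Proof.
move=> sF sG sH sK E Uz <- <- <- <-.
by rewrite -(dalongM xi sF sG Uz) -(dalongM xi sH sK Uz); apply: (dalong_ext oU).
Qed.

Lemma D1f_D2f_eq0 z : U z -> D1 f z * D2 f z = 0.
Proof.
move=> Uz; have fn := f_neq0 Uz; have aln := al_neq0 Uz.
have [ha2 hD1] := a2_and_D1k Uz; have [ha1 hD2] := a1_and_D2k Uz.
have k_neq0 : k z != 0.
  apply/eqP => k0; have := gauss_flat Uz; rewrite k0 mul0r => /esym/eqP.
  by rewrite sqrf_eq0 (negPf aln).
have s2 : smooth_on U (fun _ : plane => 2 : R) by exact: smooth_on_cst.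
have skf := smooth_onB oU sk sf.
have P1 := product_rule sf sD1k (smooth_onZ oU 2 sD1f) sk (fun y Uy => (a2_and_D1k Uy).2) Uz
  erefl erefl (dalongZ xi2 2 sD1f Uz) erefl.
have P2 := product_rule sf sD2k (smooth_onZ oU 2 sD2f) skf (fun y Uy => (a1_and_D2k Uy).2) Uz
  erefl erefl (dalongZ xi1 2 sD2f Uz) (dalongB oU xi1 sk sf Uz).
have [mE hm] : D1 (D2 f) z = D2 (D1 f) z /\ 2 * f z * D1 (D2 f) z = 7 * D1 f z * D2 f z.
  apply: (mixed_derivative_of_f fn ha2 ha1 hD1 hD2 (commutator sf Uz) (commutator sk Uz)).
    by rewrite P1; ring.
  by rewrite P2; ring.
have sfb1 := smooth_onM oU sf sb1.
have d1 : D2 (fun z => 2 * f z - k z + f z) z = 2 * D2 f z - D2 k z + D2 f z.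
  by rewrite (dalongD xi2 sk1 sf Uz) D_k1.
have d2 : D2 (fun z => - (f z * b1 z)) z = - (D2 f z * b1 z + f z * D2 b1 z).
  by rewrite (dalongN xi2 sfb1 Uz) (dalongM xi2 sf sb1 Uz).
have Q1 := product_rule sD1f (smooth_onD oU sk1 sf) (smooth_onN oU sfb1) sal
  (fun y Uy => etrans (bic1 Uy) (esym (mulNr _ _))) Uz erefl d1 d2 erefl.
have Q2 := product_rule sD2f (smooth_onD oU sk sf) (smooth_onM oU sf sb2) sal bic2 Uz
  erefl (dalongD xi1 sk sf Uz) (dalongM xi1 sf sb2 Uz) erefl.
apply: (ricci_forces_product_zero fn k_neq0 aln (gauss_flat Uz) ha2 ha1 hD1 hD2
  (codazzi42 Uz) (codazzi41 Uz) (bic1 Uz) (bic2 Uz) hm _ _ (ricci Uz)).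
- rewrite mE; apply: etrans (etrans _ Q1) _; ring.
- apply: etrans (etrans _ Q2) _; ring.
Qed.

Lemma D2f_eq0 z : U z -> D2 f z = 0.
Proof.
by move=> Uz; have /eqP := D1f_D2f_eq0 Uz; rewrite mulf_eq0 gt_eqF ?D1f0 //= => /eqP.
Qed.

Lemma a1_eq0 z : U z -> a1 z = 0.
Proof.
move=> Uz; have [+ _] := a1_and_D2k Uz; rewrite D2f_eq0 // mulr0 => /eqP.
by rewrite !mulf_eq0 pnatr_eq0 (negPf (f_neq0 Uz)) /= => /eqP.
Qed.

Lemma b2_eq0 z : U z -> b2 z = 0.
Proof.
move=> Uz; have := bic2 Uz; rewrite D2f_eq0 // mul0r => /esym/eqP.
by rewrite !mulf_eq0 (negPf (f_neq0 Uz)) (negPf (al_neq0 Uz)) orbF /= => /eqP.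
Qed.

Lemma D2k_eq0 z : U z -> D2 k z = 0.
Proof.
move=> Uz; have [_ +] := a1_and_D2k Uz; rewrite D2f_eq0 // mulr0 mul0r => /eqP.
by rewrite mulf_eq0 (negPf (f_neq0 Uz)) /= => /eqP.
Qed.

Lemma D2D1f_eq0 z : U z -> D2 (D1 f) z = 0.
Proof.
move=> Uz; have := commutator sf Uz; rewrite a1_eq0 // D2f_eq0 // mul0r mulr0 addr0.
rewrite (dalong_ext oU xi1 (G := fun _ => 0) D2f_eq0 Uz) dalong_cst sub0r.
by move=> /eqP; rewrite oppr_eq0 => /eqP.
Qed.

(** The intrinsic Gauss equation [E1(a2) = eps + a2 ^ 2], with [a2 = 3 E1(f) / (2 f)]. *)
Lemma mean_curvature_ode z : U z ->
  D1 (D1 f) z * f z - 5 / 2 * D1 f z ^+ 2 - 2 / 3 * eps * f z ^+ 2 = 0.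
Proof.
move=> Uz; have fn := f_neq0 Uz.
have := gauss_intrinsic Uz; rewrite (dalong_ext oU xi2 (G := fun _ => 0) a1_eq0 Uz).
rewrite dalong_cst subr0 a1_eq0 // expr0n /= addr0 => G.
have [ha2 _] := a2_and_D1k Uz.
have P := product_rule s2f sa2 (smooth_on_cst (3 : R)) sD1f
  (fun y Uy => (a2_and_D1k Uy).1) Uz (dalongZ xi1 2 sf Uz) G (dalong_cst xi1 _ z) erefl.
rewrite mul0r add0r in P.
have a2E : a2 z = 3 * D1 f z / (2 * f z) by rewrite -ha2; field.
have PE : 3 * D1 (D1 f) z = 2 * D1 f z * a2 z + 2 * f z * (eps + a2 z ^+ 2) by rewrite -P /cst.
have -> : D1 (D1 f) z = (2 * D1 f z * a2 z + 2 * f z * (eps + a2 z ^+ 2)) / 3 by rewrite -PE; field.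
by rewrite a2E; field.
Qed.

(** The constant [c] of the theorem. *)
Definition k_ratio z := k z / f z ^+ 2.

(** The first integral of the equation of [f], obtained with the integrating factor
[E1(f) / f ^ 6]. *)
Definition first_integral z := (D1 f z ^+ 2 + 4 / 9 * eps * f z ^+ 2) / f z ^+ 5.

(** A function with logarithmic derivative [n] times that of [f] is a multiple of
[f ^ n]. *)
Lemma quotient_constant xi (F : plane -> R) n z : smooth_on U F -> U z ->
  f z * dalong xi F z = n%:R * dalong xi f z * F z ->
  dalong xi (fun z => F z / f z ^+ n) z = 0.
Proof.
move=> sF Uz H; have fn := f_neq0 Uz.
have fx y : U y -> f y ^+ n != 0 by move=> Uy; rewrite expf_neq0 // f_neq0.
have sfn := smooth_onX oU n sf.
have DX : f z * dalong xi (fun z => f z ^+ n) z = n%:R * dalong xi f z * f z ^+ n.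
  elim: n {H fx sfn} => [|n IH].
    by rewrite (dalong_ext oU xi (F := fun z => f z ^+ 0) (G := fun _ => 1 : R) (fun y _ => expr0 (f y)) Uz) dalong_cst mulr0 !mul0r.
  rewrite (dalong_ext oU xi (G := fun y => f y * f y ^+ n) (fun y _ => exprS (f y) n) Uz).
  rewrite (dalongM xi sf (smooth_onX oU n sf) Uz) mulrDr (mulrCA (f z) (f z)) IH exprS -natr1.
  by ring.
have P := product_rule (smooth_on_div oU sF sfn fx) sfn sF (smooth_on_cst (1 : R))
  (fun y Uy => etrans (divfK (fx y Uy) (F y)) (esym (mulr1 _))) Uz erefl erefl erefl
  (dalong_cst xi _ z).
move: P DX H; rewrite mulr0 addr0 mulr1.
move: (dalong xi (fun z => F z / f z ^+ n) z) (dalong xi (fun z => f z ^+ n) z) => dq d.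
move: (dalong xi F z) (dalong xi f z) => dF df P DX H.
apply: (mulIf (fx z Uz)); apply: (mulfI fn); rewrite mul0r mulr0.
have -> : f z * (dq * f z ^+ n) = f z * dF - F z / f z ^+ n * (f z * d) by rewrite -P; ring.
by rewrite H DX; field; apply: fx.
Qed.

Lemma k_ratio_constant z : U z -> D1 k_ratio z = 0 /\ D2 k_ratio z = 0.
Proof.
move=> Uz; split; apply: quotient_constant => //.
  by have [_] := a2_and_D1k Uz.
by rewrite D2k_eq0 // D2f_eq0 // !(mulr0, mul0r).
Qed.

Lemma first_integral_constant z : U z ->
  D1 first_integral z = 0 /\ D2 first_integral z = 0.
Proof.
move=> Uz; have fn := f_neq0 Uz.
have sv2 := smooth_onM oU sD1f sD1f; have sf2 := smooth_onM oU sf sf.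
have sN := smooth_onD oU sv2 (smooth_onZ oU (4 / 9 * eps) sf2).
have DN xi : dalong xi (fun z => D1 f z ^+ 2 + 4 / 9 * eps * f z ^+ 2) z
   = 2 * D1 f z * dalong xi (D1 f) z + 4 / 9 * eps * (2 * f z * dalong xi f z).
  have E y : U y -> D1 f y ^+ 2 + 4 / 9 * eps * f y ^+ 2 = D1 f y * D1 f y + 4 / 9 * eps * (f y * f y).
    by move=> _; rewrite !expr2.
  rewrite (dalong_ext oU xi E Uz).
  rewrite (dalongD xi sv2 (smooth_onZ oU (4 / 9 * eps) sf2) Uz) (dalongZ xi _ sf2 Uz).
  by rewrite (dalongM xi sD1f sD1f Uz) (dalongM xi sf sf Uz); ring.
have sN' : smooth_on U (fun z => D1 f z ^+ 2 + 4 / 9 * eps * f z ^+ 2).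
  by apply: (smooth_on_ext oU _ sN) => y _; rewrite !expr2.
split; apply: quotient_constant => //; rewrite DN.
  have ode := mean_curvature_ode Uz.
  have vE : D1 (D1 f) z = (5 / 2 * D1 f z ^+ 2 + 2 / 3 * eps * f z ^+ 2) / f z.
    apply: (mulIf fn); rewrite divfK //; move: ode => /eqP.
    by rewrite -addrA -opprD subr_eq0 => /eqP.
  by rewrite vE; field.
by rewrite D2D1f_eq0 // D2f_eq0 //; ring.
Qed.
End ConstantCurvatureAnalysis.

(** * Adapted coordinates in the plane *)

Section CoordinateArithmetic.
Context {R : realFieldType}.

(** The left-hand side is the square norm of [D_E2 E2] in R^5; the factor of [f ^ 3]
on the right is the constant [kap]. *)
Lemma curvature_radius_identity (f f1 k al a2 eps : R) : f != 0 ->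
  2 * f * a2 = 3 * f1 -> k * (2 * f - k) = al ^+ 2 ->
  eps + a2 ^+ 2 + k ^+ 2 + al ^+ 2
  = (9 / 4 * ((f1 ^+ 2 + 4 / 9 * eps * f ^+ 2) / f ^+ 5) + 2 * (k / f ^+ 2)) * f ^+ 3.
Proof.
move=> fn ha <-.
have -> : a2 = 3 * f1 / (2 * f) by rewrite -ha; field.
by field.
Qed.

Lemma oscillator_derivative (Y r q y rho : R) : r != 0 ->
  rho * r + Y * 0 = - (q * r ^+ 2) * y -> rho = - q * r * y.
Proof. by move=> rn E; apply: (mulIf rn); rewrite -[LHS]addr0 -[X in _ + X](mulr0 Y) E; ring. Qed.
End CoordinateArithmetic.

Section FlatCoordinates.
Context {R : realType} (eps : R).
Local Notation plane := 'rV[R]_2.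
Context (U : set plane) (xi1 xi2 : plane -> plane) (f k al a1 a2 b1 b2 : plane -> R).
Hypothesis ccf : constant_curvature_frame eps U xi1 xi2 f k al a1 a2 b1 b2.
Hypothesis xi_basis : forall z h, U z -> exists a b, h = a *: xi1 z + b *: xi2 z.
Notation D1 := (dalong xi1).
Notation D2 := (dalong xi2).
Context (y : plane -> R) (z0 : plane).
Hypothesis sy : smooth_on U y.
Hypothesis D1y : forall z, U z -> D1 y z = 0.
Hypothesis D2D2y : forall z, U z ->
  D2 (D2 y) z = - (eps + a2 z ^+ 2 + k z ^+ 2 + al z ^+ 2) * y z.
Hypothesis (Uz0 : U z0) (y_pos : 0 < D2 y z0).

Let oU : open U := ccf_open ccf.
Let sxi1 : smooth_on U xi1 := (ccf_xi ccf).1.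
Let sxi2 : smooth_on U xi2 := (ccf_xi ccf).2.
Let sf : smooth_on U f. Proof. by have [] := ccf_smooth ccf. Qed.
Let sk : smooth_on U k. Proof. by have [] := ccf_smooth ccf. Qed.
Let f0 z : U z -> 0 < f z. Proof. by move=> /(ccf_pos ccf)[]. Qed.
Let D1f0 z : U z -> 0 < D1 f z. Proof. by move=> /(ccf_pos ccf)[]. Qed.
Let f_neq0 z : U z -> f z != 0. Proof. by move=> /f0/lt0r_neq0. Qed.
Let sD1f := smooth_on_dalong oU sxi1 sf.
Let sD2y := smooth_on_dalong oU sxi2 sy.

(** [r] is the density that makes [r ^ (-1) E2] commute with [E1]. *)
Let r z := f z `^ (3 / 2).
Let r0 z : U z -> 0 < r z. Proof. by move=> /f0; apply: powR_gt0. Qed.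
Let r_neq0 z : U z -> r z != 0. Proof. by move=> /r0/lt0r_neq0. Qed.
Let sr : smooth_on U r. Proof. exact: (smooth_on_powR oU (3 / 2) sf f0). Qed.

Let r_sqr z : U z -> r z ^+ 2 = f z ^+ 3.
Proof.
move=> Uz; have f_ge0 := ltW (f0 Uz).
rewrite -(powR_mulrn 3 f_ge0) -(powR_mulrn 2 (ltW (r0 Uz))) /r -powRrM.
by congr (_ `^ _); field.
Qed.

Let Dr xi z : U z -> f z * dalong xi r z = 3 / 2 * dalong xi f z * r z.
Proof.
move=> Uz; have df := smooth_on_differentiable sf Uz.
have dr := @derive_val _ _ _ _ _ _ _ (is_derive_powR_comp (3 / 2) (xi z) df (f0 Uz)).
have rE : r z = f z `^ (3 / 2 - 1) * f z.
  by rewrite -[X in _ * X](powRr1 (ltW (f0 Uz))) -powRD ?subrK // f_neq0 ?implybT.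
rewrite !dalongE rE; move: dr => /= ->; ring.
Qed.

Let D1r z : U z -> D1 r z = a2 z * r z.
Proof.
move=> Uz; have [ha2 _] := a2_and_D1k ccf Uz; apply: (mulfI (f_neq0 Uz)).
by rewrite Dr // [RHS]mulrA; congr (_ * _); move: ha2 => ha2; lra.
Qed.

Let D2r z : U z -> D2 r z = 0.
Proof.
move=> Uz; apply: (mulfI (f_neq0 Uz)).
by rewrite Dr // (D2f_eq0 ccf) // !(mulr0, mul0r).
Qed.

Let D1D2y z : U z -> D1 (D2 y) z = a2 z * D2 y z.
Proof.
move=> Uz; have := ccf_commutator ccf sy Uz.
by rewrite (dalong_ext oU xi2 D1y Uz) dalong_cst subr0 D1y // mulr0 add0r.
Qed.

(** Along [E2], measured by the parameter [t] with [E2 t = r], [y] satisfies the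
oscillator equation [y'' = - kap y]; [Y] is its velocity. *)
Let Y z := D2 y z / r z.
Let sY : smooth_on U Y. Proof. exact: (smooth_on_div oU sD2y sr r_neq0). Qed.
Let s1 : smooth_on U (fun _ => 1 : R). Proof. exact: smooth_on_cst. Qed.
Let Yr z : U z -> Y z * r z = D2 y z * 1.
Proof. by move=> Uz; rewrite divfK ?r_neq0 // mulr1. Qed.

Let D1Y z : U z -> D1 Y z = 0.
Proof.
move=> Uz; have P := product_rule ccf sY sr sD2y s1 Yr Uz erefl (D1r Uz) (D1D2y Uz) (dalong_cst xi1 _ z).
apply: (mulIf (r_neq0 Uz)); rewrite mul0r; move: P.
rewrite mulr0 addr0 mulr1 => P.
have := Yr Uz; rewrite mulr1 => E; rewrite -E in P.
by apply: (addIr (Y z * (a2 z * r z))); rewrite P; ring.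
Qed.

Let kap z := 9 / 4 * first_integral eps xi1 f z + 2 * k_ratio f k z.

Let D2Y z : U z -> D2 Y z = - kap z * r z * y z.
Proof.
move=> Uz; have P := product_rule ccf sY sr sD2y s1 Yr Uz erefl (D2r Uz) (D2D2y Uz) (dalong_cst xi2 _ z).
apply: (@oscillator_derivative _ (Y z)); first exact: r_neq0.
rewrite P mulr0 addr0 mulr1 r_sqr //; congr (- _ * _).
have [ha2 _] := a2_and_D1k ccf Uz.
exact: curvature_radius_identity (f_neq0 Uz) ha2 (ccf_gauss ccf Uz).
Qed.

Let sfn n : smooth_on U (fun z => f z ^+ n). Proof. exact: smooth_onX. Qed.
Let fn_neq0 n z : U z -> f z ^+ n != 0. Proof. by move=> Uz; rewrite expf_neq0 // f_neq0. Qed.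

Let sfirst : smooth_on U (first_integral eps xi1 f).
Proof.
apply: (smooth_on_div oU) => //; last by move=> z; exact: fn_neq0.
exact: (smooth_onD oU (smooth_onX oU 2 sD1f) (smooth_onZ oU _ (sfn 2))).
Qed.

Let sratio : smooth_on U (k_ratio f k).
Proof. by apply: (smooth_on_div oU sk (sfn 2)) => z; exact: fn_neq0. Qed.

Lemma constant_along_frame (F : plane -> R) rho : smooth_on U F ->
  (forall z, U z -> D1 F z = 0 /\ D2 F z = 0) -> ball z0 rho `<=` U ->
  forall z, ball z0 rho z -> F z = F z0.
Proof.
move=> sF DF BU; apply: constant_on_ball => z /BU Uz.
have dF := smooth_on_differentiable sF Uz; split=> // h.
have [a [b ->]] := xi_basis h Uz; have [] := DF z Uz; rewrite !dalongE => d1 d2.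
by rewrite derive_dirD // !derive_dirZ // d1 d2 !scaler0 addr0.
Qed.

Let skap : smooth_on U kap.
Proof. exact: (smooth_onD oU (smooth_onZ oU _ sfirst) (smooth_onZ oU _ sratio)). Qed.

Let Dkap z : U z -> D1 kap z = 0 /\ D2 kap z = 0.
Proof.
move=> Uz; have [c1 c2] := first_integral_constant ccf Uz; have [d1 d2] := k_ratio_constant ccf Uz.
have DE xi : dalong xi kap z
    = 9 / 4 * dalong xi (first_integral eps xi1 f) z + 2 * dalong xi (k_ratio f k) z.
  rewrite (dalongD xi (smooth_onZ oU _ sfirst) (smooth_onZ oU _ sratio) Uz).
  by rewrite (dalongZ xi _ sfirst Uz) (dalongZ xi _ sratio Uz).
by rewrite !DE c1 c2 d1 d2 !mulr0 addr0.
Qed.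

(** The energy of the oscillator. *)
Let energy z := Y z * Y z + kap z * (y z * y z).

Let senergy : smooth_on U energy.
Proof. exact: (smooth_onD oU (smooth_onM oU sY sY) (smooth_onM oU skap (smooth_onM oU sy sy))). Qed.

Let Denergy z : U z -> D1 energy z = 0 /\ D2 energy z = 0.
Proof.
move=> Uz; have [dk1 dk2] := Dkap Uz; have syy := smooth_onM oU sy sy.
have DE xi : dalong xi energy z = dalong xi Y z * Y z + Y z * dalong xi Y z +
   (dalong xi kap z * (y z * y z) + kap z * (dalong xi y z * y z + y z * dalong xi y z)).
  rewrite (dalongD xi (smooth_onM oU sY sY) (smooth_onM oU skap syy) Uz).
  by rewrite (dalongM xi sY sY Uz) (dalongM xi skap syy Uz) (dalongM xi sy sy Uz).
rewrite !DE dk1 dk2 D1Y // D2Y // D1y //; split; first by ring.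
have -> : D2 y z = Y z * r z by rewrite Yr // mulr1.
by ring.
Qed.

(** [Phi = (s, t)], with [s] a primitive of [df / E1(f)] and [t] a primitive of [dy / Y].
The fields [xi1] and [r ^ (-1) xi2] are dual to [ds] and [dt]. *)
Lemma flat_coordinates : exists (c : R) (B : set plane) (Phi Psi : plane -> plane) (f_ : R -> R),
  [/\ open B, B z0, B `<=` U, open (Phi @` B) & forall x, B x -> Psi (Phi x) = x] /\
  [/\ forall u, (Phi @` B) u -> {for u, continuous Psi}, smooth_on B Phi, smooth_on (Phi @` B) Psi &
      forall x, B x -> 'D_e_s Psi (Phi x) = xi1 x /\ 'D_e_t Psi (Phi x) = (r x)^-1 *: xi2 x] /\
  (forall x, B x -> k x = c * f x ^+ 2 /\
    let s := Phi x 0 ord0 in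
    [/\ f_ s = f x, derive1 f_ s = D1 f x & derive1n 2 f_ s = D1 (D1 f) x]).
Proof.
have Y0 : 0 < Y z0 by rewrite divr_gt0 ?r0.
have [rho rho0 Brho] : exists2 rho, 0 < rho & ball z0 rho `<=` [set z | U z /\ 0 < Y z].
  have cY : {for z0, continuous Y} by exact/differentiable_continuous/(smooth_on_differentiable sY).
  have /nbhs_ballP[rho /= rho0 H] : \forall z \near z0, U z /\ 0 < Y z.
    apply: filterI; first exact: open_nbhs_nbhs.
    exact: (cvgr_gt (Y z0) cY).
  by exists rho.
have BU : ball z0 rho `<=` U by move=> z /Brho[].
pose c := k_ratio f k z0; pose A := first_integral eps xi1 f z0.
pose kp := kap z0; pose m := energy z0.
have cE z : ball z0 rho z -> k z = c * f z ^+ 2.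
  move=> Bz; rewrite /c -(constant_along_frame sratio (k_ratio_constant ccf) BU Bz).
  by rewrite /k_ratio divfK // fn_neq0 //; exact: BU.
have AE z : ball z0 rho z -> D1 f z ^+ 2 = A * f z ^+ 5 - 4 / 9 * eps * f z ^+ 2.
  move=> Bz; rewrite /A -(constant_along_frame sfirst (first_integral_constant ccf) BU Bz).
  by rewrite /first_integral divfK ?addrK // fn_neq0 //; exact: BU.
have mE z : ball z0 rho z -> Y z ^+ 2 = m - kp * (y z * y z).
  move=> Bz; rewrite /m -(constant_along_frame senergy Denergy BU Bz).
  by rewrite /kp -(constant_along_frame skap Dkap BU Bz) /energy addrK expr2.
have oB0 : open (ball z0 rho) by exact: ball_open.
have B0z0 : ball z0 rho z0 by exact: ballxx.
have Q1c : continuous (fun x : R => A * x ^+ 5 - 4 / 9 * eps * x ^+ 2).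
  by move=> x; apply: cvgB; apply: cvgMr; exact: exprn_continuous.
have [B1 [G1 [f_ [[oB1 B1z0 B10 sG1] [DG1 f_E]]]]] := reciprocal_primitive oB0 B0z0
  (smooth_on_subset BU sf) (smooth_on_subset BU sD1f) (fun z Bz => D1f0 (BU z Bz)) AE Q1c.
have B1U z : B1 z -> U z by move=> /B10/BU.
have Q2c : continuous (fun x : R => m - kp * (x * x)).
  by move=> x; apply: cvgB; [exact: cvg_cst | apply: cvgMr; apply: cvgM].
have [B2 [G2 [y_ [[oB2 B2z0 B21 sG2] [DG2 _]]]]] := reciprocal_primitive oB1 B1z0
  (smooth_on_subset B1U sy) (smooth_on_subset B1U sY) (fun z Bz => (Brho z (B10 z Bz)).2)
  (fun z Bz => mE z (B10 z Bz)) Q2c.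
have B2U z : B2 z -> U z by move=> /B21/B1U.
pose Phi z : plane := pair_vec (G1 (f z)) (G2 (y z)).
have sPhi : smooth_on B2 Phi.
  apply: (smooth_on_rV oB2) => i; rewrite /Phi /pair_vec.
  have [->|i0] := eqVneq i ord0.
    by apply: (smooth_on_ext oB2 _ (smooth_on_subset B21 sG1)) => z _; rewrite mxE.
  by apply: (smooth_on_ext oB2 _ sG2) => z _; rewrite mxE (negPf i0).
pose eta (j : 'I_2) z : plane := if j == ord0 then xi1 z else (r z)^-1 *: xi2 z.
have eta0 : eta ord0 = xi1 by [].
have eta1 : eta ord_max = fun z => (r z)^-1 *: xi2 z by [].
have two (j : 'I_2) : j = ord0 \/ j = ord_max.
  by case: j => -[|[|//]] p; [left | right]; exact: val_inj.
have seta j : smooth_on B2 (eta j).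
  have [->|->] := two j; first by rewrite eta0; exact: smooth_on_subset B2U sxi1.
  rewrite eta1; apply: (smooth_on_rV oB2) => i.
  apply: (smooth_on_ext oB2 (F := fun z => (r z)^-1 * xi2 z 0 i)).
    by move=> z _; rewrite mxE.
  apply: (smooth_onM oB2); last exact/(smooth_on_coord oB2)/(smooth_on_subset B2U sxi2).
  by apply: (smooth_onV oB2 (smooth_on_subset B2U sr)) => z /B2U/r_neq0.
have Phi0 z : Phi z 0 ord0 = G1 (f z) by rewrite mxE.
have Phi1 z : Phi z 0 ord_max = G2 (y z) by rewrite mxE.
have D_eta1 (F : plane -> R) z : smooth_on U F -> U z -> 'D_(eta ord_max z) F z = (r z)^-1 * D2 F z.
  move=> sF Uz; rewrite eta1 derive_dirZ ?dalongE //.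
  exact: smooth_on_differentiable sF Uz.
have Deta z j : B2 z -> 'D_(eta j z) Phi z = delta_mx 0 j.
  move=> Bz; have Uz := B2U z Bz; have dPhi := smooth_on_differentiable sPhi Bz.
  apply/rowP => i; rewrite (derive_rV (eta j z) i dPhi) mxE eqxx /=.
  have [->|->] := two i.
    have -> : (fun z => Phi z 0 ord0) = G1 \o f by apply/funext => x; rewrite Phi0.
    rewrite (DG1 _ (eta j z) (B21 z Bz)); have [->|->] := two j.
      by rewrite eta0 -dalongE divff // gt_eqF // D1f0.
    by rewrite (D_eta1 f z sf Uz) (D2f_eq0 ccf Uz) mulr0 mul0r.
  have -> : (fun z => Phi z 0 ord_max) = G2 \o y by apply/funext => x; rewrite Phi1.
  rewrite (DG2 _ (eta j z) Bz); have [->|->] := two j.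
    by rewrite eta0 -dalongE D1y // mul0r.
  rewrite (D_eta1 y z sy Uz) [_ * D2 y z]mulrC divff //.
  by rewrite gt_eqF // (Brho z _).2 //; exact/B10/B21.
have [B [Psi [[oB Bz0 BB2 oPB PsiK] [cPsi sPsi DPsi]]]] := local_inverse oB2 B2z0 sPhi seta Deta.
have BU' z : B z -> U z by move=> /BB2/B2U.
exists c, B, Phi, Psi, f_; split; [by split=> // z /BU' | split].
- split=> //; first exact: smooth_on_subset BB2 sPhi.
  move=> x Bx; split; first by rewrite -eta0; exact: DPsi.
  by have := DPsi x ord_max Bx; rewrite eta1.
- have transfer (F : plane -> R) F_ x : smooth_on U F ->
      (forall x, B x -> F_ (Phi x 0 ord0) = F x) -> B x ->
      derive1 F_ (Phi x 0 ord0) = D1 F x.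
    move=> sF E Bx.
    have dPsi u : (Phi @` B) u -> differentiable Psi u by move=> /(smooth_on_differentiable sPsi).
    have dF u : (Phi @` B) u -> differentiable F (Psi u).
      by move=> [x' Bx' <-]; rewrite PsiK //; exact: smooth_on_differentiable sF (BU' _ Bx').
    have Bu : (Phi @` B) (Phi x) by exists x.
    have dFPsi u : (Phi @` B) u -> differentiable (F \o Psi) u.
      by move=> Bu'; apply: differentiable_comp; [exact: dPsi | exact: dF].
    have FE u : (Phi @` B) u -> (F \o Psi) u = F_ (u 0 ord0).
      by move=> [x' Bx' <-] /=; rewrite PsiK // E.
    rewrite (derive1_first_coordinate oPB dFPsi FE Bu).
    rewrite derive_chain; [|exact: dPsi|exact: dF].
    by rewrite dalongE PsiK // DPsi.
  have f_P x : B x -> f_ (Phi x 0 ord0) = f x by move=> Bx; rewrite Phi0 f_E //; exact/B21/BB2.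
  have f_P1 x : B x -> derive1 f_ (Phi x 0 ord0) = D1 f x by exact: transfer.
  move=> x Bx; split; first exact/cE/B10/B21/BB2.
  by split; [exact: f_P | exact: f_P1 | exact: transfer].
Qed.
End FlatCoordinates.

Section FrameCoordinates.
Context {R : realType} (eps : R).
Local Notation plane := 'rV[R]_2.
Local Notation vec := 'rV[R]_5.
Local Notation ip := (ambient_ip eps).
Context (U : set plane) (phi e1 e2 e3 e4 : plane -> vec) (xi1 xi2 : plane -> plane) (f : plane -> R).
Hypothesis mf : moving_frame eps U phi e1 e2 e3 e4 xi1 xi2.
Notation D1 := (dalong xi1).
Notation D2 := (dalong xi2).
Hypothesis A3_offdiagonal : forall z, U z -> ip (D1 e2 z) (e3 z) = 0.
Hypothesis A4_trace : forall z, U z -> ip (D2 e2 z) (e4 z) = - ip (D1 e1 z) (e4 z).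
Local Notation a1 := (conn1 eps e1 e2 xi1).
Local Notation a2 := (conn2 eps e1 e2 xi2).
Local Notation k := (coef_k2 eps e2 e3 xi2).
Local Notation al := (coef_al eps e1 e4 xi1).
Local Notation b1 := (coef_b1 eps e3 e4 xi1).
Local Notation b2 := (coef_b2 eps e3 e4 xi2).
Hypothesis be0 : forall z, U z -> coef_be eps e2 e4 xi1 z = 0.
Hypothesis ccf : constant_curvature_frame eps U xi1 xi2 f k al a1 a2 b1 b2.

Let oU : open U := mf_open mf.
Let sxi1 : smooth_on U xi1 := mf_xi1 mf.
Let sxi2 : smooth_on U xi2 := mf_xi2 mf.
Let sphi : smooth_on U phi := mf_phi mf.
Let N1 : tangent_to_N eps U phi e1. Proof. by have [] := mf_tangent mf. Qed.
Let N2 : tangent_to_N eps U phi e2. Proof. by have [] := mf_tangent mf. Qed.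
Let N3 : tangent_to_N eps U phi e3. Proof. by have [] := mf_tangent mf. Qed.
Let N4 : tangent_to_N eps U phi e4. Proof. by have [] := mf_tangent mf. Qed.
Let D1phi z : U z -> D1 phi z = e1 z. Proof. by move=> /(mf_dphi mf)[]. Qed.
Let D2phi z : U z -> D2 phi z = e2 z. Proof. by move=> /(mf_dphi mf)[]. Qed.
Let e11 z : U z -> ip (e1 z) (e1 z) = 1. Proof. by move=> /(mf_unit mf)[]. Qed.
Let e22 z : U z -> ip (e2 z) (e2 z) = 1. Proof. by move=> /(mf_unit mf)[]. Qed.
Let e12 z : U z -> ip (e1 z) (e2 z) = 0. Proof. by move=> /(mf_orth mf)[[]]. Qed.
Let e21 z : U z -> ip (e2 z) (e1 z) = 0. Proof. by move=> /e12; rewrite ipC. Qed.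
Let e32 z : U z -> ip (e3 z) (e2 z) = 0. Proof. by move=> /(mf_orth mf)[_ []]; rewrite ipC. Qed.
Let e42 z : U z -> ip (e4 z) (e2 z) = 0. Proof. by move=> /(mf_orth mf)[_ [_]]; rewrite ipC. Qed.

Lemma combination_values (w v1 v2 v3 v4 v : vec) m1 m2 m3 m4 m n1 n2 n3 n4 n :
  w = m1 *: v1 + m2 *: v2 + m3 *: v3 + m4 *: v4 - (eps * m) *: v ->
  m1 = n1 -> m2 = n2 -> m3 = n3 -> m4 = n4 -> m = n ->
  forall i, w 0 i = n1 * v1 0 i + n2 * v2 0 i + n3 * v3 0 i + n4 * v4 0 i - eps * n * v 0 i.
Proof. by move=> -> <- <- <- <- <- i; rewrite !mxE. Qed.

Section Coordinate.
Variable i : 'I_5.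
Local Notation "F ^~" := (fun z => F z 0 i) (at level 2, format "F ^~").

Let D1e2 z : U z -> D1 e2^~ z = 0.
Proof.
move=> Uz; have [_ [q1 q2 q3 q4] _ _] := connection_along_e1 mf A3_offdiagonal Uz.
rewrite -(dalong_coord xi1 i N2.1 Uz).
rewrite (combination_values (weingarten mf D1phi N2 Uz) (etrans q1 (a1_eq0 ccf Uz)) q2 q3
  (etrans q4 (be0 Uz)) (e21 Uz)).
by rewrite !mul0r mulr0 mul0r !addr0 subr0.
Qed.

Let D2e1 z : U z -> D2 e1^~ z = - a2 z * e2 z 0 i.
Proof.
move=> Uz; have [[q1 q2 q3 q4] _ _ _] := connection_along_e2 mf A3_offdiagonal A4_trace Uz.
rewrite -(dalong_coord xi2 i N1.1 Uz).
rewrite (combination_values (weingarten mf D2phi N1 Uz) q1 q2 q3 (etrans q4 (be0 Uz)) (e12 Uz)).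
by rewrite !mul0r mulr0 mul0r !addr0 subr0 add0r.
Qed.

Let D2e2 z : U z ->
  D2 e2^~ z = a2 z * e1 z 0 i + k z * e3 z 0 i - al z * e4 z 0 i - eps * phi z 0 i.
Proof.
move=> Uz; have [_ [q1 q2 q3 q4] _ _] := connection_along_e2 mf A3_offdiagonal A4_trace Uz.
rewrite -(dalong_coord xi2 i N2.1 Uz).
rewrite (combination_values (weingarten mf D2phi N2 Uz) q1 q2 q3 q4 (e22 Uz)).
by rewrite mul0r mulr1 addr0 mulNr.
Qed.

Let D2e3 z : U z -> D2 e3^~ z = - k z * e2 z 0 i.
Proof.
move=> Uz; have [_ _ [q1 q2 q3 q4] _] := connection_along_e2 mf A3_offdiagonal A4_trace Uz.
rewrite -(dalong_coord xi2 i N3.1 Uz).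
rewrite (combination_values (weingarten mf D2phi N3 Uz) q1 q2 q3 (etrans q4 (b2_eq0 ccf Uz)) (e32 Uz)).
by rewrite !mul0r mulr0 mul0r !addr0 subr0 add0r.
Qed.

Let D2e4 z : U z -> D2 e4^~ z = al z * e2 z 0 i.
Proof.
move=> Uz; have [_ _ _ [q1 q2 q3 q4]] := connection_along_e2 mf A3_offdiagonal A4_trace Uz.
rewrite -(dalong_coord xi2 i N4.1 Uz).
have q1' := etrans q1 (etrans (congr1 -%R (be0 Uz)) (oppr0 _)).
have q3' := etrans q3 (etrans (congr1 -%R (b2_eq0 ccf Uz)) (oppr0 _)).
rewrite (combination_values (weingarten mf D2phi N4 Uz) q1' q2 q3' q4 (e42 Uz)).
by rewrite !mul0r mulr0 mul0r !addr0 subr0 add0r.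
Qed.

Let D2a2 z : U z -> D2 a2 z = 0.
Proof.
move=> Uz; have [sf _ _] := ccf_smooth ccf; have [_ sa2 _ _] := ccf_smooth_conn ccf.
have s2f := smooth_onZ oU 2 sf; have sD1f := smooth_on_dalong oU sxi1 sf.
have P := product_rule ccf s2f sa2 (smooth_on_cst (3 : R)) sD1f
  (fun y Uy => (a2_and_D1k ccf Uy).1) Uz (etrans (dalongZ xi2 2 sf Uz)
  (congr1 (fun d => 2 * d) (D2f_eq0 ccf Uz))) erefl (dalong_cst xi2 _ z) (D2D1f_eq0 ccf Uz).
have [f_gt0 _ _] := ccf_pos ccf Uz.
move: P; rewrite mulr0 !mul0r mulr0 addr0 add0r => /eqP.
by rewrite !mulf_eq0 pnatr_eq0 (gt_eqF f_gt0) /= => /eqP.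
Qed.

Let D2al z : U z -> D2 al z = 0.
Proof.
by move=> Uz; rewrite (ccf_codazzi41 ccf Uz) (a1_eq0 ccf Uz) (b2_eq0 ccf Uz) !mulr0 subr0.
Qed.

(** Along [E1] the vector [e2] is constant in R^5.  Its derivative along [E2] is
[a2 e1 + k e3 - al e4 - eps phi], whose coefficients are constant along [E2], and
each of [e1], [e3], [e4], [phi] is differentiated along [E2] into a multiple of
[e2]. *)
Lemma e2_component_equations :
  [/\ smooth_on U e2^~, forall z, U z -> D1 e2^~ z = 0 &
      forall z, U z -> D2 (D2 e2^~) z = - (eps + a2 z ^+ 2 + k z ^+ 2 + al z ^+ 2) * e2 z 0 i].
Proof.
have c1 := smooth_on_coord oU i N1.1; have c3 := smooth_on_coord oU i N3.1.
have c4 := smooth_on_coord oU i N4.1; have cp := smooth_on_coord oU i sphi.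
have [_ sk sal] := ccf_smooth ccf; have [_ sa2 _ _] := ccf_smooth_conn ccf.
split=> //; first exact: smooth_on_coord N2.1.
move=> z Uz; rewrite (dalong_ext oU xi2 D2e2 Uz).
have t1 := smooth_onM oU sa2 c1; have t3 := smooth_onM oU sk c3.
have t4 := smooth_onM oU sal c4; have tp := smooth_onZ oU eps cp.
rewrite (dalongB oU xi2 (smooth_onB oU (smooth_onD oU t1 t3) t4) tp Uz).
rewrite (dalongB oU xi2 (smooth_onD oU t1 t3) t4 Uz) (dalongD xi2 t1 t3 Uz).
rewrite (dalongM xi2 sa2 c1 Uz) (dalongM xi2 sk c3 Uz) (dalongM xi2 sal c4 Uz) (dalongZ xi2 eps cp Uz).
rewrite D2a2 // (D2k_eq0 ccf Uz) D2al // D2e1 // D2e3 // D2e4 //.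
by rewrite -(dalong_coord xi2 i sphi Uz) D2phi //; ring.
Qed.
End Coordinate.

(** The component of [D_E2 E2] along [e1] is [a2 > 0]. *)
Lemma e2_component_moves z : U z -> exists i, D2 (fun z => e2 z 0 i) z != 0.
Proof.
move=> Uz; have a2_pos : 0 < a2 z.
  have [f_gt0 _ D1f_gt0] := ccf_pos ccf Uz; have [ha2 _] := a2_and_D1k ccf Uz.
  have : 0 < 2 * f z * a2 z by rewrite ha2 mulr_gt0.
  by rewrite pmulr_rgt0 // mulr_gt0.
apply: contrapT => no; have D20 : D2 e2 z = 0.
  apply/rowP => i; rewrite (dalong_coord xi2 i N2.1 Uz) mxE.
  by apply/eqP/negPn/negP => ni; apply: no; exists i.
by move: a2_pos; rewrite /conn2 D20 ip0l ltxx.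
Qed.

(** The sign of the component [y] of [e2] is chosen so that [y] increases along [E2]. *)
Lemma frame_coordinates z0 : U z0 -> exists (c : R) (B : set plane) (Phi Psi : plane -> plane) (f_ : R -> R),
  [/\ open B, B z0, B `<=` U, open (Phi @` B) & forall x, B x -> Psi (Phi x) = x] /\
  [/\ forall u, (Phi @` B) u -> {for u, continuous Psi}, smooth_on B Phi, smooth_on (Phi @` B) Psi &
      forall x, B x -> 'D_e_s Psi (Phi x) = xi1 x /\
                       'D_e_t Psi (Phi x) = (f x `^ (3 / 2))^-1 *: xi2 x] /\
  (forall x, B x -> k x = c * f x ^+ 2 /\
    let s := Phi x 0 ord0 in
    [/\ f_ s = f x, derive1 f_ s = D1 f x & derive1n 2 f_ s = D1 (D1 f) x]).
Proof.
move=> Uz0; have basis z h : U z -> exists a b, h = a *: xi1 z + b *: xi2 z.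
  by move=> Uz; have := mf_basis mf h Uz; eexists; eexists; eassumption.
have [i ni] := e2_component_moves Uz0; have [sy D1y D2D2y] := e2_component_equations i.
have [pos|neg|/eqP] := ltgtP 0 (D2 (fun z => e2 z 0 i) z0).
- exact: (flat_coordinates ccf basis sy D1y D2D2y Uz0 pos).
- have syN := smooth_onN oU sy; have sD2y := smooth_on_dalong oU sxi2 sy.
  have DN xi z : U z -> dalong xi (fun z => - e2 z 0 i) z = - dalong xi (fun z => e2 z 0 i) z.
    by move=> Uz; apply: (dalongN xi sy Uz).
  apply: (flat_coordinates ccf basis syN _ _ Uz0).
  + by move=> z Uz; rewrite DN // D1y // oppr0.
  + move=> z Uz; rewrite (dalong_ext oU xi2 (DN xi2) Uz) (dalongN xi2 sD2y Uz) D2D2y //.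
    by rewrite mulrN.
  + by rewrite DN // oppr_gt0.
- by rewrite eq_sym (negPf ni).
Qed.
End FrameCoordinates.

(** * Charts and tangent vectors *)

Section Charts.
Context {R : realType} {M : topologicalType}.
Implicit Types x y : chart R M.

Definition cimg x := cmap x @` cdom x.

Lemma cinv_cdom x z : cimg x z -> cdom x (cinv x z).
Proof. by move=> [q xq <-]; rewrite cmapK. Qed.

Lemma cinvK x z : cimg x z -> cmap x (cinv x z) = z.
Proof. by move=> [q xq <-]; rewrite cmapK. Qed.

Lemma cimg_cmap x q : cdom x q -> cimg x (cmap x q).
Proof. by exists q. Qed.

Lemma cinv_cvg x q : cdom x q -> {for cmap x q, continuous (cinv x)}.
Proof.
move=> xq; have := @cinv_continuous _ _ x; rewrite continuous_open_subspace; last exact: cimg_open.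
by apply; rewrite inE; apply: cimg_cmap.
Qed.

Lemma cmap_cvg x q : cdom x q -> {for q, continuous (cmap x)}.
Proof.
move=> xq; have := @cmap_continuous _ _ x; rewrite continuous_open_subspace; last exact: cdom_open.
by apply; rewrite inE.
Qed.

Lemma open_chart_image x (A : set M) : open A -> open (cmap x @` (A `&` cdom x)).
Proof.
move=> oA; rewrite openE => _ [q [Aq xq] <-].
have : nbhs (cmap x q) (cimg x) by apply: open_nbhs_nbhs; split; [exact: cimg_open | exact: cimg_cmap].
have : nbhs (cmap x q) (cinv x @^-1` A).
  apply: (cinv_cvg xq); rewrite cmapK //; exact: open_nbhs_nbhs.
move=> H1 H2; apply: filterS (filterI H1 H2) => z [Az xz].
by exists (cinv x z); [split=> //; exact: cinv_cdom | exact: cinvK].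
Qed.

(** Composing with a change of chart changes nothing near the point; away from the
common domain the maps [cinv] are arbitrary. *)
Lemma near_transition (T : Type) (F : M -> T) x y q : cdom x q -> cdom y q ->
  \forall z \near cmap y q, (F \o cinv x) ((cmap x \o cinv y) z) = (F \o cinv y) z.
Proof.
move=> xq yq.
have : nbhs (cmap y q) (cmap y @` (cdom x `&` cdom y)).
  by apply: open_nbhs_nbhs; split; [apply: open_chart_image; exact: cdom_open | exists q].
by apply: filterS => z [q' [xq' yq'] <-] /=; rewrite cmapK // cmapK.
Qed.

Lemma transition_at x y q : cdom x q -> cdom y q -> (cmap x \o cinv y) (cmap y q) = cmap x q.
Proof. by move=> xq yq /=; rewrite cmapK. Qed.

Lemma transition_differentiable x y q : smoothly_compatible x y -> cdom x q -> cdom y q ->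
  differentiable (cmap x \o cinv y) (cmap y q).
Proof.
by move=> [_ syx] xq yq; apply: (smooth_on_differentiable syx); exists q.
Qed.

(** Derivatives in two charts are related by the chain rule, which makes [dirder]
independent of the chart. *)
Lemma derive_change_chart (W : normedModType R) (F : M -> W) x y q h :
  smoothly_compatible x y -> cdom x q -> cdom y q ->
  differentiable (F \o cinv x) (cmap x q) ->
  'D_h (F \o cinv y) (cmap y q) = 'D_('D_h (cmap x \o cinv y) (cmap y q)) (F \o cinv x) (cmap x q).
Proof.
move=> xy xq yq dF.
rewrite -(near_eq_derive h (near_transition F xq yq)).
rewrite -[fun z => _]/((F \o cinv x) \o (cmap x \o cinv y)) derive_chain.
- by rewrite transition_at.
- exact: transition_differentiable.
- by rewrite transition_at.
Qed.

End Charts.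

Section TangentVectors.
Context {R : realType} (eps : R) {M : topologicalType} (S : surface R M)
        (phi : M -> 'rV[R]_5).
Local Notation vec := 'rV[R]_5.
Local Notation ip := (ambient_ip eps).
Hypothesis imm : isometric_immersion eps S phi.

Let sphi : smooth_map S phi. Proof. by case: imm. Qed.

Lemma smooth_map_differentiable (W : normedModType R) (F : M -> W) x q :
  smooth_map S F -> atlas S x -> cdom x q -> differentiable (F \o cinv x) (cmap x q).
Proof. by move=> sF ax xq; apply: (smooth_on_differentiable (sF x ax)); exists q. Qed.

Let dphi x q := smooth_map_differentiable (x := x) (q := q) sphi.

Lemma coord_field_lin x q a b h k : atlas S x -> cdom x q ->
  coord_field phi x (a *: h + b *: k) q = a *: coord_field phi x h q + b *: coord_field phi x k q.
Proof.
by move=> ax xq; rewrite /coord_field (derive_dirD _ _ (dphi ax xq)) !(derive_dirZ _ _ (dphi ax xq)).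
Qed.

Lemma coord_field_inj x q h k : atlas S x -> cdom x q ->
  coord_field phi x h q = coord_field phi x k q -> h = k.
Proof.
move=> ax xq hk; apply/eqP; rewrite -subr_eq0; apply/eqP.
case: imm => _ _ /(_ x q (h - k) ax xq); apply.
by rewrite (derive_dirB _ _ (dphi ax xq)); move: hk; rewrite /coord_field => ->; rewrite subrr.
Qed.

Lemma coord_field_change x y q h : atlas S x -> atlas S y -> cdom x q -> cdom y q ->
  coord_field phi y h q = coord_field phi x ('D_h (cmap x \o cinv y) (cmap y q)) q.
Proof.
move=> ax ay xq yq; apply: derive_change_chart => //; last exact: dphi.
exact: atlas_compatible ax ay.
Qed.

Lemma tangent_vecP x p v : atlas S x -> cdom x p ->
  tangent_vec S phi p v <-> exists h, v = coord_field phi x h p.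
Proof.
move=> ax xp; split=> [[y [h [ay yp ->]]]|[h ->]]; last by exists x, h.
by eexists; apply: coord_field_change.
Qed.

Lemma dirderE (W : normedModType R) (F : M -> W) x p h : atlas S x -> cdom x p ->
  differentiable (F \o cinv x) (cmap x p) ->
  dirder S phi F p (coord_field phi x h p) = 'D_h (F \o cinv x) (cmap x p).
Proof.
move=> ax xp dF; rewrite /dirder.
set A := [set w | _].
have A0 : A ('D_h (F \o cinv x) (cmap x p)) by exists x, h.
have [y [k [ay yp ky <-]]] := xgetI 0 A0.
have xy := atlas_compatible ax ay.
rewrite (derive_change_chart k xy xp yp dF); congr ('D_ _ _ _).
by apply: (coord_field_inj ax xp); rewrite -ky -coord_field_change.
Qed.
End TangentVectors.

Section Reparametrization.
Context {R : realType} {M : topologicalType} (S : surface R M).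
Local Notation plane := 'rV[R]_2.
Context (x0 : chart R M) (B : set plane) (Phi Psi : plane -> plane).
Hypothesis (ax0 : atlas S x0) (oB : open B) (BU : B `<=` cimg x0) (oPB : open (Phi @` B)).
Hypothesis PsiK : forall z, B z -> Psi (Phi z) = z.
Hypothesis cPsi : forall u, (Phi @` B) u -> {for u, continuous Psi}.
Hypothesis (sPhi : smooth_on B Phi) (sPsi : smooth_on (Phi @` B) Psi).

Let dom : set M := [set q | cdom x0 q /\ B (cmap x0 q)].

Let dom_image : (Phi \o cmap x0) @` dom = Phi @` B.
Proof.
apply/seteqP; split => [u [q [xq Bq] <-]|u [z Bz <-]]; first by exists (cmap x0 q).
have Uz := BU Bz; exists (cinv x0 z); last by rewrite /= cinvK.
by split; [exact: cinv_cdom | rewrite cinvK].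
Qed.

Let dom_open : open dom.
Proof.
rewrite openE => q [xq Bq]; apply: filterI; first exact: (open_nbhs_nbhs (conj (@cdom_open _ _ x0) xq)).
exact: (cmap_cvg xq (open_nbhs_nbhs (conj oB Bq))).
Qed.

Let image_open : open ((Phi \o cmap x0) @` dom).
Proof. by rewrite dom_image. Qed.

Let map_continuous : {within dom, continuous (Phi \o cmap x0)}.
Proof.
apply: continuous_in_subspaceT => q; rewrite inE => -[xq Bq].
apply: continuous_comp; first exact: cmap_cvg.
exact/differentiable_continuous/(smooth_on_differentiable sPhi).
Qed.

Let inv_continuous : {within (Phi \o cmap x0) @` dom, continuous (cinv x0 \o Psi)}.
Proof.
apply: continuous_in_subspaceT => u; rewrite dom_image inE => Bu.
apply: continuous_comp; first exact: cPsi.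
by case: Bu => z Bz <-; rewrite PsiK // -(cinvK (BU Bz)); apply: cinv_cvg; exact/cinv_cdom/BU.
Qed.

Let mapK q : dom q -> (cinv x0 \o Psi) ((Phi \o cmap x0) q) = q.
Proof. by move=> [xq Bq]; rewrite /= PsiK // cmapK. Qed.

(** A chart of the atlas may be followed by a diffeomorphism [Phi] of the plane with
inverse [Psi]: the new transition maps are compositions of the old ones with
[Phi] and [Psi]. *)
Lemma reparametrized_chart : exists x : chart R M,
  [/\ cdom x = dom, cmap x = Phi \o cmap x0, cinv x = cinv x0 \o Psi & local_coordinates S x].
Proof.
pose x := Chart dom_open image_open mapK map_continuous inv_continuous.
exists x; split=> // y ay; have [c1 c2] := atlas_compatible ax0 ay; split.
- have oI : open (cmap x0 @` (cdom x0 `&` cdom y)) by rewrite setIC; exact/open_chart_image/cdom_open.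
  have oJ : open (cmap x @` (cdom x `&` cdom y)) by rewrite setIC; exact/open_chart_image/cdom_open.
  apply: (smooth_on_comp (U' := cmap x0 @` (cdom x0 `&` cdom y)) (T := Psi) oJ _ _ oI c1).
  + by apply: smooth_on_subset sPsi => u [q [[xq Bq] yq] <-]; exists (cmap x0 q).
  + by move=> u [q [[xq Bq] yq] <-] /=; rewrite PsiK //; exists q.
- have oJ : open (cmap y @` (cdom x `&` cdom y)) by exact/open_chart_image/cdom_open.
  apply: (smooth_on_comp (U' := B) (T := cmap x0 \o cinv y) oJ _ _ oB sPhi).
  + by apply: smooth_on_subset c2 => u [q [[xq Bq] yq] <-]; exists q.
  + by move=> u [q [[xq Bq] yq] <-] /=; rewrite cmapK.
Qed.
End Reparametrization.

(** * The adapted frame on the surface *)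

Section Positivity.
Context {R : realType} (eps : R).
Local Notation vec := 'rV[R]_5.
Local Notation ip := (ambient_ip eps).

Lemma cauchy_schwarz4 (v w : 'I_4 -> R) :
  (\sum_i v i * w i) ^+ 2 <= (\sum_i v i * v i) * (\sum_i w i * w i).
Proof.
rewrite !big_ord_recl !big_ord0 !addr0.
set a := v _; set b := v _; set c := v _; set d := v _.
set a' := w _; set b' := w _; set c' := w _; set d' := w _.
rewrite -subr_ge0.
rewrite [leRHS](_ : _ = (a * b' - b * a') ^+ 2 + (a * c' - c * a') ^+ 2
  + (a * d' - d * a') ^+ 2 + (b * c' - c * b') ^+ 2 + (b * d' - d * b') ^+ 2
  + (c * d' - d * c') ^+ 2); last by ring.
by rewrite !addr_ge0 // sqr_ge0.
Qed.

Lemma sum_sqr_eq0 n (v : 'I_n -> R) : \sum_i v i * v i = 0 -> forall i, v i = 0.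
Proof.
move=> /eqP; rewrite psumr_eq0 => [/allP H i|i _]; last by rewrite -expr2 sqr_ge0.
by have := H i (mem_index_enum i); rewrite /= -expr2 sqrf_eq0 => /eqP.
Qed.

(** The tangent spaces of the space form are positive definite; for [eps < 0] this is
the reverse Cauchy-Schwarz inequality. *)
Lemma ip_tangent_pos x (v : vec) : space_form eps x ->
  ip v (space_form_normal eps x) = 0 -> v <> 0 -> 0 < ip v v.
Proof.
rewrite /space_form /space_form_normal /= => Nx vn v0.
have [e0|e0] := ltP eps 0; last first.
  have E : ip v v = \sum_i v 0 i * v 0 i.
    by rewrite ipE; apply: eq_bigr => i _; rewrite /ip_sign ltNge e0 /= mul1r.
  rewrite E lt_neqAle eq_sym; apply/andP; split; last first.
    by apply: sumr_ge0 => i _; rewrite -expr2 sqr_ge0.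
  apply/eqP => /sum_sqr_eq0 vi; apply: v0; apply/rowP => i; by rewrite vi mxE.
move: Nx vn; rewrite lt_eqF // => -[xx /(_ e0) x0].
move: xx; rewrite /ambient_ip e0.
have := cauchy_schwarz4 (fun i => v 0 (lift ord0 i)) (fun i => x 0 (lift ord0 i)).
set C := \sum_i _; set P := \sum_i _; set Q := \sum_i _ => CPQ xx vx.
have Q0 : Q < x 0 ord0 ^+ 2.
  have : eps^-1 < 0 by rewrite invr_lt0.
  by move: xx; rewrite expr2; lra.
have P0 : 0 <= P by apply: sumr_ge0 => i _; rewrite -expr2 sqr_ge0.
have CE : C = v 0 ord0 * x 0 ord0 by move: vx; lra.
have Ppos : 0 < P.
  rewrite lt_neqAle P0 andbT eq_sym; apply/eqP => P00.
  have vi := sum_sqr_eq0 P00.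
  have C0 : C = 0 by apply: big1 => i _; rewrite vi mul0r.
  apply: v0; apply/rowP => i; rewrite mxE.
  have [j ->|->] := unliftP ord0 i; first exact: vi.
  by move: CE; rewrite C0 => /esym/eqP; rewrite mulf_eq0 (gt_eqF x0) orbF => /eqP.
have : v 0 ord0 ^+ 2 * x 0 ord0 ^+ 2 < P * x 0 ord0 ^+ 2.
  by rewrite -exprMn -CE; apply: le_lt_trans CPQ _; rewrite ltr_pM2l.
rewrite ltr_pM2r ?exprn_gt0 // expr2; lra.
Qed.
End Positivity.

Lemma derive_plane (R : realType) (W : normedModType R) (F : 'rV[R]_2 -> W) z h :
  differentiable F z ->
  'D_h F z = h 0 0 *: 'D_(delta_mx 0 0) F z + h 0 1 *: 'D_(delta_mx 0 1) F z.
Proof.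
move=> dF; rewrite derive_rV_dir // !big_ord_recl big_ord0 addr0.
by have -> : lift ord0 ord0 = 1 :> 'I_2 by apply/val_inj.
Qed.

Section AdaptedFrames.
Context {R : realType} (eps : R) {M : topologicalType} (S : surface R M)
        (phi : M -> 'rV[R]_5) (E1 E2 E3 E4 : M -> 'rV[R]_5).
Local Notation vec := 'rV[R]_5.
Local Notation ip := (ambient_ip eps).
Local Notation T p := (tangent_vec S phi p).
Local Notation n p := (space_form_normal eps (phi p)).
Hypothesis imm : isometric_immersion eps S phi.
Hypothesis frame : adapted_frame eps S phi E1 E2 E3 E4.

Let sphi : smooth_map S phi. Proof. by case: imm. Qed.
Let Nphi p : space_form eps (phi p). Proof. by case: imm. Qed.
Let sE1 : smooth_map S E1. Proof. by case: frame => -[[]]. Qed.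
Let sE2 : smooth_map S E2. Proof. by case: frame => -[_ []]. Qed.
Let sE3 : smooth_map S E3. Proof. by case: frame => -[_ _ []]. Qed.
Let sE4 : smooth_map S E4. Proof. by case: frame => -[_ _ _ []]. Qed.
Let tE1 p : T p (E1 p). Proof. by case: frame => -[[]]. Qed.
Let tE2 p : T p (E2 p). Proof. by case: frame => -[_ []]. Qed.
Let nE3 p : normal_vec eps S phi p (E3 p). Proof. by case: frame => -[_ _ []]. Qed.
Let nE4 p : normal_vec eps S phi p (E4 p). Proof. by case: frame => -[_ _ _ []]. Qed.
Let ip11 p : ip (E1 p) (E1 p) = 1. Proof. by case: frame => _ _ _ /(_ p) []. Qed.
Let ip22 p : ip (E2 p) (E2 p) = 1. Proof. by case: frame => _ _ _ /(_ p) []. Qed.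
Let ip12 p : ip (E1 p) (E2 p) = 0. Proof. by case: frame => _ _ _ /(_ p) []. Qed.
Let ip44 p : ip (E4 p) (E4 p) = 1. Proof. by case: frame => _ _ /(_ p) []. Qed.
Let ip34 p : ip (E3 p) (E4 p) = 0. Proof. by case: frame => _ _ /(_ p) []. Qed.

Lemma ip_projection p v : ip (space_form_proj eps (phi p) v) (n p) = 0.
Proof.
rewrite /space_form_proj ipBl ipZl (space_form_normalE (Nphi p)) divfK ?subrr //.
exact: normal_sqnorm_neq0.
Qed.

Lemma normal_vecP p w : normal_vec eps S phi p w <->
  ip w (n p) = 0 /\ forall u, T p u -> ip w u = 0.
Proof.
split=> [[<- H]|[H0 H]]; first by split; [exact: ip_projection | exact: H].
by split=> //; rewrite /space_form_proj H0 mul0r scale0r subr0.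
Qed.

Lemma ip_coord_field_normal x h p : atlas S x -> cdom x p -> ip (coord_field phi x h p) (n p) = 0.
Proof.
move=> ax xp; pose z := cmap x p.
have oU : open (cimg x) by exact: cimg_open.
have Uz : cimg x z by exact: cimg_cmap.
have sU := sphi ax : smooth_on (cimg x) (phi \o cinv x).
rewrite -[coord_field phi x h p](dalongE (fun _ => h)) /space_form_normal.
have [e0|e0] := eqVneq eps 0.
  rewrite ip_delta0 // (dalong_coord (fun _ => h) ord0 sU Uz).
  rewrite (dalong_ext oU (fun _ => h) (G := fun _ => 0) _ Uz) ?dalong_cst // => y _ /=.
  by have := Nphi (cinv x y); rewrite /space_form /= e0 eqxx.
have := dalong_ip eps oU (fun _ => h) sU sU Uz.
rewrite (dalong_ext oU (fun _ => h) (G := fun _ => eps^-1) _ Uz); last first.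
  move=> y _; have := Nphi (cinv x y); rewrite /space_form /= (negPf e0); by case.
rewrite dalong_cst (ipC _ ((phi \o cinv x) z)) /= cmapK // => /esym/eqP.
by rewrite -mulr2n mulrn_eq0 /= => /eqP.
Qed.

Lemma tangent_normal p u : T p u -> ip u (n p) = 0.
Proof. by move=> [x [h [ax xp ->]]]; exact: ip_coord_field_normal. Qed.

Lemma tangent_lin p a b u v : T p u -> T p v -> T p (a *: u + b *: v).
Proof.
move=> [x [h [ax xp uE]]] /(tangent_vecP imm _ ax xp)[k vE]; exists x, (a *: h + b *: k).
by split; [exact: ax | exact: xp | rewrite (coord_field_lin imm a b h k ax xp) uE vE].
Qed.

(** [E1] and [E2] are independent because they are orthonormal, hence they span the
two-dimensional image of the differential of [phi]. *)
Lemma tangent_expansion p u : T p u -> u = ip u (E1 p) *: E1 p + ip u (E2 p) *: E2 p.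
Proof.
move=> [x [h [ax xp uE]]].
have [h1 E1h] := (tangent_vecP imm (E1 p) ax xp).1 (tE1 p).
have [h2 E2h] := (tangent_vecP imm (E2 p) ax xp).1 (tE2 p).
pose A : 'M[R]_2 := \matrix_(i < 2) (if i == ord0 then h1 else h2).
have mulA (c : 'rV[R]_2) : c *m A = c 0 ord0 *: h1 + c 0 ord_max *: h2.
  rewrite mulmx_sum_row !big_ord_recl big_ord0 addr0 !rowK /=.
  by congr (_ + c 0 _ *: _); apply/val_inj.
have Aunit : A \in unitmx.
  rewrite -row_free_unit; apply: inj_row_free => c; rewrite mulA => cA.
  have : c 0 ord0 *: E1 p + c 0 ord_max *: E2 p = 0.
    by rewrite E1h E2h -(coord_field_lin imm _ _ h1 h2 ax xp) cA /coord_field derive0.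
  move=> E; have c1 := congr1 (fun v => ip v (E1 p)) E.
  have c2 := congr1 (fun v => ip v (E2 p)) E.
  rewrite ipDl !ipZl ip11 (ipC _ (E2 p)) ip12 ip0l mulr1 mulr0 addr0 in c1.
  rewrite ipDl !ipZl ip12 ip22 ip0l mulr1 mulr0 add0r in c2.
  apply/rowP => i; rewrite mxE; case: (unliftP ord0 i) => [j ->|->]; last exact: c1.
  by rewrite -{}[RHS]c2; congr (c 0 _); apply/val_inj; rewrite /= ord1.
have [c hE] : exists c : 'rV[R]_2, h = c 0 ord0 *: h1 + c 0 ord_max *: h2.
  by exists (h *m invmx A); rewrite -mulA mulmxKV.
have {}uE : u = c 0 ord0 *: E1 p + c 0 ord_max *: E2 p.
  by rewrite uE hE (coord_field_lin imm _ _ h1 h2 ax xp) -E1h -E2h.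
have -> : ip u (E1 p) = c 0 ord0.
  by rewrite uE ipDl !ipZl ip11 (ipC _ (E2 p)) ip12 mulr1 mulr0 addr0.
have -> // : ip u (E2 p) = c 0 ord_max.
by rewrite uE ipDl !ipZl ip12 ip22 mulr1 mulr0 add0r.
Qed.

Lemma tangent_ext p u v : T p u -> T p v ->
  (forall w, T p w -> ip u w = ip v w) -> u = v.
Proof.
move=> Tu Tv uv; rewrite (tangent_expansion Tu) (tangent_expansion Tv).
by rewrite !(uv _ (tE1 p)) !(uv _ (tE2 p)).
Qed.

Lemma ip_tangent p u v : T p u -> 
  ip u v = ip u (E1 p) * ip v (E1 p) + ip u (E2 p) * ip v (E2 p).
Proof. by move=> Tu; rewrite {1}(tangent_expansion Tu) ipDl !ipZl !(ipC _ v). Qed.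

Lemma tan_partE p v : tan_part eps S phi p v = ip v (E1 p) *: E1 p + ip v (E2 p) *: E2 p.
Proof.
have Tw : T p (ip v (E1 p) *: E1 p + ip v (E2 p) *: E2 p) by apply: tangent_lin.
apply: xget_unique => [|w [Tw' w'v]].
  split=> // u Tu; rewrite ipBl ipDl !ipZl ipC (ip_tangent _ Tu) !(ipC _ _ u).
  by rewrite (mulrC (ip u (E1 p))) (mulrC (ip u (E2 p))) subrr.
apply: (tangent_ext Tw' Tw) => u Tu.
have := w'v u Tu; rewrite ipBl => /eqP; rewrite subr_eq0 => /eqP <-.
rewrite ipC (ip_tangent _ Tu) ipDl !ipZl !(ipC _ _ u).
by rewrite (mulrC (ip u (E1 p))) (mulrC (ip u (E2 p))).
Qed.

Lemma tan_part_tangent p v : T p (tan_part eps S phi p v).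
Proof. by rewrite tan_partE; apply: tangent_lin. Qed.

Lemma ip_tan_part p v u : T p u -> ip (tan_part eps S phi p v) u = ip v u.
Proof.
move=> Tu; rewrite tan_partE ipDl !ipZl (ipC _ v u) (ip_tangent v Tu).
rewrite (ipC _ (E1 p) u) (ipC _ (E2 p) u).
by rewrite (mulrC (ip u (E1 p))) (mulrC (ip u (E2 p))).
Qed.

Lemma ip_nor_part p v w : normal_vec eps S phi p w -> ip (nor_part eps S phi p v) w = ip v w.
Proof.
move=> /normal_vecP[w0 wT]; rewrite /nor_part /space_form_proj !ipBl ipZl.
by rewrite (ipC _ (n p)) w0 (ipC _ (tan_part _ _ _ _ _)) wT ?mulr0 ?subr0 //; exact: tan_part_tangent.
Qed.

Lemma nor_part_normal p v : normal_vec eps S phi p (nor_part eps S phi p v).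
Proof.
apply/normal_vecP; split.
  by rewrite /nor_part ipBl ip_projection (tangent_normal (tan_part_tangent p v)) subr0.
move=> u Tu; rewrite /nor_part ipBl ip_tan_part // /space_form_proj ipBl ipZl.
by rewrite (ipC _ (n p) u) (tangent_normal Tu) mulr0 subr0 subrr.
Qed.

Lemma normal_vec0 p : normal_vec eps S phi p 0.
Proof. by apply/normal_vecP; split=> [|u _]; rewrite ip0l. Qed.

Lemma normal_vec_lin p a b u v : normal_vec eps S phi p u -> normal_vec eps S phi p v ->
  normal_vec eps S phi p (a *: u + b *: v).
Proof.
move=> /normal_vecP[u0 uT] /normal_vecP[v0 vT]; apply/normal_vecP; split=> [|w Tw].
  by rewrite ipDl !ipZl u0 v0 !mulr0 addr0.
by rewrite ipDl !ipZl uT // vT // !mulr0 addr0.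
Qed.

(** Whether or not the defining set is a singleton, its chosen element is normal.  So
[H] is normal and, if nonzero, of positive square norm, before uniqueness is known. *)
Lemma second_fundamental_form_normal p v w :
  normal_vec eps S phi p (second_fundamental_form eps S phi p v w).
Proof.
rewrite /second_fundamental_form; case: xgetP => [b _ [x [h [_ _ _ ->]]]|_].
  exact: nor_part_normal.
exact: normal_vec0.
Qed.

Lemma mean_curvature_vector_normal p :
  normal_vec eps S phi p (mean_curvature_vector eps S phi p).
Proof.
rewrite /mean_curvature_vector /metric_trace; case: xgetP => [t _ [v [w [_ _ _ _ ->]]]|_].
  rewrite scalerDr; apply: normal_vec_lin; exact: second_fundamental_form_normal.
by rewrite scaler0; apply: normal_vec0.
Qed.

Hypothesis H_neq0 : forall p, mean_curvature_vector eps S phi p <> 0.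

Local Notation f p := (mean_curvature eps S phi p).
Local Notation H p := (mean_curvature_vector eps S phi p).
Local Notation D F p v := (dirder S phi F p v).
Local Notation II p v w := (second_fundamental_form eps S phi p v w).

Lemma normal_vec_pos p w : normal_vec eps S phi p w -> w <> 0 -> 0 < ip w w.
Proof. by move=> /normal_vecP[w0 _]; apply: ip_tangent_pos (Nphi p) w0. Qed.

Lemma mean_curvature_pos p : 0 < f p.
Proof. by rewrite sqrtr_gt0; exact: normal_vec_pos (mean_curvature_vector_normal p) (@H_neq0 p). Qed.

Lemma E3_def p : E3 p = (f p)^-1 *: H p.
Proof. by case: frame => _ /(_ p). Qed.

Lemma H_E3 p : H p = f p *: E3 p.
Proof. by rewrite E3_def scalerA divff ?scale1r // gt_eqF // mean_curvature_pos. Qed.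

Lemma ip33 p : ip (E3 p) (E3 p) = 1.
Proof.
have f0 := mean_curvature_pos p.
have HH : ip (H p) (H p) = f p ^+ 2.
  by rewrite sqr_sqrtr // ltW //; exact: normal_vec_pos (mean_curvature_vector_normal p) (@H_neq0 p).
by rewrite E3_def ipZl ipZr HH; field; rewrite gt_eqF.
Qed.

Lemma ip_tangent_E3 p u : T p u -> ip u (E3 p) = 0.
Proof. by move=> Tu; rewrite ipC; case: (normal_vecP p (E3 p)).1 => // _; apply. Qed.

Lemma ip_tangent_E4 p u : T p u -> ip u (E4 p) = 0.
Proof. by move=> Tu; rewrite ipC; case: (normal_vecP p (E4 p)).1 => // _; apply. Qed.

Lemma space_expansion p u :
  u = ip u (E1 p) *: E1 p + ip u (E2 p) *: E2 p + ip u (E3 p) *: E3 p + ip u (E4 p) *: E4 p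
    + (ip u (n p) / normal_sqnorm eps) *: n p.
Proof.
apply: (orthonormal_expansion u (Nphi p)); last 1 first.
- split; [exact: tangent_normal | exact: tangent_normal | |].
    by case: (normal_vecP p (E3 p)).1.
  by case: (normal_vecP p (E4 p)).1.
- by split; [exact: ip11 | exact: ip22 | exact: ip33 | exact: ip44].
- by split; [exact: ip12 | exact: ip_tangent_E3 | exact: ip_tangent_E4
            | exact: ip_tangent_E3 | exact: ip_tangent_E4].
- exact: ip34.
Qed.

Lemma normal_expansion p w : normal_vec eps S phi p w ->
  w = ip w (E3 p) *: E3 p + ip w (E4 p) *: E4 p.
Proof.
move=> /normal_vecP[w0 wT]; rewrite {1}(space_expansion p w) w0 (wT _ (tE1 p)) (wT _ (tE2 p)).
by rewrite mul0r !scale0r addr0 !add0r.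
Qed.

Lemma normal_ext p u v : normal_vec eps S phi p u -> normal_vec eps S phi p v ->
  ip u (E3 p) = ip v (E3 p) -> ip u (E4 p) = ip v (E4 p) -> u = v.
Proof. by move=> nu nv u3 u4; rewrite (normal_expansion nu) (normal_expansion nv) u3 u4. Qed.

Section InChart.
Variable x : chart R M.
Hypothesis ax : atlas S x.
Local Notation U := (cimg x).

Lemma cimg_isopen : open U. Proof. exact: cimg_open. Qed.
Let oU := cimg_isopen.

Lemma coord_field_smooth h : smooth_on U (coord_field phi x h \o cinv x).
Proof.
apply: (smooth_on_ext oU _ (smooth_on_derive h (sphi ax))) => z Uz.
by rewrite /= /coord_field cinvK.
Qed.

Lemma dirder_chart (W : normedModType R) (F : M -> W) p h : cdom x p ->
  smooth_on U (F \o cinv x) -> D F p (coord_field phi x h p) = 'D_h (F \o cinv x) (cmap x p).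
Proof.
move=> xp sF; apply: (dirderE imm) => //.
by apply: (smooth_on_differentiable sF); exact: cimg_cmap.
Qed.

Lemma dirder_ip (F G : M -> vec) p v : cdom x p -> T p v ->
  smooth_on U (F \o cinv x) -> smooth_on U (G \o cinv x) ->
  D (fun q => ip (F q) (G q)) p v = ip (D F p v) (G p) + ip (F p) (D G p v).
Proof.
move=> xp /(tangent_vecP imm _ ax xp)[h ->] sF sG.
have Uz := cimg_cmap xp.
rewrite (dirder_chart h xp (smooth_on_ip eps oU sF sG)).
rewrite (dirder_chart h xp sF) (dirder_chart h xp sG).
rewrite -[LHS](dalongE (fun _ => h)) (dalong_ip eps oU _ sF sG Uz) !dalongE /=.
by rewrite cmapK.
Qed.

Lemma dirder_local (W : normedModType R) (F G : M -> W) p v : cdom x p -> T p v ->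
  (forall q, cdom x q -> F q = G q) -> smooth_on U (F \o cinv x) -> D F p v = D G p v.
Proof.
move=> xp /(tangent_vecP imm _ ax xp)[h ->] FG sF.
have E z : U z -> (F \o cinv x) z = (G \o cinv x) z by move=> Uz; apply: FG; exact: cinv_cdom.
have sG := smooth_on_ext oU E sF.
rewrite (dirder_chart h xp sF) (dirder_chart h xp sG).
by rewrite -!(dalongE (fun _ => h)); apply: (dalong_ext oU _ E); exact: cimg_cmap.
Qed.

Lemma dirder_cst (W : normedModType R) (c : W) p v : cdom x p -> T p v -> D (fun _ => c) p v = 0.
Proof.
move=> xp /(tangent_vecP imm _ ax xp)[h ->].
by rewrite (dirder_chart h xp (smooth_on_cst (c : W) : smooth_on U _)); exact: derive_cst.
Qed.

Lemma dirder_linear (W : normedModType R) (F : M -> W) p a b u v : cdom x p -> T p u -> T p v ->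
  smooth_on U (F \o cinv x) -> D F p (a *: u + b *: v) = a *: D F p u + b *: D F p v.
Proof.
move=> xp /(tangent_vecP imm _ ax xp)[h ->] /(tangent_vecP imm _ ax xp)[k ->] sF.
rewrite -(coord_field_lin imm a b h k ax xp) !(dirder_chart _ xp sF).
have dF := smooth_on_differentiable sF (cimg_cmap xp).
by rewrite (derive_dirD _ _ dF) !(derive_dirZ _ _ dF).
Qed.

(** The Weingarten formula computes the second fundamental form from the derivatives
of a normal field; hence it does not depend on the extension of [w]. *)
Lemma second_form_weingarten (N : M -> vec) p v w : cdom x p -> T p v -> T p w ->
  smooth_map S N -> (forall q, normal_vec eps S phi q (N q)) ->
  ip (II p v w) (N p) = - ip w (D N p v).
Proof.
move=> xp Tv Tw sN nN; rewrite /second_fundamental_form.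
set A := [set b | _].
have [h wE] := (tangent_vecP imm w ax xp).1 Tw.
have A0 : A (nor_part eps S phi p (D (coord_field phi x h) p v)) by exists x, h.
have [y [k [ay yp ky ->]]] := xgetI 0 A0.
rewrite (ip_nor_part _ (nN p)).
have sY : smooth_on (cimg y) (coord_field phi y k \o cinv y).
  have oY : open (cimg y) by exact: cimg_open.
  apply: (smooth_on_ext oY _ (smooth_on_derive k (sphi ay))) => z Uz.
  by rewrite /= /coord_field cinvK.
have [l vE] := (tangent_vecP imm v ay yp).1 Tv.
have oY : open (cimg y) by exact: cimg_open.
have Yz := cimg_cmap yp.
have dN := smooth_on_differentiable (sN y ay) Yz.
have dY := smooth_on_differentiable sY Yz.
rewrite vE (dirderE imm l ay yp dY) (dirderE imm l ay yp dN).
have := dalong_ip eps oY (fun _ => l) sY (sN y ay) Yz.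
rewrite (dalong_ext oY (fun _ => l) (G := fun _ => 0) _ Yz); last first.
  move=> z /cinv_cdom yz /=; rewrite ipC; have /normal_vecP[_] := nN (cinv y z); apply.
  by exists y, k.
rewrite dalong_cst !dalongE /= cmapK // ky => /esym/eqP.
by rewrite addr_eq0 => /eqP.
Qed.
End InChart.

Local Opaque second_fundamental_form dirder.

Lemma exists_chart p : exists2 x, atlas S x & cdom x p.
Proof. exact: atlas_cover. Qed.

Lemma ip_II_E3 p v w : T p v -> T p w -> ip (II p v w) (E3 p) = - ip w (D E3 p v).
Proof.
by move=> Tv Tw; have [x ax xp] := exists_chart p; exact: (second_form_weingarten ax xp Tv Tw sE3 nE3).
Qed.

Lemma ip_II_E4 p v w : T p v -> T p w -> ip (II p v w) (E4 p) = - ip w (D E4 p v).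
Proof.
by move=> Tv Tw; have [x ax xp] := exists_chart p; exact: (second_form_weingarten ax xp Tv Tw sE4 nE4).
Qed.

Lemma dirder_lin_map (F : M -> vec) p a b u v : smooth_map S F -> T p u -> T p v ->
  D F p (a *: u + b *: v) = a *: D F p u + b *: D F p v.
Proof.
by move=> sF Tu Tv; have [x ax xp] := exists_chart p; exact: (dirder_linear ax a b xp Tu Tv (sF x ax)).
Qed.

Lemma shape_operatorE p c3 c4 v : T p v ->
  shape_operator eps S phi p (c3 *: E3 p + c4 *: E4 p) v
  = - (c3 *: tan_part eps S phi p (D E3 p v) + c4 *: tan_part eps S phi p (D E4 p v)).
Proof.
move=> Tv; set w0 := - _.
have Tw0 : T p w0.
  rewrite /w0 -scaleN1r -[X in T p X]addr0 -[X in T p (_ + X)](scale0r (E1 p)).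
  apply: tangent_lin (tE1 p); apply: tangent_lin; exact: tan_part_tangent.
have w0E u : T p u -> ip w0 u = ip (II p v u) (c3 *: E3 p + c4 *: E4 p).
  have linl a b : ip (- (c3 *: a + c4 *: b)) u = - (c3 * ip a u + c4 * ip b u).
    by rewrite ipNl ipDl !ipZl.
  have linr c : ip c (c3 *: E3 p + c4 *: E4 p) = c3 * ip c (E3 p) + c4 * ip c (E4 p).
    by rewrite ipDr !ipZr.
  move=> Tu; rewrite linr (ip_II_E3 Tv Tu) (ip_II_E4 Tv Tu) /w0 linl.
  have combine (a b a' b' : R) : a = a' -> b = b' ->
    - (c3 * a + c4 * b) = c3 * - a' + c4 * - b' by move=> -> ->; ring.
  exact: combine (etrans (ip_tan_part _ Tu) (ipC _ _ _)) (etrans (ip_tan_part _ Tu) (ipC _ _ _)).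
apply: xget_unique => [|w [Tw wE]]; first by split.
by apply: (tangent_ext Tw Tw0) => u Tu; rewrite wE // w0E.
Qed.

(** Two orthonormal bases of the tangent plane differ by an orthogonal matrix: the
determinant [d] of the second one satisfies [d ^ 2 = 1], and its second vector is
[d] times the first one turned by a right angle. *)
Lemma bilinear_metric_trace (b : vec -> vec -> vec) p b11 b12 b21 b22 :
  (forall v w, T p v -> T p w -> b v w = (ip v (E1 p) * ip w (E1 p)) *: b11
     + (ip v (E1 p) * ip w (E2 p)) *: b12 + (ip v (E2 p) * ip w (E1 p)) *: b21
     + (ip v (E2 p) * ip w (E2 p)) *: b22) ->
  metric_trace eps S phi p b = b11 + b22.
Proof.
move=> bE.
have bE11 : b (E1 p) (E1 p) = b11.
  by rewrite bE // ip11 ip12 !(mul0r, mulr0, mulr1, scale0r, scale1r, addr0).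
have bE22 : b (E2 p) (E2 p) = b22.
  by rewrite bE // ip22 (ipC _ (E2 p)) ip12 !(mul0r, mulr0, mulr1, scale0r, scale1r, addr0, add0r).
apply: xget_unique => [|t [v [w [Tv Tw [vv ww] vw ->]]]].
  by exists (E1 p), (E2 p); rewrite bE11 bE22; split => //; split.
rewrite !bE //.
move: vv ww vw; rewrite (ip_tangent v Tv) (ip_tangent w Tw) (ip_tangent w Tv).
move: (ip v (E1 p)) (ip v (E2 p)) (ip w (E1 p)) (ip w (E2 p)) => v1 v2 w1 w2 vv ww vw.
have d2 : (v1 * w2 - v2 * w1) ^+ 2 = 1.
  have -> : (v1 * w2 - v2 * w1) ^+ 2
    = (v1 * v1 + v2 * v2) * (w1 * w1 + w2 * w2) - (v1 * w1 + v2 * w2) ^+ 2 by ring.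
  by rewrite vv ww vw mulr1 expr0n subr0.
have w1E : w1 = - (v1 * w2 - v2 * w1) * v2.
  rewrite -[LHS]mul1r -vv.
  have -> : (v1 * v1 + v2 * v2) * w1 = v1 * (v1 * w1 + v2 * w2) - (v1 * w2 - v2 * w1) * v2 by ring.
  by rewrite vw mulr0 sub0r mulNr.
have w2E : w2 = (v1 * w2 - v2 * w1) * v1.
  rewrite -[LHS]mul1r -vv.
  have -> : (v1 * v1 + v2 * v2) * w2 = v2 * (v1 * w1 + v2 * w2) + (v1 * w2 - v2 * w1) * v1 by ring.
  by rewrite vw mulr0 add0r.
move: w1E w2E d2; set d := v1 * w2 - v2 * w1 => w1E w2E d2; clearbody d; subst w1 w2.
have -> : - d * v2 * (- d * v2) = v2 * v2 by rewrite -[RHS]mul1r -d2; ring.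
have -> : d * v1 * (d * v1) = v1 * v1 by rewrite -[RHS]mul1r -d2; ring.
have -> : - d * v2 * (d * v1) = - (v1 * v2) by rewrite -[v1 * v2]mul1r -d2; ring.
have -> : d * v1 * (- d * v2) = - (v2 * v1) by rewrite -[v2 * v1]mul1r -d2; ring.
have {}vv : v2 * v2 = 1 - v1 * v1 by move: vv; lra.
by rewrite vv; apply/rowP => i; rewrite !mxE; ring.
Qed.

Lemma metric_trace_II p :
  metric_trace eps S phi p (second_fundamental_form eps S phi p)
  = II p (E1 p) (E1 p) + II p (E2 p) (E2 p).
Proof.
apply: (bilinear_metric_trace (b12 := II p (E1 p) (E2 p)) (b21 := II p (E2 p) (E1 p))) => v w Tv Tw.
have nII u u' := second_fundamental_form_normal p u u'.
have regroup (a b c d : R) (u1 u2 u3 u4 : vec) : a *: u1 + b *: u2 + c *: u3 + d *: u4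
   = 1 *: (a *: u1 + b *: u2) + 1 *: (c *: u3 + d *: u4) by rewrite !scale1r addrA.
have ip4 (a b c d : R) (u1 u2 u3 u4 u : vec) : ip (a *: u1 + b *: u2 + c *: u3 + d *: u4) u
   = a * ip u1 u + b * ip u2 u + c * ip u3 u + d * ip u4 u by rewrite !ipDl !ipZl.
have expand2 (a b : R) (d1 d2 d : vec) : d = a *: d1 + b *: d2 ->
    - ip w d = a * ip w (E1 p) * - ip (E1 p) d1 + a * ip w (E2 p) * - ip (E2 p) d1
      + b * ip w (E1 p) * - ip (E1 p) d2 + b * ip w (E2 p) * - ip (E2 p) d2.
  move=> ->; rewrite (ip_tangent _ Tw) !ipDl !ipZl !(ipC _ _ (E1 p)) !(ipC _ _ (E2 p)).
  by move: (ip _ d1) (ip _ d1) (ip _ d2) (ip _ d2) => c1 c2 c3 c4; ring.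
have coef (N : M -> vec) : smooth_map S N ->
    (forall v w, T p v -> T p w -> ip (II p v w) (N p) = - ip w (D N p v)) ->
    ip (II p v w) (N p)
    = ip v (E1 p) * ip w (E1 p) * ip (II p (E1 p) (E1 p)) (N p)
    + ip v (E1 p) * ip w (E2 p) * ip (II p (E1 p) (E2 p)) (N p)
    + ip v (E2 p) * ip w (E1 p) * ip (II p (E2 p) (E1 p)) (N p)
    + ip v (E2 p) * ip w (E2 p) * ip (II p (E2 p) (E2 p)) (N p).
  move=> sN HN.
  have substitute (a b c d y z1 z2 z3 z4 y' z1' z2' z3' z4' : R) :
      y = y' -> z1 = z1' -> z2 = z2' -> z3 = z3' -> z4 = z4' ->
      y' = a * z1' + b * z2' + c * z3' + d * z4' -> y = a * z1 + b * z2 + c * z3 + d * z4.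
    by move=> -> -> -> -> ->.
  apply: (substitute _ _ _ _ _ _ _ _ _ _ _ _ _ _ (HN _ _ Tv Tw) (HN _ _ (tE1 p) (tE1 p))
    (HN _ _ (tE1 p) (tE2 p)) (HN _ _ (tE2 p) (tE1 p)) (HN _ _ (tE2 p) (tE2 p))).
  apply: expand2.
  by rewrite -(dirder_lin_map _ _ sN (tE1 p) (tE2 p)) -(tangent_expansion Tv).
apply: normal_ext; first exact: nII.
- by rewrite regroup; apply: normal_vec_lin; apply: normal_vec_lin.
- by rewrite ip4; apply: coef => //; apply: ip_II_E3.
- by rewrite ip4; apply: coef => //; apply: ip_II_E4.
Qed.

Section FrameInChart.
Variable x : chart R M.
Hypothesis ax : atlas S x.
Local Notation U := (cimg x).
Local Notation "F ^~x" := (F \o cinv x) (at level 2, format "F ^~x").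
Let oU : open U := @cimg_isopen x.

(** The field of the parameter plane that the chart maps to [E]. *)
Definition coord_vector (E : M -> vec) (z : 'rV[R]_2) : 'rV[R]_2 :=
  xget 0 [set h | 'D_h (phi \o cinv x) z = E (cinv x z)].

Lemma coord_vectorP E z : (forall p, T p (E p)) -> U z ->
  'D_(coord_vector E z) (phi \o cinv x) z = E (cinv x z).
Proof.
move=> TE Uz; have [h hE] := (tangent_vecP imm _ ax (cinv_cdom Uz)).1 (TE (cinv x z)).
have Ph : [set h | 'D_h (phi \o cinv x) z = E (cinv x z)] h.
  by rewrite /= hE /coord_field cinvK.
exact: (xgetI 0 Ph).
Qed.

Local Notation xi1 := (coord_vector E1).
Local Notation xi2 := (coord_vector E2).

Lemma dalong_phi E z : (forall p, T p (E p)) -> U z ->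
  dalong (coord_vector E) (phi \o cinv x) z = E (cinv x z).
Proof. by move=> TE Uz; rewrite dalongE; apply: coord_vectorP. Qed.

Lemma dirder_coord_vector (W : normedModType R) (F : M -> W) E z :
  (forall p, T p (E p)) -> U z -> smooth_on U (F \o cinv x) ->
  D F (cinv x z) (E (cinv x z)) = dalong (coord_vector E) (F \o cinv x) z.
Proof.
move=> TE Uz sF; have xp := cinv_cdom Uz.
have -> : E (cinv x z) = coord_field phi x (coord_vector E z) (cinv x z).
  by rewrite /coord_field cinvK // coord_vectorP.
by rewrite (dirder_chart ax _ xp sF) cinvK // dalongE.
Qed.

Lemma coord_vector_basis z h : U z ->
  h = ip ('D_h (phi \o cinv x) z) (E1 (cinv x z)) *: xi1 z
    + ip ('D_h (phi \o cinv x) z) (E2 (cinv x z)) *: xi2 z.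
Proof.
move=> Uz; have xp := cinv_cdom Uz.
apply: (coord_field_inj imm ax xp); rewrite (coord_field_lin imm _ _ (xi1 z) (xi2 z) ax xp).
rewrite /coord_field cinvK // !coord_vectorP //.
apply: tangent_expansion; apply/(tangent_vecP imm _ ax xp); exists h.
by rewrite /coord_field cinvK.
Qed.

(** The components of [xi1], [xi2] are given by Cramer's rule from the products of the
partial derivatives of [phi] with [E1] and [E2]. *)
Lemma coord_vectors_smooth : smooth_on U xi1 /\ smooth_on U xi2.
Proof.
have sphix : smooth_on U (phi \o cinv x) := sphi ax.
pose P (a : 'I_2) (E : M -> vec) z := ip ('D_(delta_mx 0 a) (phi \o cinv x) z) (E (cinv x z)).
have sP a E : smooth_map S E -> smooth_on U (P a E).
  by move=> sE; exact: (smooth_on_ip eps oU (smooth_on_derive _ sphix) (sE x ax)).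
pose det z := P 0 E1 z * P 1 E2 z - P 0 E2 z * P 1 E1 z.
have sdet : smooth_on U det.
  by apply: smooth_onB => //; apply: smooth_onM => //; apply: sP.
have eqs E E' z : (forall p, T p (E p)) -> U z -> ip (E (cinv x z)) (E' (cinv x z)) =
    coord_vector E z 0 0 * P 0 E' z + coord_vector E z 0 1 * P 1 E' z.
  move=> TE Uz; have dphi := smooth_on_differentiable sphix Uz.
  have decomposition := etrans (esym (coord_vectorP TE Uz)) (derive_plane (coord_vector E z) dphi).
  by rewrite {1}decomposition ipDl !ipZl.
have solve (a b c d p q r s : R) : a * p + b * r = 1 -> a * q + b * s = 0 ->
    c * p + d * r = 0 -> c * q + d * s = 1 ->
    [/\ p * s - q * r != 0, a = s / (p * s - q * r), b = - q / (p * s - q * r),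
        c = - r / (p * s - q * r) & d = p / (p * s - q * r)].
  move=> h1 h2 h3 h4.
  have D1 : (a * d - b * c) * (p * s - q * r) = 1.
    have -> : (a * d - b * c) * (p * s - q * r)
      = (a * p + b * r) * (c * q + d * s) - (a * q + b * s) * (c * p + d * r) by ring.
    by rewrite h1 h2 h3 h4 !mulr1 mul0r subr0.
  have Dn : p * s - q * r != 0.
    by apply/eqP => D0; move: D1; rewrite D0 mulr0 => /esym/eqP; rewrite oner_eq0.
  split=> //; apply: (mulIf Dn); rewrite divfK //.
  - rewrite -[RHS]mulr1 -h1 -[RHS]subr0 -[0](mulr0 r) -h2; ring.
  - rewrite -[RHS]mulr1 -h1 -[RHS]addr0 -[0](mulr0 p) -h2; ring.
  - rewrite -[RHS]mulr1 -h4 -[RHS]addr0 -[0](mulr0 s) -h3; ring.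
  - rewrite -[RHS]mulr1 -h4 -[RHS]subr0 -[0](mulr0 q) -h3; ring.
have sol z : U z -> [/\ det z != 0,
    xi1 z 0 0 = P 1 E2 z / det z, xi1 z 0 1 = - P 0 E2 z / det z,
    xi2 z 0 0 = - P 1 E1 z / det z & xi2 z 0 1 = P 0 E1 z / det z].
  move=> Uz; apply: solve; rewrite -eqs //.
  by rewrite ipC.
have det0 z : U z -> det z != 0 by move=> /sol[].
have two (i : 'I_2) : i = 0 \/ i = 1.
  by case: i => -[|[|//]] ?; [left | right]; apply/val_inj.
have sN a E : smooth_map S E -> smooth_on U (fun z => - P a E z).
  by move=> sE; apply: smooth_onN => //; apply: sP.
split; apply: smooth_on_rV => // i; have [->|->] := two i.
- apply: (smooth_on_ext oU _ (smooth_on_div oU (sP 1 _ sE2) sdet det0)) => z /sol[_ -> //].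
- apply: (smooth_on_ext oU _ (smooth_on_div oU (sN 0 _ sE2) sdet det0)) => z /sol[_ _ -> //].
- apply: (smooth_on_ext oU _ (smooth_on_div oU (sN 1 _ sE1) sdet det0)) => z /sol[_ _ _ -> //].
- apply: (smooth_on_ext oU _ (smooth_on_div oU (sP 0 _ sE1) sdet det0)) => z /sol[_ _ _ _ -> //].
Qed.
End FrameInChart.
End AdaptedFrames.

Local Opaque second_fundamental_form dirder.

(** * The adapted frame read in a chart *)

Section TraceArithmetic.
Context {R : realFieldType}.

Lemma trace_component (t a b c d g m1 m2 m3 m4 n1 n2 n3 n4 : R) : 2 * t + g = 0 ->
  t = - (a * m1 + b * m2) - (c * m3 + d * m4) -> m1 = n1 -> m2 = n2 -> m3 = n3 -> m4 = n4 ->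
  2 * (a * n1 + b * n2 + (c * n3 + d * n4)) = g.
Proof. by move=> E tE <- <- <- <-; move: E; rewrite tE; lra. Qed.

Lemma biconservative_components (f f1 f2 k1 k2 al b1 b2 : R) :
  2 * (f1 * - k1 + - (f * - b1) * - al + (f2 * 0 + - (f * - b2) * - 0)) = 2 * (f * f1) ->
  2 * (f1 * 0 + - (f * - b1) * - 0 + (f2 * - k2 + - (f * - b2) * al)) = 2 * (f * f2) ->
  f1 * (k1 + f) = - (f * b1 * al) /\ f2 * (k2 + f) = f * b2 * al.
Proof. by move=> R1 R2; split; lra. Qed.
End TraceArithmetic.

Section LocalData.
Context {R : realType} (eps : R) {M : topologicalType} (S : surface R M)
        (phi : M -> 'rV[R]_5) (E1 E2 E3 E4 : M -> 'rV[R]_5).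
Local Notation vec := 'rV[R]_5.
Local Notation plane := 'rV[R]_2.
Local Notation ip := (ambient_ip eps).
Local Notation T p := (tangent_vec S phi p).
Local Notation n p := (space_form_normal eps (phi p)).
Local Notation f p := (mean_curvature eps S phi p).
Local Notation H p := (mean_curvature_vector eps S phi p).
Local Notation D F p v := (dirder S phi F p v).
Local Notation II p v w := (second_fundamental_form eps S phi p v w).
Hypothesis imm : isometric_immersion eps S phi.
Hypothesis frame : adapted_frame eps S phi E1 E2 E3 E4.
Hypothesis H_neq0 : forall p, mean_curvature_vector eps S phi p <> 0.

Let sphi : smooth_map S phi. Proof. by case: imm. Qed.
Let sE1 : smooth_map S E1. Proof. by case: frame => -[[]]. Qed.
Let sE2 : smooth_map S E2. Proof. by case: frame => -[_ []]. Qed.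
Let sE3 : smooth_map S E3. Proof. by case: frame => -[_ _ []]. Qed.
Let sE4 : smooth_map S E4. Proof. by case: frame => -[_ _ _ []]. Qed.
Let tE1 p : T p (E1 p). Proof. by case: frame => -[[]]. Qed.
Let tE2 p : T p (E2 p). Proof. by case: frame => -[_ []]. Qed.
Let nE3 p : normal_vec eps S phi p (E3 p). Proof. by case: frame => -[_ _ []]. Qed.
Let nE4 p : normal_vec eps S phi p (E4 p). Proof. by case: frame => -[_ _ _ []]. Qed.
Let ip11 p : ip (E1 p) (E1 p) = 1. Proof. by case: frame => _ _ _ /(_ p) []. Qed.
Let ip22 p : ip (E2 p) (E2 p) = 1. Proof. by case: frame => _ _ _ /(_ p) []. Qed.
Let ip12 p : ip (E1 p) (E2 p) = 0. Proof. by case: frame => _ _ _ /(_ p) []. Qed.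
Let ip44 p : ip (E4 p) (E4 p) = 1. Proof. by case: frame => _ _ /(_ p) []. Qed.
Let ip34 p : ip (E3 p) (E4 p) = 0. Proof. by case: frame => _ _ /(_ p) []. Qed.
Let ip33 p := ip33 imm frame H_neq0 p.

Lemma shape_operator_E3 p v : T p v ->
  shape_operator eps S phi p (E3 p) v = - tan_part eps S phi p (D E3 p v).
Proof.
move=> Tv; have := shape_operatorE imm frame 1 0 Tv.
by rewrite !scale1r !scale0r !addr0.
Qed.

Lemma shape_operator_E4 p v : T p v ->
  shape_operator eps S phi p (E4 p) v = - tan_part eps S phi p (D E4 p v).
Proof.
move=> Tv; have := shape_operatorE imm frame 0 1 Tv.
by rewrite !scale1r !scale0r !add0r.
Qed.

Lemma ip_shape_E3 p v u : T p v -> T p u ->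
  ip (shape_operator eps S phi p (E3 p) v) u = - ip (D E3 p v) u.
Proof. by move=> Tv Tu; rewrite shape_operator_E3 // ipNl (ip_tan_part imm frame _ Tu). Qed.

Lemma ip_shape_E4 p v u : T p v -> T p u ->
  ip (shape_operator eps S phi p (E4 p) v) u = - ip (D E4 p v) u.
Proof. by move=> Tv Tu; rewrite shape_operator_E4 // ipNl (ip_tan_part imm frame _ Tu). Qed.

Lemma E3_diagonal p : ip (D E3 p (E1 p)) (E2 p) = 0.
Proof.
case: frame => _ _ _ _ /(_ p)[h1 _].
have := ip_shape_E3 (tE1 p) (tE2 p); rewrite h1 ipZl ip12 mulr0 => /esym/eqP.
by rewrite oppr_eq0 => /eqP.
Qed.

Lemma mean_curvature_trace p :
  f p = - 2^-1 * (ip (D E3 p (E1 p)) (E1 p) + ip (D E3 p (E2 p)) (E2 p)).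
Proof.
have : ip (H p) (E3 p) = f p by rewrite (H_E3 imm frame H_neq0) ipZl ip33 mulr1.
move=> <-; rewrite {1}/mean_curvature_vector (metric_trace_II imm frame H_neq0) ipZl ipDl.
rewrite (ip_II_E3 imm frame (tE1 p) (tE1 p)) (ip_II_E3 imm frame (tE2 p) (tE2 p)).
rewrite (ipC _ (E1 p) (D E3 p (E1 p))) (ipC _ (E2 p) (D E3 p (E2 p))).
by rewrite -opprD mulrN mulNr.
Qed.

(** [H] is a multiple of [E3], so the trace of [A_4] vanishes. *)
Lemma A4_traceless p : ip (D E4 p (E2 p)) (E2 p) = - ip (D E4 p (E1 p)) (E1 p).
Proof.
have : ip (H p) (E4 p) = 0 by rewrite (H_E3 imm frame H_neq0) ipZl ip34 mulr0.
rewrite {1}/mean_curvature_vector (metric_trace_II imm frame H_neq0) ipZl ipDl.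
rewrite (ip_II_E4 imm frame (tE1 p) (tE1 p)) (ip_II_E4 imm frame (tE2 p) (tE2 p)).
rewrite (ipC _ (E1 p) (D E4 p (E1 p))) (ipC _ (E2 p) (D E4 p (E2 p))).
move: (ip _ _) (ip _ _) => a b; lra.
Qed.

Section Chart.
Variable x : chart R M.
Hypothesis ax : atlas S x.
Local Notation U := (cimg x).
Let oU : open U := @cimg_isopen _ _ x.
Local Notation xi1 := (coord_vector phi x E1).
Local Notation xi2 := (coord_vector phi x E2).
Local Notation e1 := (E1 \o cinv x).
Local Notation e2 := (E2 \o cinv x).
Local Notation e3 := (E3 \o cinv x).
Local Notation e4 := (E4 \o cinv x).

Lemma chart_moving_frame : moving_frame eps U (phi \o cinv x) e1 e2 e3 e4 xi1 xi2.
Proof.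
have [sxi1 sxi2] := coord_vectors_smooth imm frame ax.
have tn E : smooth_map S E -> (forall p, ip (E p) (n p) = 0) ->
    tangent_to_N eps U (phi \o cinv x) (E \o cinv x).
  by move=> sE En; split=> [|z Uz]; [exact: sE ax | exact: En].
have n3 p : ip (E3 p) (n p) = 0 by have [] := (normal_vecP imm p (E3 p)).1 (nE3 p).
have n4 p : ip (E4 p) (n p) = 0 by have [] := (normal_vecP imm p (E4 p)).1 (nE4 p).
have t3 p u (Tu : T p u) : ip u (E3 p) = 0 := ip_tangent_E3 imm frame Tu.
have t4 p u (Tu : T p u) : ip u (E4 p) = 0 := ip_tangent_E4 imm frame Tu.
split; [exact: oU | exact: sphi ax | exact: sxi1 | exact: sxi2 | | | | | |].
- by move=> z _; have [_ N _] := imm; exact: N.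
- split; apply: tn => //; by move=> p; apply: (tangent_normal imm).
- move=> z _; split; [exact: ip11 | exact: ip22 | exact: ip33 | exact: ip44].
- move=> z _; split; split; [exact: ip12 | exact: t3 | exact: t4 | exact: t3 | exact: t4 | exact: ip34].
- move=> z Uz; split; exact: (dalong_phi imm ax _ Uz).
- move=> z h Uz; exact: (coord_vector_basis imm frame ax).
Qed.
Let mf := chart_moving_frame.

Local Notation D1 := (dalong xi1).
Local Notation D2 := (dalong xi2).
Local Notation a1 := (conn1 eps e1 e2 xi1).
Local Notation K1 := (coef_k1 eps e1 e3 xi1).
Local Notation K2 := (coef_k2 eps e2 e3 xi2).
Local Notation Al := (coef_al eps e1 e4 xi1).
Local Notation Be := (coef_be eps e2 e4 xi1).
Local Notation B1 := (coef_b1 eps e3 e4 xi1).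
Local Notation B2 := (coef_b2 eps e3 e4 xi2).

Let N1 : tangent_to_N eps U (phi \o cinv x) e1. Proof. by have [] := mf_tangent mf. Qed.
Let N2 : tangent_to_N eps U (phi \o cinv x) e2. Proof. by have [] := mf_tangent mf. Qed.
Let N3 : tangent_to_N eps U (phi \o cinv x) e3. Proof. by have [] := mf_tangent mf. Qed.
Let N4 : tangent_to_N eps U (phi \o cinv x) e4. Proof. by have [] := mf_tangent mf. Qed.

Lemma along_E1 (F : M -> vec) z : U z -> smooth_map S F ->
  D F (cinv x z) (E1 (cinv x z)) = D1 (F \o cinv x) z.
Proof. by move=> Uz sF; apply: (dirder_coord_vector imm ax) => //; exact: sF ax. Qed.

Lemma along_E2 (F : M -> vec) z : U z -> smooth_map S F ->
  D F (cinv x z) (E2 (cinv x z)) = D2 (F \o cinv x) z.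
Proof. by move=> Uz sF; apply: (dirder_coord_vector imm ax) => //; exact: sF ax. Qed.

Let e13 y : U y -> ip (e1 y) (e3 y) = 0. Proof. by move=> /(mf_orth mf)[[]]. Qed.
Let e14 y : U y -> ip (e1 y) (e4 y) = 0. Proof. by move=> /(mf_orth mf)[[]]. Qed.
Let e23 y : U y -> ip (e2 y) (e3 y) = 0. Proof. by move=> /(mf_orth mf)[_ []]. Qed.
Let e24 y : U y -> ip (e2 y) (e4 y) = 0. Proof. by move=> /(mf_orth mf)[_ []]. Qed.

Lemma A3_offdiagonal z : U z -> ip (D1 e2 z) (e3 z) = 0.
Proof.
move=> Uz; rewrite (dalong_skew mf xi1 e23 N2 N3 Uz) -(along_E1 Uz sE3).
by rewrite /= E3_diagonal oppr0.
Qed.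

Lemma A4_trace z : U z -> ip (D2 e2 z) (e4 z) = - ip (D1 e1 z) (e4 z).
Proof.
move=> Uz; rewrite (dalong_skew mf xi2 e24 N2 N4 Uz) (dalong_skew mf xi1 e14 N1 N4 Uz).
by rewrite -(along_E1 Uz sE4) -(along_E2 Uz sE4) /= A4_traceless.
Qed.

Lemma k1_chart z : U z -> k1 eps S phi E1 E3 (cinv x z) = K1 z.
Proof.
move=> Uz; rewrite /k1 /shape_coef ip_shape_E3 // (along_E1 Uz sE3).
by rewrite /coef_k1 (dalong_skew mf xi1 e13 N1 N3 Uz).
Qed.

Lemma k2_chart z : U z -> k2 eps S phi E2 E3 (cinv x z) = K2 z.
Proof.
move=> Uz; rewrite /k2 /shape_coef ip_shape_E3 // (along_E2 Uz sE3).
by rewrite /coef_k2 (dalong_skew mf xi2 e23 N2 N3 Uz).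
Qed.

Lemma alpha_chart z : U z -> alpha eps S phi E1 E4 (cinv x z) = Al z.
Proof.
move=> Uz; rewrite /alpha /shape_coef ip_shape_E4 // (along_E1 Uz sE4).
by rewrite /coef_al (dalong_skew mf xi1 e14 N1 N4 Uz).
Qed.

Lemma a2_chart z : U z -> a2 eps S phi E1 E2 (cinv x z) = conn2 eps e1 e2 xi2 z.
Proof. by move=> Uz; rewrite /a2 /nabla (ip_tan_part imm frame _ (tE1 _)) (along_E2 Uz sE2). Qed.

Lemma b1_chart z : U z -> b1 eps S phi E1 E3 E4 (cinv x z) = B1 z.
Proof. by move=> Uz; rewrite /b1 /nabla_perp (ip_nor_part imm frame _ (nE4 _)) (along_E1 Uz sE3). Qed.

Lemma mean_curvature_chart z : U z -> f (cinv x z) = 2^-1 * (K1 z + K2 z).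
Proof.
move=> Uz; rewrite mean_curvature_trace (along_E1 Uz sE3) (along_E2 Uz sE3).
rewrite /coef_k1 /coef_k2 (dalong_skew mf xi1 e13 N1 N3 Uz) (dalong_skew mf xi2 e23 N2 N3 Uz) /=.
move: (ip _ _) (ip _ _) => a b; lra.
Qed.

Lemma smooth_coefs : [/\ smooth_on U a1, smooth_on U (conn2 eps e1 e2 xi2) & smooth_on U Be] /\
  [/\ smooth_on U K1, smooth_on U K2, smooth_on U Al, smooth_on U B1 & smooth_on U B2].
Proof.
have s F G xi : smooth_on U xi -> smooth_on U F -> smooth_on U G ->
    smooth_on U (fun z => ip (dalong xi F z) (G z)).
  by move=> sxi sF sG; exact: (smooth_on_ip eps oU (smooth_on_dalong_rV oU sxi sF) sG).
have [sxi1 sxi2] := (mf_xi1 mf, mf_xi2 mf).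
have [[s1 s2] [s3 s4]] := ((N1.1, N2.1), (N3.1, N4.1)).
by split; split; apply: s.
Qed.

Lemma mean_curvature_smooth : smooth_on U ((fun p => f p) \o cinv x).
Proof.
have [_ [sK1 sK2 _ _ _]] := smooth_coefs.
apply: (smooth_on_ext oU _ (smooth_onZ oU 2^-1 (smooth_onD oU sK1 sK2))) => z Uz.
by rewrite /= mean_curvature_chart.
Qed.

Local Notation fz := ((fun p => f p) \o cinv x).

Lemma along_E1_f z : U z -> D (fun p => f p) (cinv x z) (E1 (cinv x z)) = D1 fz z.
Proof. by move=> Uz; apply: (dirder_coord_vector imm ax) => //; exact: mean_curvature_smooth. Qed.

Lemma nabla_perp_E3 E q : (forall p, T p (E p)) ->
  nabla_perp eps S phi q (E q) E3 = ip (D E3 q (E q)) (E4 q) *: E4 q.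
Proof.
move=> TE; have nN : normal_vec eps S phi q (nabla_perp eps S phi q (E q) E3).
  exact: (nor_part_normal imm frame).
have [y ay yq] := exists_chart S q.
have oY := @cimg_isopen _ _ y.
have zero : ip (D E3 q (E q)) (E3 q) = 0.
  have := dirder_ip imm ay yq (TE q) (sE3 ay) (sE3 ay).
  rewrite (dirder_local imm ay (F := fun q => ip (E3 q) (E3 q)) (G := fun _ => 1 : R) yq (TE q) (fun q _ => ip33 q)); last first.
    exact: (smooth_on_ip eps oY (sE3 ay) (sE3 ay)).
  by rewrite (dirder_cst imm ay _ yq (TE q)) (ipC _ (E3 q)); move: (ip _ _) => a; lra.
have c3 : ip (nabla_perp eps S phi q (E q) E3) (E3 q) = 0.
  exact: etrans (ip_nor_part imm frame _ (nE3 q)) zero.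
have c4 : ip (nabla_perp eps S phi q (E q) E3) (E4 q) = ip (D E3 q (E q)) (E4 q).
  exact: (ip_nor_part imm frame _ (nE4 q)).
rewrite {1}(normal_expansion imm frame H_neq0 nN).
by rewrite c3 c4 scale0r add0r.
Qed.

Lemma normal_multiple_derivative (G : M -> vec) (g : plane -> R) E z :
  smooth_on U g -> (forall y, U y -> G (cinv x y) = g y *: e4 y) ->
  (forall p, T p (E p)) -> U z ->
  ip (D G (cinv x z) (E (cinv x z))) (E4 (cinv x z)) = dalong (coord_vector phi x E) g z.
Proof.
move=> sg GE TE Uz; set xi := coord_vector phi x E.
have s4 := N4.1.
have sG : smooth_on U (G \o cinv x).
  apply: smooth_on_rV => // i.
  apply: (smooth_on_ext oU _ (smooth_onM oU sg (smooth_on_coord oU i s4))) => y Uy.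
  by rewrite /= GE // mxE.
rewrite (dirder_coord_vector imm ax TE Uz sG).
have E0 := dalong_ip eps oU xi sG s4 Uz.
have E1' : dalong xi (fun y => ip ((G \o cinv x) y) (e4 y)) z = dalong xi g z.
  by apply: (dalong_ext oU) => // y Uy; rewrite /= GE // ipZl ip44 mulr1.
have E2' : ip ((G \o cinv x) z) (dalong xi e4 z) = 0.
  have -> : (G \o cinv x) z = g z *: e4 z by exact: GE.
  by rewrite ipZl ipC (dalong_skew0 mf xi (c := 1) _ N4 Uz) ?mulr0 // => y _; exact: ip44.
by move: E0; rewrite E1' E2' addr0 => ->.
Qed.

(** The [E4]-component of [R(E1, E2) E3 = 0] for the normal connection, in which the
derivatives of [E3] along [E1] and [E2] are [b1 E4] and [b2 E4]. *)
Lemma flat_ricci z : flat_normal_bundle eps S phi -> U z ->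
  D1 B2 z - D2 B1 z = a1 z * B1 z + conn2 eps e1 e2 xi2 z * B2 z.
Proof.
move=> flat Uz; set p := cinv x z.
have [_ [_ _ _ sB1 sB2]] := smooth_coefs.
have TE1 : tangent_field S phi E1 by case: frame => -[].
have TE2 : tangent_field S phi E2 by case: frame => -[].
have NE3 : normal_field eps S phi E3 by case: frame => -[].
have distribute (u v w e : vec) : u - v - w = 0 -> ip u e = ip v e + ip w e.
  by move=> /eqP; rewrite -addrA -opprD subr_eq0 => /eqP ->; rewrite ipDl.
have E := distribute _ _ _ (E4 p) (flat E1 E2 E3 TE1 TE2 NE3 p).
have P1 : ip (nabla_perp eps S phi p (E1 p) (fun q => nabla_perp eps S phi q (E2 q) E3)) (E4 p)
    = D1 B2 z.
  apply: etrans (ip_nor_part imm frame _ (nE4 p)) _.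
  apply: (normal_multiple_derivative sB2 _ tE1 Uz) => y Uy.
  by rewrite (nabla_perp_E3 _ tE2) (along_E2 Uy sE3).
have P2 : ip (nabla_perp eps S phi p (E2 p) (fun q => nabla_perp eps S phi q (E1 q) E3)) (E4 p)
    = D2 B1 z.
  apply: etrans (ip_nor_part imm frame _ (nE4 p)) _.
  apply: (normal_multiple_derivative sB1 _ tE2 Uz) => y Uy.
  by rewrite (nabla_perp_E3 _ tE1) (along_E1 Uy sE3).
have P3 : ip (nabla_perp eps S phi p (bracket S phi E1 E2 p) E3) (E4 p)
    = a1 z * B1 z + conn2 eps e1 e2 xi2 z * B2 z.
  have -> : bracket S phi E1 E2 p = a1 z *: E1 p + conn2 eps e1 e2 xi2 z *: E2 p.
    rewrite /bracket (along_E1 Uz sE2) (along_E2 Uz sE1).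
    exact: (frame_bracket_tangent mf Uz).
  apply: etrans (ip_nor_part imm frame _ (nE4 p)) _.
  rewrite (dirder_lin_map imm _ _ sE3 (tE1 p) (tE2 p)) ipDl !ipZl.
  by rewrite (along_E1 Uz sE3) (along_E2 Uz sE3).
by move: (etrans (esym P1) (etrans E (f_equal2 +%R P2 P3))) => ->; rewrite addrC addKr.
Qed.

Lemma k1_neq_k2 z : (forall p, ~ (forall v, T p v ->
     shape_operator eps S phi p (unit_mean_curvature eps S phi p) v = f p *: v)) ->
  U z -> K1 z <> K2 z.
Proof.
move=> umb Uz K12; apply: (umb (cinv x z)) => v Tv; set p := cinv x z.
have fK : f p = K1 z by rewrite mean_curvature_chart // -K12; lra.
have -> : unit_mean_curvature eps S phi p = E3 p by rewrite (E3_def frame).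
case: frame => _ _ _ _ /(_ p)[h1 h2].
have lin : shape_operator eps S phi p (E3 p) v = ip v (E1 p) *: shape_operator eps S phi p (E3 p) (E1 p)
   + ip v (E2 p) *: shape_operator eps S phi p (E3 p) (E2 p).
  rewrite !shape_operator_E3 // {1}(tangent_expansion imm frame Tv).
  rewrite (dirder_lin_map imm _ _ sE3 (tE1 p) (tE2 p)) !(tan_partE imm frame) !ipDl !ipZl.
  by apply/rowP => i; rewrite !mxE; ring.
rewrite lin h1 h2 (k1_chart Uz) (k2_chart Uz) -K12 -fK.
by rewrite [in RHS](tangent_expansion imm frame Tv) scalerDr !scalerA ![f p * _]mulrC.
Qed.

(** For a flat normal bundle the Ricci equation reads [(k2 - k1) be = 0]. *)
Lemma A4_offdiagonal z : flat_normal_bundle eps S phi ->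
  (forall p, ~ (forall v, T p v ->
     shape_operator eps S phi p (unit_mean_curvature eps S phi p) v = f p *: v)) ->
  U z -> Be z = 0.
Proof.
move=> flat umb Uz.
have := ricci_equation mf A3_offdiagonal A4_trace Uz; rewrite flat_ricci // => E.
have : (K2 z - K1 z) * Be z = 0.
  have cancel (a c d e : R) : d + e = a + d + e -> a = 0 by move=> h; lra.
  exact: cancel E.
move=> /eqP; rewrite mulf_eq0 subr_eq0 => /orP[/eqP K12|/eqP //].
by case: (k1_neq_k2 umb Uz).
Qed.

Lemma gradient_chart z : U z ->
  ip (gradient eps S phi (fun q => f q ^+ 2) (cinv x z)) (E1 (cinv x z)) = 2 * (fz z * D1 fz z) /\
  ip (gradient eps S phi (fun q => f q ^+ 2) (cinv x z)) (E2 (cinv x z)) = 2 * (fz z * D2 fz z).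
Proof.
move=> Uz; set p := cinv x z; have sf := mean_curvature_smooth.
have sF : smooth_on U ((fun q => f q ^+ 2) \o cinv x) := smooth_onX oU 2 sf.
have xp : cdom x p := cinv_cdom Uz.
pose w0 := D (fun q => f q ^+ 2) p (E1 p) *: E1 p + D (fun q => f q ^+ 2) p (E2 p) *: E2 p.
have Tw0 : T p w0 by exact: (tangent_lin imm _ _ (tE1 p) (tE2 p)).
have grad_w0 : T p w0 /\ forall u, T p u -> ip w0 u = D (fun q => f q ^+ 2) p u.
  split=> // u Tu; rewrite {2}(tangent_expansion imm frame Tu).
  rewrite (dirder_linear imm ax _ _ xp (tE1 p) (tE2 p) sF) /w0 ipDl !ipZl.
  by rewrite !(ipC _ _ u) !/(_ *: _) /= (mulrC (ip u (E1 p))) (mulrC (ip u (E2 p))).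
have [Tg gE] : T p (gradient eps S phi (fun q => f q ^+ 2) p) /\ forall u, T p u ->
    ip (gradient eps S phi (fun q => f q ^+ 2) p) u = D (fun q => f q ^+ 2) p u.
  exact: (xgetI 0 (grad_w0 : [set w | T p w /\ forall u, T p u ->
    ip w u = D (fun q => f q ^+ 2) p u] w0)).
have DX E : (forall p, T p (E p)) -> D (fun q => f q ^+ 2) p (E p)
    = 2 * (fz z * dalong (coord_vector phi x E) fz z).
  move=> TE; rewrite (dirder_coord_vector imm ax TE Uz sF).
  rewrite (dalong_ext oU _ (G := fun y => fz y * fz y) (fun y _ => expr2 (fz y)) Uz).
  by rewrite (dalongM _ sf sf Uz); ring.
by split; rewrite gE //; exact: DX.
Qed.

Lemma mean_curvature_vector_smooth : smooth_on U ((fun p => H p) \o cinv x).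
Proof.
apply: smooth_on_rV => // i.
apply: (smooth_on_ext oU _ (smooth_onM oU mean_curvature_smooth (smooth_on_coord oU i N3.1))) => y Uy.
by rewrite /= (H_E3 imm frame H_neq0) mxE.
Qed.

Lemma nabla_perp_H_coefs E z : (forall p, T p (E p)) -> U z ->
  ip (D (fun p => H p) (cinv x z) (E (cinv x z))) (E3 (cinv x z))
    = dalong (coord_vector phi x E) fz z /\
  ip (D (fun p => H p) (cinv x z) (E (cinv x z))) (E4 (cinv x z))
    = - (fz z * ip (dalong (coord_vector phi x E) e4 z) (e3 z)).
Proof.
move=> TE Uz; set xi := coord_vector phi x E; have sH := mean_curvature_vector_smooth.
rewrite (dirder_coord_vector imm ax TE Uz sH).
have HE y : H (cinv x y) = fz y *: e3 y by rewrite (H_E3 imm frame H_neq0).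
have ext3 : dalong xi (fun y => ip (((fun p => H p) \o cinv x) y) (e3 y)) z = dalong xi fz z.
  by apply: (dalong_ext oU) => // y Uy; rewrite /= HE ipZl ip33 mulr1.
have ext4 : dalong xi (fun y => ip (((fun p => H p) \o cinv x) y) (e4 y)) z = 0.
  rewrite (dalong_ext oU xi (G := fun _ => 0) _ Uz) ?dalong_cst // => y Uy.
  by rewrite /= HE ipZl ip34 mulr0.
have r3 := dalong_ip eps oU xi sH N3.1 Uz; have r4 := dalong_ip eps oU xi sH N4.1 Uz.
have z3 : ip (H (cinv x z)) (dalong xi e3 z) = 0.
  by rewrite HE ipZl ipC (dalong_skew0 mf xi (c := 1) _ N3 Uz) ?mulr0 // => y _; exact: ip33.
have z4 : ip (H (cinv x z)) (dalong xi e4 z) = fz z * ip (dalong xi e4 z) (e3 z).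
  by rewrite HE ipZl ipC.
split; first by move: r3; rewrite ext3 /= z3 addr0 => ->.
by move: r4; rewrite ext4 /= z4 => /esym/eqP; rewrite addr_eq0 => /eqP.
Qed.

(** The shape operator in the direction [<D_v H, E3> E3 + <D_v H, E4> E4] is bilinear
in [v] and [w], so its trace can be taken over [E1], [E2]. *)
Lemma biconservative_trace z : U z ->
  let b v w := shape_operator eps S phi (cinv x z) (nabla_perp eps S phi (cinv x z) v (fun p => H p)) w in
  let c3 E := ip (D (fun p => H p) (cinv x z) (E (cinv x z))) (E3 (cinv x z)) in
  let c4 E := ip (D (fun p => H p) (cinv x z) (E (cinv x z))) (E4 (cinv x z)) in
  forall u, T (cinv x z) u ->
  ip (metric_trace eps S phi (cinv x z) b) u =
    - (c3 E1 * ip (D1 e3 z) u + c4 E1 * ip (D1 e4 z) u)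
    - (c3 E2 * ip (D2 e3 z) u + c4 E2 * ip (D2 e4 z) u).
Proof.
move=> Uz b c3 c4 u Tu; set p := cinv x z in b c3 c4 Tu *.
have xp : cdom x p := cinv_cdom Uz.
pose t N w := tan_part eps S phi p (D N p w).
have bE v w : T p v -> T p w -> b v w =
    - (ip (D (fun p => H p) p v) (E3 p) *: t E3 w + ip (D (fun p => H p) p v) (E4 p) *: t E4 w).
  move=> Tv Tw; rewrite /b.
  have nN : normal_vec eps S phi p (nabla_perp eps S phi p v (fun p => H p)).
    exact: (nor_part_normal imm frame).
  rewrite (normal_expansion imm frame H_neq0 nN) (shape_operatorE imm frame) //.
  by rewrite /nabla_perp (ip_nor_part imm frame _ (nE3 p)) (ip_nor_part imm frame _ (nE4 p)).
have tlin N w : smooth_map S N -> T p w ->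
    t N w = ip w (E1 p) *: t N (E1 p) + ip w (E2 p) *: t N (E2 p).
  move=> sN Tw; rewrite /t {1}(tangent_expansion imm frame Tw).
  rewrite (dirder_lin_map imm _ _ sN (tE1 p) (tE2 p)) !(tan_partE imm frame) !ipDl !ipZl.
  by apply/rowP => i; rewrite !mxE; ring.
have Hlin v : T p v -> D (fun p => H p) p v =
    ip v (E1 p) *: D (fun p => H p) p (E1 p) + ip v (E2 p) *: D (fun p => H p) p (E2 p).
  move=> Tv; rewrite {1}(tangent_expansion imm frame Tv).
  exact: (dirder_linear imm ax _ _ xp (tE1 p) (tE2 p) mean_curvature_vector_smooth).
rewrite (bilinear_metric_trace imm frame (b11 := b (E1 p) (E1 p)) (b12 := b (E1 p) (E2 p))
  (b21 := b (E2 p) (E1 p)) (b22 := b (E2 p) (E2 p))); last first.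
  have expand (v1 v2 w1 w2 c31 c32 c41 c42 : R) (t31 t32 t41 t42 : vec) :
      - ((v1 * c31 + v2 * c32) *: (w1 *: t31 + w2 *: t32)
         + (v1 * c41 + v2 * c42) *: (w1 *: t41 + w2 *: t42)) =
      (v1 * w1) *: - (c31 *: t31 + c41 *: t41) + (v1 * w2) *: - (c31 *: t32 + c41 *: t42)
    + (v2 * w1) *: - (c32 *: t31 + c42 *: t41) + (v2 * w2) *: - (c32 *: t32 + c42 *: t42).
    by apply/rowP => i; rewrite !mxE; ring.
  move=> v w Tv Tw; rewrite (bE _ _ Tv Tw) (bE _ _ (tE1 p) (tE1 p)) (bE _ _ (tE1 p) (tE2 p)).
  rewrite (bE _ _ (tE2 p) (tE1 p)) (bE _ _ (tE2 p) (tE2 p)) (tlin _ _ sE3 Tw) (tlin _ _ sE4 Tw).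
  by rewrite (Hlin v Tv) !ipDl !ipZl; exact: expand.
have ipt N q : ip (t N q) u = ip (D N p q) u by exact: (ip_tan_part imm frame _ Tu).
have ipsum (a1 a2 a3 a4 : R) (t1 t2 t3 t4 : vec) :
    ip (- (a1 *: t1 + a2 *: t2) + - (a3 *: t3 + a4 *: t4)) u
    = - (a1 * ip t1 u + a2 * ip t2 u) - (a3 * ip t3 u + a4 * ip t4 u).
  by rewrite ipDl !ipNl !ipDl !ipZl.
apply: etrans (congr1 (ip^~ u) (f_equal2 +%R (bE _ _ (tE1 p) (tE1 p)) (bE _ _ (tE2 p) (tE2 p)))) _.
apply: etrans (ipsum _ _ _ _ _ _ _ _) _.
congr (- (_ * _ + _ * _) - (_ * _ + _ * _)); apply: etrans (ipt _ _) _; congr (ip _ u).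
- exact: along_E1 Uz sE3.
- exact: along_E1 Uz sE4.
- exact: along_E2 Uz sE3.
- exact: along_E2 Uz sE4.
Qed.

(** The two components of the biconservative equation, with [H = f E3] and the
derivatives of [E3], [E4] inserted. *)
Lemma biconservative_chart z : biconservative eps S phi ->
  (forall z, U z -> Be z = 0) -> U z ->
  D1 fz z * (K1 z + fz z) = - (fz z * B1 z * Al z) /\
  D2 fz z * (K2 z + fz z) = fz z * B2 z * Al z.
Proof.
move=> bic be0 Uz.
have [_ _ [S31 S32 S33 S34] [S41 S42 S43 S44]] := connection_along_e1 mf A3_offdiagonal Uz.
have [_ _ [T31 T32 T33 T34] [T41 T42 T43 T44]] := connection_along_e2 mf A3_offdiagonal A4_trace Uz.
have [c31 c41] := nabla_perp_H_coefs tE1 Uz; have [c32 c42] := nabla_perp_H_coefs tE2 Uz.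
have [g1 g2] := gradient_chart Uz.
have distribute (u v e : vec) : 2 *: u + v = 0 -> 2 * ip u e + ip v e = 0.
  by move=> h; rewrite -ipZl -ipDl h ip0l.
have b1' := distribute _ _ (E1 (cinv x z)) (bic (cinv x z)).
have b2' := distribute _ _ (E2 (cinv x z)) (bic (cinv x z)).
have tr1 := biconservative_trace Uz (tE1 (cinv x z)).
have tr2 := biconservative_trace Uz (tE2 (cinv x z)).
rewrite S43 in c41; rewrite T43 in c42.
have Be0 := be0 z Uz.
have R1 := trace_component b1' tr1 S31 S41 T31 T41.
have R2 := trace_component b2' tr2 S32 S42 T32 T42.
rewrite c31 c41 c32 c42 g1 Be0 in R1; rewrite c31 c41 c32 c42 g2 Be0 in R2.
exact: biconservative_components R1 R2.
Qed.
End Chart.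
End LocalData.

(** * The Gauss curvature *)

Section GaussArithmetic.
Context {R : realFieldType}.

(** The Gauss equation in the basis [x1 e1 + x2 e2], [y1 e1 + y2 e2] of the tangent
plane; the denominator is the square of the determinant of this basis. *)
Lemma gauss_quotient (k1 k2 al eps x1 x2 y1 y2 : R) : x1 * y2 - x2 * y1 != 0 ->
  ((k1 * y1 ^+ 2 + k2 * y2 ^+ 2) * (k1 * x1 ^+ 2 + k2 * x2 ^+ 2)
   + (al * y1 ^+ 2 - al * y2 ^+ 2) * (al * x1 ^+ 2 - al * x2 ^+ 2)
   + eps * (y1 ^+ 2 + y2 ^+ 2) * (x1 ^+ 2 + x2 ^+ 2)
   - ((k1 * (x1 * y1) + k2 * (x2 * y2)) * (k1 * (x1 * y1) + k2 * (x2 * y2))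
     + (al * (x1 * y1) - al * (x2 * y2)) * (al * (x1 * y1) - al * (x2 * y2))
     + eps * (x1 * y1 + x2 * y2) * (x1 * y1 + x2 * y2)))
  / ((x1 ^+ 2 + x2 ^+ 2) * (y1 ^+ 2 + y2 ^+ 2) - (x1 * y1 + x2 * y2) ^+ 2)
  = k1 * k2 - al ^+ 2 + eps.
Proof.
move=> d0.
have dE : (x1 ^+ 2 + x2 ^+ 2) * (y1 ^+ 2 + y2 ^+ 2) - (x1 * y1 + x2 * y2) ^+ 2
  = (x1 * y2 - x2 * y1) ^+ 2 by ring.
have d20 : (x1 * y2 - x2 * y1) ^+ 2 != 0 by rewrite expf_neq0.
rewrite dE; apply: (mulIf d20); rewrite divfK //; ring.
Qed.

Lemma leibniz_difference (a b c d x y z : R) :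
  a + b = c + d -> b = d - (x + y + z) -> a = c + x + y + z.
Proof. by move=> h1 h2; move: h1; rewrite h2; lra. Qed.

Lemma independent_det n (s t w1 w2 : 'rV[R]_n) (x1 x2 y1 y2 : R) :
  s = x1 *: w1 + x2 *: w2 -> t = y1 *: w1 + y2 *: w2 ->
  (forall a b : R, a *: s + b *: t = 0 -> a = 0 /\ b = 0) -> x1 * y2 - x2 * y1 != 0.
Proof.
move=> sE tE indep; apply/eqP => dep.
have lin (a b : R) : a *: s + b *: t = (a * x1 + b * y1) *: w1 + (a * x2 + b * y2) *: w2.
  by rewrite sE tE; apply/rowP => i; rewrite !mxE; ring.
have [y20 x20] : y2 = 0 /\ - x2 = 0.
  apply: indep; rewrite lin.
  have -> : y2 * x1 + - x2 * y1 = 0 by rewrite -dep; ring.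
  have -> : y2 * x2 + - x2 * y2 = 0 by ring.
  by rewrite !scale0r addr0.
have [y10 x10] : y1 = 0 /\ - x1 = 0.
  apply: indep; rewrite lin.
  have -> : y1 * x2 + - x1 * y2 = 0 by apply: oppr_inj; rewrite oppr0 -dep; ring.
  have -> : y1 * x1 + - x1 * y1 = 0 by ring.
  by rewrite !scale0r addr0.
have [/eqP + _] : (1 : R) = 0 /\ (0 : R) = 0; last by rewrite oner_eq0.
apply: indep; rewrite sE -[x1]opprK x10 -[x2]opprK x20 oppr0.
by rewrite !scale0r !addr0 scaler0.
Qed.

Lemma quadratic_form_values (a b y1 y2 m1 m2 m3 m4 k1 k2 : R) :
  m1 = - k1 -> m2 = 0 -> m3 = 0 -> m4 = - k2 ->
  - (a * (m1 * y1 + m2 * y2) + b * (m3 * y1 + m4 * y2)) = k1 * (a * y1) + k2 * (b * y2).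
Proof. by move=> -> -> -> ->; ring. Qed.
End GaussArithmetic.

Section GaussCurvature.
Context {R : realType} (eps : R) {M : topologicalType} (S : surface R M)
        (phi : M -> 'rV[R]_5) (E1 E2 E3 E4 : M -> 'rV[R]_5).
Local Notation vec := 'rV[R]_5.
Local Notation plane := 'rV[R]_2.
Local Notation ip := (ambient_ip eps).
Local Notation T p := (tangent_vec S phi p).
Local Notation n p := (space_form_normal eps (phi p)).
Local Notation D F p v := (dirder S phi F p v).
Hypothesis imm : isometric_immersion eps S phi.
Hypothesis frame : adapted_frame eps S phi E1 E2 E3 E4.
Hypothesis H_neq0 : forall p, mean_curvature_vector eps S phi p <> 0.

Variable x : chart R M.
Hypothesis ax : atlas S x.
Local Notation U := (cimg x).
Let oU : open U := @cimg_isopen _ _ x.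
Local Notation xi1 := (coord_vector phi x E1).
Local Notation xi2 := (coord_vector phi x E2).
Local Notation e1 := (E1 \o cinv x).
Local Notation e2 := (E2 \o cinv x).
Local Notation e3 := (E3 \o cinv x).
Local Notation e4 := (E4 \o cinv x).
Local Notation phix := (phi \o cinv x).
Let mf := chart_moving_frame imm frame H_neq0 ax.
Local Notation D1 := (dalong xi1).
Local Notation D2 := (dalong xi2).
Local Notation K1 := (coef_k1 eps e1 e3 xi1).
Local Notation K2 := (coef_k2 eps e2 e3 xi2).
Local Notation Al := (coef_al eps e1 e4 xi1).
Local Notation Be := (coef_be eps e2 e4 xi1).

Let sphi : smooth_on U phix := mf_phi mf.
Let N3 : tangent_to_N eps U phix e3. Proof. by have [] := mf_tangent mf. Qed.
Let N4 : tangent_to_N eps U phix e4. Proof. by have [] := mf_tangent mf. Qed.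
Let tE1 p : T p (E1 p). Proof. by case: frame => -[[]]. Qed.
Let tE2 p : T p (E2 p). Proof. by case: frame => -[_ []]. Qed.

(** The coordinate field of direction [h], read in the chart. *)
Let dir (h : plane) : plane -> plane := fun _ => h.
Let X (h : plane) : plane -> vec := dalong (dir h) phix.

Let sdir h : smooth_on U (dir h) := smooth_on_cst h.
Let sX h : smooth_on U (X h) := smooth_on_dalong_rV oU (sdir h) sphi.

Let XE h z : U z -> coord_field phi x h (cinv x z) = X h z.
Proof. by move=> Uz; rewrite /coord_field cinvK // /X dalongE. Qed.

Let TX h z : U z -> T (cinv x z) (X h z).
Proof.
move=> Uz; rewrite -XE //; apply/(tangent_vecP imm _ ax (cinv_cdom Uz)); by exists h.
Qed.

Let NX h : tangent_to_N eps U phix (X h).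
Proof. by split=> [|z Uz]; [exact: sX | exact: (tangent_normal imm (TX h Uz))]. Qed.

Let ipX3 h z : U z -> ip (X h z) (e3 z) = 0.
Proof. by move=> Uz; exact: (ip_tangent_E3 imm frame (TX h Uz)). Qed.

Let ipX4 h z : U z -> ip (X h z) (e4 z) = 0.
Proof. by move=> Uz; exact: (ip_tangent_E4 imm frame (TX h Uz)). Qed.

Let c1 h z := ip (X h z) (e1 z).
Let c2 h z := ip (X h z) (e2 z).

Let ipXX h k z : U z -> ip (X h z) (X k z) = c1 h z * c1 k z + c2 h z * c2 k z.
Proof. by move=> Uz; exact: (ip_tangent imm frame _ (TX h Uz)). Qed.

Let ip_X u k z : U z -> ip u (X k z) = ip u (e1 z) * c1 k z + ip u (e2 z) * c2 k z.
Proof.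
move=> Uz; rewrite (ipC _ u) (ip_tangent imm frame u (TX k Uz)).
by rewrite (mulrC (ip u (e1 z))) (mulrC (ip u (e2 z))).
Qed.

Let dir_frame (W : normedModType R) (F : plane -> W) h z : U z -> smooth_on U F ->
  dalong (dir h) F z = c1 h z *: D1 F z + c2 h z *: D2 F z.
Proof.
move=> Uz sF; have hE := mf_basis mf h Uz.
have dF := smooth_on_differentiable sF Uz.
rewrite [LHS]dalongE /dir {1}hE (derive_dirD _ _ dF) !(derive_dirZ _ _ dF) !dalongE.
by rewrite /c1 /c2 /X !dalongE.
Qed.

Hypothesis Be0 : forall z, U z -> Be z = 0.

Let second_form3 h k z : U z ->
  ip (dalong (dir h) (X k) z) (e3 z) = K1 z * (c1 h z * c1 k z) + K2 z * (c2 h z * c2 k z).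
Proof.
move=> Uz; have [_ _ [S31 S32 _ _] _] := connection_along_e1 mf (A3_offdiagonal imm frame H_neq0 ax) Uz.
have [_ _ [T31 T32 _ _] _] := connection_along_e2 mf (A3_offdiagonal imm frame H_neq0 ax)
  (A4_trace imm frame H_neq0 ax) Uz.
rewrite (dalong_skew mf (dir h) (fun y Uy => ipX3 k Uy) (NX k) N3 Uz).
rewrite (dir_frame h Uz N3.1).
have expand (a b : R) (u v : vec) : ip (a *: u + b *: v) (X k z) =
  a * (ip u (e1 z) * c1 k z + ip u (e2 z) * c2 k z) + b * (ip v (e1 z) * c1 k z + ip v (e2 z) * c2 k z).
  by rewrite ipDl !ipZl (ip_X u k Uz) (ip_X v k Uz).
apply: etrans (congr1 -%R (expand _ _ _ _)) _.
exact: quadratic_form_values S31 S32 T31 T32.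
Qed.

Let second_form4 h k z : U z ->
  ip (dalong (dir h) (X k) z) (e4 z) = Al z * (c1 h z * c1 k z) - Al z * (c2 h z * c2 k z).
Proof.
move=> Uz; have [_ _ _ [S41 S42 _ _]] := connection_along_e1 mf (A3_offdiagonal imm frame H_neq0 ax) Uz.
have [_ _ _ [T41 T42 _ _]] := connection_along_e2 mf (A3_offdiagonal imm frame H_neq0 ax)
  (A4_trace imm frame H_neq0 ax) Uz.
rewrite (dalong_skew mf (dir h) (fun y Uy => ipX4 k Uy) (NX k) N4 Uz).
rewrite (dir_frame h Uz N4.1).
have expand (a b : R) (u v : vec) : ip (a *: u + b *: v) (X k z) =
  a * (ip u (e1 z) * c1 k z + ip u (e2 z) * c2 k z) + b * (ip v (e1 z) * c1 k z + ip v (e2 z) * c2 k z).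
  by rewrite ipDl !ipZl (ip_X u k Uz) (ip_X v k Uz).
apply: etrans (congr1 -%R (expand _ _ _ _)) _.
rewrite Be0 // oppr0 in S42 T41.
by rewrite (quadratic_form_values _ _ _ _ S41 S42 T41 (etrans T42 (esym (opprK _)))) mulNr.
Qed.

(** The covariant derivative of the coordinate field [X k] along [X h]. *)
Let cov h k z := tan_part eps S phi (cinv x z) (dalong (dir h) (X k) z).

Let nabla_coord h k q : cdom x q ->
  nabla eps S phi q (coord_field phi x h q) (coord_field phi x k) = cov h k (cmap x q).
Proof.
move=> xq; have Uz := cimg_cmap xq; rewrite /nabla /cov cmapK //; congr (tan_part _ _ _ _ _).
rewrite (dirder_chart imm ax h xq (coord_field_smooth imm ax k)).
apply: etrans (esym (dalongE (dir h) _ _)) _.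
by apply: (dalong_ext oU) => // y Uy; exact: XE.
Qed.

Let scov h k : smooth_on U (cov h k).
Proof.
have sdX : smooth_on U (dalong (dir h) (X k)) := smooth_on_dalong_rV oU (sdir h) (sX k).
have [[s1 _] [s2 _]] : tangent_to_N eps U phix e1 /\ tangent_to_N eps U phix e2.
  by have [] := mf_tangent mf.
apply: smooth_on_rV => // i.
have s := smooth_onD oU
  (smooth_onM oU (smooth_on_ip eps oU sdX s1) (smooth_on_coord oU i s1))
  (smooth_onM oU (smooth_on_ip eps oU sdX s2) (smooth_on_coord oU i s2)).
by apply: (smooth_on_ext oU _ s) => z Uz; rewrite /cov (tan_partE imm frame) !mxE.
Qed.

Let nabla_nabla_coord l h k q : cdom x q ->
  nabla eps S phi q (coord_field phi x l q)
    (fun q => nabla eps S phi q (coord_field phi x h q) (coord_field phi x k))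
  = tan_part eps S phi q (dalong (dir l) (cov h k) (cmap x q)).
Proof.
move=> xq; have Uz := cimg_cmap xq; rewrite {1}/nabla; congr (tan_part _ _ _ _ _).
have E y : U y -> ((fun q => nabla eps S phi q (coord_field phi x h q) (coord_field phi x k))
    \o cinv x) y = cov h k y.
  by move=> Uy /=; rewrite nabla_coord ?cinvK //; exact: cinv_cdom.
have sF := smooth_on_ext oU (fun y Uy => esym (E y Uy)) (scov h k).
rewrite (dirder_chart imm ax l xq sF).
by apply: etrans (esym (dalongE (dir l) _ _)) _; exact: (dalong_ext oU).
Qed.

(** The derivative in R^5 and the covariant derivative of [X k] differ by components
along [e3], [e4] and [eps phi], whose products with [X m] vanish; differentiating these
products gives the three correction terms. *)
Let ip_cov_derivative l h k m z : U z ->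
  ip (dalong (dir l) (cov h k) z) (X m z) =
    ip (dalong (dir l) (dalong (dir h) (X k)) z) (X m z)
  + ip (dalong (dir h) (X k) z) (e3 z) * ip (dalong (dir l) (X m) z) (e3 z)
  + ip (dalong (dir h) (X k) z) (e4 z) * ip (dalong (dir l) (X m) z) (e4 z)
  + eps * ip (X k z) (X h z) * ip (X m z) (X l z).
Proof.
move=> Uz.
have sA : smooth_on U (dalong (dir h) (X k)) := smooth_on_dalong_rV oU (sdir h) (sX k).
have r1 := dalong_ip eps oU (dir l) (scov h k) (sX m) Uz.
have r2 := dalong_ip eps oU (dir l) sA (sX m) Uz.
have same : dalong (dir l) (fun y => ip (cov h k y) (X m y)) z
    = dalong (dir l) (fun y => ip (dalong (dir h) (X k) y) (X m y)) z.
  apply: (dalong_ext oU) => // y Uy.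
  exact: (ip_tan_part imm frame _ (TX m Uy)).
have covE : cov h k z = dalong (dir h) (X k) z
   - (ip (dalong (dir h) (X k) z) (e3 z) *: e3 z + ip (dalong (dir h) (X k) z) (e4 z) *: e4 z
     - (eps * ip (X k z) (X h z)) *: phix z).
  have W := weingarten mf (xi := dir h) (e := X h) (fun y _ => erefl) (NX k) Uz.
  move: W; rewrite /cov (tan_partE imm frame).
  move: (dalong (dir h) (X k) z) => A W; rewrite [X in _ = X - _]W.
  by apply/rowP => i; rewrite !mxE; ring.
have radial := eps_ip_phi mf (xi := dir l) (e := X l) (fun y _ => erefl) (NX m) Uz.
have expand (A B u v w : vec) (a b c d e : R) : B = A - (a *: u + b *: v - (eps * c) *: w) ->
   forall V, eps * ip w V = - (eps * d) ->
   ip B V = ip A V - (a * ip V u + b * ip V v + eps * c * d).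
  move=> -> V wV; rewrite ipBl ipBl ipDl !ipZl (ipC _ u) (ipC _ v) mulrAC wV.
  by move: (ip A V) (ip V u) (ip V v) => i j k'; ring.
have covip := expand _ _ _ _ _ _ _ _ _ 0 covE _ radial.
exact: leibniz_difference (etrans (esym r1) (etrans same r2)) covip.
Qed.

Let ip_cov_derivative_coefs l h k m z : U z ->
  ip (dalong (dir l) (cov h k) z) (X m z) =
    ip (dalong (dir l) (dalong (dir h) (X k)) z) (X m z)
  + (K1 z * (c1 h z * c1 k z) + K2 z * (c2 h z * c2 k z))
    * (K1 z * (c1 l z * c1 m z) + K2 z * (c2 l z * c2 m z))
  + (Al z * (c1 h z * c1 k z) - Al z * (c2 h z * c2 k z))
    * (Al z * (c1 l z * c1 m z) - Al z * (c2 l z * c2 m z))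
  + eps * (c1 k z * c1 h z + c2 k z * c2 h z) * (c1 m z * c1 l z + c2 m z * c2 l z).
Proof.
move=> Uz; apply: etrans (ip_cov_derivative l h k m Uz) _.
congr (_ + _ * _ + _ * _ + _ * _ * _).
- exact: second_form3.
- exact: second_form3.
- exact: second_form4.
- exact: second_form4.
- exact: ipXX.
- exact: ipXX.
Qed.

(** The coordinate fields commute, so the curvature is the difference of two second
covariant derivatives; the derivatives in R^5 cancel by symmetry and the correction
terms of [ip_cov_derivative] remain. *)
Lemma gauss_curvature_in_chart q : cdom x q ->
  let X := coord_field phi x e_s in
  let Y := coord_field phi x e_t in
  ip (curvature S phi (nabla eps S phi) X Y Y q) (X q)
    / (ip (X q) (X q) * ip (Y q) (Y q) - ip (X q) (Y q) ^+ 2)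
  = k1 eps S phi E1 E3 q * k2 eps S phi E2 E3 q - alpha eps S phi E1 E4 q ^+ 2 + eps.
Proof.
move=> xq; pose z := cmap x q; have Uz : U z by exact: cimg_cmap.
have qz : q = cinv x z by rewrite /z cmapK.
rewrite qz (k1_chart imm frame H_neq0 ax Uz) (k2_chart imm frame H_neq0 ax Uz)
  (alpha_chart imm frame H_neq0 ax Uz) -qz.
set s := @e_s R; set t := @e_t R; move=> XX YY.
have XzE : XX q = X s z by rewrite /XX qz XE.
have YzE : YY q = X t z by rewrite /YY qz XE.
have commute n' (F : plane -> 'rV[R]_n') : smooth_on U F ->
    dalong (dir s) (dalong (dir t) F) z = dalong (dir t) (dalong (dir s) F) z.
  move=> sF; apply/eqP; rewrite -subr_eq0; apply/eqP.
  apply: etrans (dalong_commutator_rV oU (sdir s) (sdir t) sF Uz) _.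
  by rewrite /dir !derive_cst subrr derive0.
have bracket0 : bracket S phi XX YY q = 0.
  rewrite /bracket /XX /YY (dirder_chart imm ax s xq (coord_field_smooth imm ax t)).
  rewrite (dirder_chart imm ax t xq (coord_field_smooth imm ax s)).
  have toD h k : 'D_h (coord_field phi x k \o cinv x) z = dalong (dir h) (X k) z.
    apply: etrans (esym (dalongE (dir h) _ _)) _.
    by apply: (dalong_ext oU) => // y Uy; exact: XE.
  by rewrite !toD (commute _ _ sphi) subrr.
have nabla0 : nabla eps S phi q 0 YY = 0.
  have zeroE : (0 : vec) = coord_field phi x 0 q by rewrite /coord_field derive0.
  rewrite /nabla {1}zeroE /YY (dirder_chart imm ax 0 xq (coord_field_smooth imm ax t)).
  by rewrite derive0 (tan_partE imm frame) !ip0l !scale0r addr0.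
have curvE : ip (curvature S phi (nabla eps S phi) XX YY YY q) (XX q)
   = ip (dalong (dir s) (cov t t) z) (X s z) - ip (dalong (dir t) (cov s t) z) (X s z).
  rewrite /curvature bracket0 nabla0 subr0.
  rewrite (nabla_nabla_coord s t t xq) (nabla_nabla_coord t s t xq) XzE ipBl.
  have Tq : T q (X s z) by rewrite qz; exact: TX.
  by congr (_ - _); exact: (ip_tan_part imm frame _ Tq).
have numE : ip (dalong (dir s) (cov t t) z) (X s z) - ip (dalong (dir t) (cov s t) z) (X s z)
  = (K1 z * c1 t z ^+ 2 + K2 z * c2 t z ^+ 2) * (K1 z * c1 s z ^+ 2 + K2 z * c2 s z ^+ 2)
   + (Al z * c1 t z ^+ 2 - Al z * c2 t z ^+ 2) * (Al z * c1 s z ^+ 2 - Al z * c2 s z ^+ 2)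
   + eps * (c1 t z ^+ 2 + c2 t z ^+ 2) * (c1 s z ^+ 2 + c2 s z ^+ 2)
   - ((K1 z * (c1 s z * c1 t z) + K2 z * (c2 s z * c2 t z))
       * (K1 z * (c1 s z * c1 t z) + K2 z * (c2 s z * c2 t z))
     + (Al z * (c1 s z * c1 t z) - Al z * (c2 s z * c2 t z))
       * (Al z * (c1 s z * c1 t z) - Al z * (c2 s z * c2 t z))
     + eps * (c1 s z * c1 t z + c2 s z * c2 t z) * (c1 s z * c1 t z + c2 s z * c2 t z)).
  have r1 := ip_cov_derivative_coefs s t t s Uz.
  have r2 := ip_cov_derivative_coefs t s t s Uz.
  rewrite (commute _ _ (sX t)) in r1.
  apply: etrans (f_equal2 (fun a b => a - b) r1 r2) _; move: (ip _ _) (K1 z) (K2 z) (Al z) (c1 s z) (c2 s z) (c1 t z) (c2 t z).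
  by move=> d k k' al x1 x2 y1 y2; ring.
have denE : ip (XX q) (XX q) * ip (YY q) (YY q) - ip (XX q) (YY q) ^+ 2
  = (c1 s z ^+ 2 + c2 s z ^+ 2) * (c1 t z ^+ 2 + c2 t z ^+ 2)
    - (c1 s z * c1 t z + c2 s z * c2 t z) ^+ 2.
  rewrite XzE YzE; congr (_ * _ - _ ^+ 2); last exact: ipXX.
    by rewrite !expr2; exact: ipXX.
  by rewrite !expr2; exact: ipXX.
apply: etrans (f_equal2 (fun a b => a / b) (etrans curvE numE) denE) _.
apply: gauss_quotient.
have frameE h : h = c1 h z *: xi1 z + c2 h z *: xi2 z.
  by rewrite {1}(mf_basis mf h Uz) /c1 /c2 /X !dalongE.
have indep (a b : R) : a *: s + b *: t = 0 -> a = 0 /\ b = 0.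
  move=> /rowP E; have := E ord0; have := E ord_max.
  by rewrite /s /t /e_s /e_t !mxE /= !mulr1 !mulr0 addr0 add0r.
exact: (independent_det (frameE s) (frameE t) indep).
Qed.
End GaussCurvature.

(** * The surfaces of curvature eps *)

Section FundamentalEquationValues.
Context {R : realFieldType}.

Lemma codazzi31_values (d d' be b1 a1 k al b2 h h' : R) :
  - d = be * b1 - a1 * k - al * b2 + a1 * h -> d = d' -> be = 0 -> h = h' ->
  - d' = - a1 * k - al * b2 + a1 * h'.
Proof. by move=> E <- b0 <-; rewrite E b0; ring. Qed.

Lemma codazzi32_values (d be b1 b2 a2 k al h h' : R) :
  d = - a2 * h - al * b1 - be * b2 + a2 * k -> be = 0 -> h = h' ->
  d = - a2 * h' - al * b1 + a2 * k.
Proof. by move=> E b0 <-; rewrite E b0; ring. Qed.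

Lemma gauss_flat_values (h h' k al eps K : R) :
  K = eps -> K = h * k - al ^+ 2 + eps -> h = h' -> k * h' = al ^+ 2.
Proof. by move=> -> E <-; lra. Qed.

Lemma gauss_intrinsic_values (d h h' k al be eps a1 a2 : R) :
  d = h * k - al ^+ 2 - be ^+ 2 + eps + a1 ^+ 2 + a2 ^+ 2 -> be = 0 -> h = h' ->
  k * h' = al ^+ 2 -> d = eps + a1 ^+ 2 + a2 ^+ 2.
Proof. by move=> E b0 hE G; rewrite E b0 hE -G; ring. Qed.

Lemma half_sum_values (f h k : R) : f = 2^-1 * (h + k) -> h = 2 * f - k.
Proof. by move=> ->; field. Qed.

Lemma normal_connection_value (f f1 k c al b1 : R) : 0 < f -> 0 < al -> k = c * f ^+ 2 ->
  f1 * (2 * f - k + f) = - (f * b1 * al) -> b1 = - (f1 * (3 - c * f) / al).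
Proof.
move=> f0 al0 -> E; have fn : f != 0 by rewrite gt_eqF.
have an : al != 0 by rewrite gt_eqF.
apply: (mulIf an); apply: (mulfI fn).
have -> : f * (b1 * al) = - (- (f * b1 * al)) by ring.
by rewrite -E; field.
Qed.

Lemma tangent_connection_value (f f1 a2 : R) : 0 < f -> 2 * f * a2 = 3 * f1 -> a2 = 3 / 2 * (f1 / f).
Proof.
move=> f0 E; have fn : f != 0 by rewrite gt_eqF.
have -> : f1 = 2 * f * a2 / 3 by rewrite E; field.
by field.
Qed.
End FundamentalEquationValues.

Section PowerValues.
Context {R : realType}.

Lemma powR_half3_sqr (f : R) : 0 < f -> (f `^ (3 / 2)) ^+ 2 = f ^+ 3.
Proof.
move=> f0; rewrite -(powR_mulrn 3 (ltW f0)) -(powR_mulrn 2 (powR_ge0 _ _)) -powRrM.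
by congr (_ `^ _); field.
Qed.

Lemma alpha_value_sqr (f c : R) : 0 < f -> 0 < c -> 0 <= 2 - c * f ->
  (Num.sqrt c * f `^ (3 / 2) * Num.sqrt (2 - c * f)) ^+ 2 = (c * f ^+ 2) * (2 * f - c * f ^+ 2).
Proof.
move=> f0 c0 h; rewrite !exprMn powR_half3_sqr // !sqr_sqrtr // ?(ltW c0) //; ring.
Qed.

(** Both factors of [c f (2 - c f) = al ^ 2 / f ^ 2] are positive, because their sum
[c f + (2 - c f)] is. *)
Lemma alpha_value (f k c al : R) : 0 < f -> 0 < al -> k = c * f ^+ 2 -> k * (2 * f - k) = al ^+ 2 ->
  0 < c /\ al = Num.sqrt c * f `^ (3 / 2) * Num.sqrt (2 - c * f).
Proof.
move=> f0 al0 kE E.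
have pos : 0 < (c * f) * (2 - c * f).
  have : 0 < al ^+ 2 by rewrite exprn_gt0.
  rewrite -E kE; have -> : c * f ^+ 2 * (2 * f - c * f ^+ 2) = f ^+ 2 * (c * f * (2 - c * f)) by ring.
  by rewrite pmulr_rgt0 // exprn_gt0.
have cf0 : 0 < c * f by nra.
have h0 : 0 < 2 - c * f by nra.
have c0 : 0 < c by move: cf0; rewrite pmulr_lgt0.
split=> //; apply/eqP; rewrite -(@eqrXn2 _ 2) ?(ltW al0) //.
  by rewrite (alpha_value_sqr f0 c0 (ltW h0)) -kE E.
by rewrite !mulr_ge0 ?sqrtr_ge0 ?powR_ge0.
Qed.
End PowerValues.

Section ConstantCurvatureSurface.
Context {R : realType} (eps : R) {M : topologicalType} (S : surface R M)
        (phi : M -> 'rV[R]_5) (E1 E2 E3 E4 : M -> 'rV[R]_5).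
Local Notation vec := 'rV[R]_5.
Local Notation plane := 'rV[R]_2.
Local Notation ip := (ambient_ip eps).
Local Notation f p := (mean_curvature eps S phi p).
Hypothesis imm : isometric_immersion eps S phi.
Hypothesis flat : flat_normal_bundle eps S phi.
Hypothesis bic : nonCMC_biconservative eps S phi.
Hypothesis frame : adapted_frame eps S phi E1 E2 E3 E4.
Hypothesis sign : sign_convention eps S phi E1 E4.

Let H_neq0 p : mean_curvature_vector eps S phi p <> 0.
Proof. by case: bic => _ /(_ p)[]. Qed.

Let umb p : ~ (forall v, tangent_vec S phi p v ->
  shape_operator eps S phi p (unit_mean_curvature eps S phi p) v = f p *: v).
Proof. by case: bic => _ /(_ p)[]. Qed.

(** All charts of the atlas give the same value, so the choice of a chart in the
definition of [gauss_curvature] is immaterial. *)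
Lemma gauss_curvatureE p : gauss_curvature eps S phi p
  = k1 eps S phi E1 E3 p * k2 eps S phi E2 E3 p - alpha eps S phi E1 E4 p ^+ 2 + eps.
Proof.
have [x ax xp] := exists_chart S p.
have be0 y (ay : atlas S y) z := @A4_offdiagonal _ _ _ _ _ _ _ _ _ imm frame H_neq0 y ay z flat umb.
apply: xget_unique => [|v [y [ay yp ->]]].
  exists x; split=> //=; apply: esym.
  exact: (gauss_curvature_in_chart imm frame H_neq0 ax (be0 x ax) xp).
exact: (gauss_curvature_in_chart imm frame H_neq0 ay (be0 y ay) yp).
Qed.

Lemma k1E p : k1 eps S phi E1 E3 p = 2 * f p - k2 eps S phi E2 E3 p.
Proof.
have [x ax xp] := exists_chart S p; have Uz := cimg_cmap xp.
apply: half_sum_values; have := mean_curvature_chart imm frame H_neq0 ax Uz.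
by rewrite -(k1_chart imm frame H_neq0 ax Uz) -(k2_chart imm frame H_neq0 ax Uz) cmapK.
Qed.

Section InChart.
Variable x : chart R M.
Hypothesis ax : atlas S x.
Local Notation U := (cimg x).
Let oU : open U := @cimg_isopen _ _ x.
Local Notation xi1 := (coord_vector phi x E1).
Local Notation xi2 := (coord_vector phi x E2).
Local Notation e1 := (E1 \o cinv x).
Local Notation e2 := (E2 \o cinv x).
Local Notation e3 := (E3 \o cinv x).
Local Notation e4 := (E4 \o cinv x).
Local Notation fz := ((fun p => f p) \o cinv x).
Local Notation D1 := (dalong xi1).
Local Notation D2 := (dalong xi2).
Local Notation a1 := (conn1 eps e1 e2 xi1).
Local Notation a2 := (conn2 eps e1 e2 xi2).
Local Notation K1 := (coef_k1 eps e1 e3 xi1).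
Local Notation K2 := (coef_k2 eps e2 e3 xi2).
Local Notation Al := (coef_al eps e1 e4 xi1).
Local Notation Be := (coef_be eps e2 e4 xi1).
Local Notation B1 := (coef_b1 eps e3 e4 xi1).
Local Notation B2 := (coef_b2 eps e3 e4 xi2).
Let mf := chart_moving_frame imm frame H_neq0 ax.
Let h3 := A3_offdiagonal imm frame H_neq0 ax.
Let h4 := A4_trace imm frame H_neq0 ax.
Let be0 z : U z -> Be z = 0 := @A4_offdiagonal _ _ _ _ _ _ _ _ _ imm frame H_neq0 x ax z flat umb.

Let K1E z : U z -> K1 z = 2 * fz z - K2 z.
Proof.
by move=> Uz; apply: half_sum_values; exact: (mean_curvature_chart imm frame H_neq0 ax Uz).
Qed.

(** The curvature enters through [k (2 f - k) = al ^ 2] alone; the other equations are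
those of a biconservative surface with flat normal bundle. *)
Lemma chart_constant_curvature_frame : (forall p, gauss_curvature eps S phi p = eps) ->
  constant_curvature_frame eps U xi1 xi2 fz K2 Al a1 a2 B1 B2.
Proof.
move=> Keps.
have [[sa1 sa2 _] [_ sK2 sAl sB1 sB2]] := smooth_coefs imm frame H_neq0 ax.
have gauss z : U z -> K2 z * (2 * fz z - K2 z) = Al z ^+ 2.
  move=> Uz; apply: gauss_flat_values (Keps (cinv x z)) _ (K1E Uz).
  rewrite gauss_curvatureE (k1_chart imm frame H_neq0 ax Uz) (k2_chart imm frame H_neq0 ax Uz).
  by rewrite (alpha_chart imm frame H_neq0 ax Uz).
split=> //.
- by split; [exact: mf_xi1 mf | exact: mf_xi2 mf].
- by split=> //; exact: (mean_curvature_smooth imm frame H_neq0 ax).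
- by move=> F sF z Uz; exact: (frame_commutator_scalar mf sF Uz).
- move=> z Uz; have [D1f_gt0 al_gt0] := sign (cinv x z); split.
  + exact: (mean_curvature_pos imm frame H_neq0).
  + by rewrite -(alpha_chart imm frame H_neq0 ax Uz).
  + by rewrite -(along_E1_f imm frame H_neq0 ax Uz).
- move=> z Uz; exact: (gauss_intrinsic_values (gauss_equation mf h3 h4 Uz) (be0 Uz) (K1E Uz) (gauss z Uz)).
- move=> z Uz; exact: (codazzi31_values (codazzi_31 mf h3 h4 Uz)
    (dalong_ext oU xi2 K1E Uz) (be0 Uz) (K1E Uz)).
- move=> z Uz; exact: (codazzi32_values (codazzi_32 mf h3 h4 Uz) (be0 Uz) (K1E Uz)).
- move=> z Uz; apply: etrans (codazzi_41 mf h3 h4 Uz be0) _.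
  by congr (_ - _ * _); exact: K1E.
- by move=> z Uz; exact: (codazzi_42 mf h3 h4 Uz be0).
- by move=> z Uz; exact: (flat_ricci imm frame H_neq0 ax flat Uz).
- move=> z Uz; have [q1 q2] := biconservative_chart imm frame H_neq0 ax bic.1 be0 Uz.
  by split=> //; apply: etrans q1; congr (_ * (_ + _)); exact: esym (K1E Uz).
Qed.
End InChart.
End ConstantCurvatureSurface.

Theorem theorem3p17 (R : realType) (eps : R) (M : topologicalType)
    (S : surface R M) (phi : M -> 'rV[R]_5) (E1 E2 E3 E4 : M -> 'rV[R]_5) :
  isometric_immersion eps S phi ->
  flat_normal_bundle eps S phi ->
  nonCMC_biconservative eps S phi ->
  W_surface eps S phi ->
  adapted_frame eps S phi E1 E2 E3 E4 ->
  labelling_convention eps S phi E1 E2 E3 E4 ->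
  sign_convention eps S phi E1 E4 ->
  (forall p, 3 * mean_curvature eps S phi p ^+ 2
             + gauss_curvature eps S phi p - eps != 0) ->
  nowhere_parallel eps S phi E3 ->
  (forall p, exists2 v, tangent_vec S phi p v & shape_operator eps S phi p (E4 p) v != 0) ->
  (forall p, nabla eps S phi p (E2 p) E2 != 0) ->
  (forall p, gauss_curvature eps S phi p = eps) <->
  (forall p, exists (x : chart R M)
     (g22 f_ k1_ k2_ alpha_ a2_ b1_ K_ : R -> R) (c : R),
     [/\ cdom x p, adapted_coordinates eps S phi E1 E2 x g22,
         [/\ depends_on_s x (mean_curvature eps S phi) f_,
             depends_on_s x (k1 eps S phi E1 E3) k1_,
             depends_on_s x (k2 eps S phi E2 E3) k2_ &
             depends_on_s x (alpha eps S phi E1 E4) alpha_],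
         [/\ depends_on_s x (a2 eps S phi E1 E2) a2_,
             depends_on_s x (b1 eps S phi E1 E3 E4) b1_ &
             depends_on_s x (gauss_curvature eps S phi) K_] &
         0 < c /\
         forall s, s_range x s ->
           [/\ b1_ s = - (derive1 f_ s * (3 - c * f_ s)
                          / (Num.sqrt c * f_ s `^ (3 / 2)
                             * Num.sqrt (2 - c * f_ s))),
               a2_ s = 3 / 2 * (derive1 f_ s / f_ s),
               alpha_ s = Num.sqrt c * f_ s `^ (3 / 2)
                          * Num.sqrt (2 - c * f_ s),
               k2_ s = c * f_ s ^+ 2 &
               [/\ derive1n 2 f_ s * f_ s - 5 / 2 * derive1 f_ s ^+ 2
                     - 2 / 3 * eps * f_ s ^+ 2 = 0,
                   0 < f_ s & 0 < derive1 f_ s]]]).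
Proof.
move=> imm flat bic _ frame _ sign _ _ _ _.
have H_neq0 p : mean_curvature_vector eps S phi p <> 0 by case: bic => _ /(_ p)[].
split=> [Keps p|local p]; last first.
- have [x [g22 [f_ [k1_ [k2_ [al_ [a2_ [b1_ [K_ [c [xp _ [fE _ kE aE] _ [c0 H]]]]]]]]]]]] := local p.
  have [_ _ alE k2E [_ f0 _]] := H (coord_s x p) (ex_intro2 _ _ p xp erefl).
  have [_ al0] := sign p.
  rewrite (gauss_curvatureE imm flat bic frame) (k1E imm bic frame) kE // fE // aE // k2E alE.
  rewrite aE // alE in al0.
  rewrite alpha_value_sqr //; first by ring.
  have : Num.sqrt (2 - c * f_ (coord_s x p)) != 0.
    by apply/eqP => E; rewrite E mulr0 ltxx in al0.
  by rewrite sqrtr_eq0 -ltNge => /ltW.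
have [x0 ax xp] := exists_chart S p; have Uz0 := cimg_cmap xp.
have mf := chart_moving_frame imm frame H_neq0 ax.
have be0 z : cimg x0 z -> _ := @A4_offdiagonal _ _ _ _ _ _ _ _ _ imm frame H_neq0 x0 ax z flat
  (fun p => let: And3 _ _ u := bic.2 p in u).
have ccf := chart_constant_curvature_frame imm flat bic frame sign ax Keps.
have [c [B [Phi [Psi [f_ [[oB Bz0 BU oPB PsiK] [[cPsi sPhi sPsi DPsi] values]]]]]]] :=
  frame_coordinates mf (A3_offdiagonal imm frame H_neq0 ax) (A4_trace imm frame H_neq0 ax) be0 ccf Uz0.
have [x [domE mapE invE lx]] := reparametrized_chart ax oB BU oPB PsiK cPsi sPhi sPsi.
have tE1 q : tangent_vec S phi q (E1 q) by case: frame => -[[]].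
have tE2 q : tangent_vec S phi q (E2 q) by case: frame => -[_ []].
have dphi u : (Phi @` B) u -> differentiable (phi \o cinv x0) (Psi u).
  by move=> [z Bz <-]; rewrite PsiK //; exact: smooth_on_differentiable (mf_phi mf) (BU z Bz).
have fieldE q h : cdom x q -> coord_field phi x h q
    = 'D_('D_h Psi (Phi (cmap x0 q))) (phi \o cinv x0) (cmap x0 q).
  rewrite domE => -[xq Bq]; rewrite /coord_field mapE invE.
  have Bu : (Phi @` B) (Phi (cmap x0 q)) by exists (cmap x0 q).
  rewrite -[phi \o _]/((phi \o cinv x0) \o Psi) derive_chain; last exact: dphi.
    by rewrite /= PsiK.
  exact: smooth_on_differentiable sPsi Bu.
have field_s q : cdom x q -> coord_field phi x e_s q = E1 q.
  move=> xq; rewrite fieldE //; move: xq; rewrite domE => -[xq Bq].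
  by rewrite (DPsi _ Bq).1 (coord_vectorP imm ax tE1 (BU _ Bq)) cmapK.
pose r s := f_ s `^ (3 / 2).
have sE q : cdom x q -> coord_s x q = Phi (cmap x0 q) 0 ord0 by rewrite /coord_s mapE.
have fE q : cdom x q -> f_ (coord_s x q) = mean_curvature eps S phi q.
  move=> xq; rewrite sE //; move: xq; rewrite domE => -[xq Bq].
  by have [_ [-> _ _]] := values _ Bq; rewrite /= cmapK.
have f_gt0 q : 0 < mean_curvature eps S phi q by exact: (mean_curvature_pos imm frame H_neq0).
have r_gt0 q : cdom x q -> 0 < r (coord_s x q) by move=> xq; rewrite powR_gt0 // fE.
have field_t q : cdom x q -> coord_field phi x e_t q = (r (coord_s x q))^-1 *: E2 q.
  move=> xq'; rewrite fieldE // /r fE //; move: xq'; rewrite domE => -[xq Bq].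
  rewrite (DPsi _ Bq).2 derive_dirZ ?(coord_vectorP imm ax tE2 (BU _ Bq)) /= ?cmapK //.
  exact: smooth_on_differentiable (mf_phi mf) (BU _ Bq).
have [ip11 ip22 ip12] : [/\ forall q, ambient_ip eps (E1 q) (E1 q) = 1,
    forall q, ambient_ip eps (E2 q) (E2 q) = 1 & forall q, ambient_ip eps (E1 q) (E2 q) = 0].
  by split=> q; case: frame => _ _ _ /(_ q)[].
have pointwise q : cdom x q -> let s := coord_s x q in
    [/\ k2 eps S phi E2 E3 q = c * f_ s ^+ 2,
        0 < c /\ alpha eps S phi E1 E4 q = Num.sqrt c * f_ s `^ (3 / 2) * Num.sqrt (2 - c * f_ s),
        a2 eps S phi E1 E2 q = 3 / 2 * (derive1 f_ s / f_ s),
        b1 eps S phi E1 E3 E4 q = - (derive1 f_ s * (3 - c * f_ s)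
          / (Num.sqrt c * f_ s `^ (3 / 2) * Num.sqrt (2 - c * f_ s))) &
        derive1n 2 f_ s * f_ s - 5 / 2 * derive1 f_ s ^+ 2 - 2 / 3 * eps * f_ s ^+ 2 = 0
        /\ 0 < derive1 f_ s].
  move=> xq s; rewrite {}/s (sE q xq); move: xq; rewrite domE => -[xq Bq].
  have Uz := BU _ Bq; have [kE [v0 v1 v2]] := values _ Bq; rewrite v0 v1 v2.
  have [fz0 alz0 D1f0] := ccf_pos ccf Uz; have [ha2 _] := a2_and_D1k ccf Uz.
  have [c0 alE] := alpha_value fz0 alz0 kE (ccf_gauss ccf Uz).
  have kq := k2_chart imm frame H_neq0 ax Uz; have aq := alpha_chart imm frame H_neq0 ax Uz.
  have a2q := a2_chart imm frame ax Uz; have bq := b1_chart imm frame ax Uz.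
  rewrite cmapK // in kq aq a2q bq; rewrite kq aq a2q bq.
  split=> //; first exact: tangent_connection_value.
    rewrite -alE; exact: normal_connection_value fz0 alz0 kE (ccf_biconservative ccf Uz).1.
  by split=> //; exact: (mean_curvature_ode ccf Uz).
have xp' : cdom x p by rewrite domE.
(* the coordinate field of [t] is [r ^ (-1) E2], so that [g22 = r ^ (-2)] *)
exists x, (fun s => (r s)^-1 ^+ 2), f_, (fun s => 2 * f_ s - c * f_ s ^+ 2),
  (fun s => c * f_ s ^+ 2),
  (fun s => Num.sqrt c * f_ s `^ (3 / 2) * Num.sqrt (2 - c * f_ s)),
  (fun s => 3 / 2 * (derive1 f_ s / f_ s)),
  (fun s => - (derive1 f_ s * (3 - c * f_ s) / (Num.sqrt c * f_ s `^ (3 / 2) * Num.sqrt (2 - c * f_ s)))),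
  (fun => eps), c; split=> //.
- split=> // q xq; have rq := r_gt0 q xq; rewrite field_s // field_t // ipZr ipZl ipZr ip11 ip12 ip22.
  split=> //; [by rewrite mulr0 | by rewrite mulr1 expr2 | ].
  rewrite sqrtr_sqr ger0_norm ?invr_ge0 ?ltW // invrK scalerA divff ?scale1r //.
  by rewrite gt_eqF.
- split=> q xq.
  + by rewrite fE.
  + by have [k2E _ _ _ _] := pointwise q xq; rewrite (k1E imm bic frame) k2E fE.
  + by have [] := pointwise q xq.
  + by have [_ []] := pointwise q xq.
- by split=> q xq //; have [] := pointwise q xq.
- split; first by have [_ []] := pointwise p xp'.
  move=> s [q xq <-]; split=> //.
  by have [_ _ _ _ [ode f1]] := pointwise q xq; split=> //; rewrite fE.
Qed.
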